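(* Let $d\ge 2$ be an integer. Let $w\colon(0,\infty)\to[0,\infty)$ be a measurable function with $$\int_0^1 w(r)\,r^{d-1}\,dr+\int_1^\infty w(r)\,dr<\infty .$$ Assume that the Fourier transforms of $w$ as a radial function on $\mathbb{R}^d$ and on $\mathbb{R}^{d+1}$ are both non-negative, in the sense that for each $n\in\{d,d+1\}$, $$\int_{x\in\mathbb{R}^n} w(|x|)\exp(-\varepsilon|x|^2)\exp(-ix\cdot\xi)\,dx\ \ge 0\qquad\text{for every }\varepsilon\in(0,\infty)\text{ and every }\xi\in\mathbb{R}^n .$$ Then $$\mathbf{C}_{\mathrm S}^{(d+1)}(w,\psi)\le \mathbf{C}_{\mathrm S}^{(d)}(w,\psi)$$ for every continuous function $\psi\colon(0,\infty)\to[0,\infty)$, where $\mathbf{C}_{\mathrm S}^{(n)}(w,\psi)$ denotes the optimal constant of the smoothing estimate for the free Schrödinger equation on $\mathbb{R}^n$ with spatial weight $w$ and smoothing function $\psi$.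
   Context: For an integer $n\ge1$, a measurable $w\colon(0,\infty)\to[0,\infty)$ (spatial weight) and a continuous $\psi\colon(0,\infty)\to[0,\infty)$ (smoothing function), $\mathbf{C}_{\mathrm S}^{(n)}(w,\psi)\in[0,\infty]$ denotes the optimal (i.e. smallest) constant $C$ in the inequality $$\int_{(x,t)\in\mathbb{R}^n\times\mathbb{R}} w(|x|)\,\bigl|\psi(|\nabla|)e^{it\Delta}u_0(x)\bigr|^2\,dx\,dt\le C\|u_0\|_{L^2(\mathbb{R}^n)}^2,\qquad u_0\in L^2(\mathbb{R}^n),$$ (with value $\infty$ if no finite $C$ works), or equivalently $$\frac1{(2\pi)^n}\int_{t\in\mathbb{R}}\int_{x\in\mathbb{R}^n} w(|x|)\left|\int_{\xi\in\mathbb{R}^n}e^{ix\cdot\xi}\psi(|\xi|)e^{-it|\xi|^2}\widehat{u_0}(\xi)\,d\xi\right|^2dx\,dt\le C\|\widehat{u_0}\|_{L^2(\mathbb{R}^n)}^2 .$$ Here $\widehat{u_0}(\xi)=(2\pi)^{-n/2}\int_{\mathbb{R}^n}u_0(x)e^{-ix\cdot\xi}\,dx$, and $\psi(|\nabla|)$ is the Fourier multiplier with symbol $\psi(|\xi|)$. *)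

(* Defs.v *)
From HB Require Import structures.
From mathcomp Require Import all_boot all_order all_algebra.
From mathcomp Require Import complex.
From mathcomp Require Import all_classical all_reals all_analysis.

Set Implicit Arguments.
Unset Strict Implicit.
Unset Printing Implicit Defensive.

Import Order.TTheory GRing.Theory Num.Theory.
Import numFieldNormedType.Exports.

Local Open Scope classical_set_scope.
Local Open Scope ring_scope.
Local Open Scope complex_scope.

(* n-tuples carry the product sigma-algebra, here the Borel sigma-algebra. *)
Notation Rn R n := (n.-tuple (measurableTypeR R)).

Section lebesgue_tuple.
Context {R : realType}.

Definition tcons n (z : measurableTypeR R * Rn R n) : Rn R n.+1 :=
  [tuple of z.1 :: z.2].

Definition tuncons n (t : Rn R n.+1) : measurableTypeR R * Rn R n :=
  (thead t, [tuple of behead t]).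

Lemma tconsK n : cancel (@tcons n) (@tuncons n).
Proof.
move=> [a s]; rewrite /tuncons /tcons /=; congr pair; exact: val_inj.
Qed.

Lemma measurable_tcons n : measurable_fun setT (@tcons n).
Proof. exact: measurable_cons. Qed.

Lemma measurable_tuncons n : measurable_fun setT (@tuncons n).
Proof.
apply: measurable_fun_pair; first exact: measurable_tnth.
exact: measurable_behead.
Qed.

Section step.
Context n (m : {sigma_finite_measure set (Rn R n) -> \bar R}).

Definition lebesgue_cons : set (Rn R n.+1) -> \bar R :=
  pushforward (@lebesgue_measure R \x m)%E (@tcons n).

Let lebesgue_cons0 : lebesgue_cons set0 = 0%E.
Proof. by rewrite /lebesgue_cons /pushforward preimage_set0 measure0. Qed.

Let lebesgue_cons_ge0 A : (0 <= lebesgue_cons A)%E.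
Proof. by rewrite /lebesgue_cons /pushforward; exact: measure_ge0. Qed.

Let lebesgue_cons_sigma_additive : semi_sigma_additive lebesgue_cons.
Proof.
exact: (@measure_semi_sigma_additive _ _ _
  (measure_function_pushforward__canonical__measure_function_Measure
     (@lebesgue_measure R \x m)%E (@measurable_tcons n))).
Qed.

HB.instance Definition _ := isMeasure.Build _ _ _ lebesgue_cons
  lebesgue_cons0 lebesgue_cons_ge0 lebesgue_cons_sigma_additive.

Let lebesgue_cons_sigma_finite : sigma_finite setT lebesgue_cons.
Proof.
have /sigma_finiteP[F [FT Fnd Foo]] := sigma_finiteT (@lebesgue_measure R).
have /sigma_finiteP[G [GT Gnd Goo]] := sigma_finiteT m.
exists (fun i => @tuncons n @^-1` (F i `*` G i)).
  rewrite -preimage_bigcup (_ : \bigcup_i _ = setT) ?preimage_setT//.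
  rewrite -setXTT FT GT predeqE => -[x y]; split.
    by move=> [i _ []/= ? ?]; split; exists i.
  move=> [/= [i _ Fix] [k _ Gky]]; exists (maxn i k) => //; split.
  - by move: x Fix; exact/subsetPset/Fnd/leq_maxl.
  - by move: y Gky; exact/subsetPset/Gnd/leq_maxr.
move=> i; have [mF Foo'] := Foo i; have [mG Goo'] := Goo i.
split.
  rewrite -[X in measurable X]setTI; apply: measurable_tuncons => //.
  exact: measurableX.
rewrite /lebesgue_cons /pushforward -comp_preimage.
rewrite (_ : _ \o _ = id) ?preimage_id; last first.
  by apply/funext => z; exact: tconsK.
by rewrite product_measure1E// lte_mul_pinfty// ge0_fin_numE.
Qed.

HB.instance Definition _ := @Measure_isSigmaFinite.Build _ _ _ lebesgue_cons
  lebesgue_cons_sigma_finite.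

End step.

Fixpoint lebesgue_tuple n : {sigma_finite_measure set (Rn R n) -> \bar R} :=
  match n with
  | 0 => \d_([tuple])
  | n'.+1 => lebesgue_cons (lebesgue_tuple n')
  end.

End lebesgue_tuple.

Section complex_functions.
Context {R : realType}.

Definition expi (x : R) : R[i] := cos x +i* sin x.

Definition normc2 (z : R[i]) : R := complex.Re z ^+ 2 + complex.Im z ^+ 2.

Context d {T : measurableType d}.

Definition measurable_cfun (f : T -> R[i]) :=
  measurable_fun setT (fun x => complex.Re (f x)) /\
  measurable_fun setT (fun x => complex.Im (f x)).

Definition cintegral (mu : {measure set T -> \bar R}) (D : set T) (f : T -> R[i]) : R[i] :=
  Rintegral mu D (fun x => complex.Re (f x)) +i* Rintegral mu D (fun x => complex.Im (f x)).

(* The square of the L^2 norm. *)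
Definition energy (mu : set T -> \bar R) (f : T -> R[i]) : \bar R :=
  (\int[mu]_x (normc2 (f x))%:E)%E.

Definition L2 (mu : set T -> \bar R) (f : T -> R[i]) :=
  measurable_cfun f /\ (energy mu f < +oo)%E.

End complex_functions.

Section smoothing.
Context {R : realType} (n : nat).
Local Notation V := (Rn R n).
Local Notation leb := (@lebesgue_tuple R n).

Definition dot (x y : V) : R := \sum_(i < n) (tnth x i : R) * tnth y i.

Definition enorm (x : V) : R := Num.sqrt (dot x x).

Definition fourier_cst : R := (Num.sqrt (2 * pi) ^+ n)^-1.

(* The integral converges absolutely for u in L^2, and the Fourier transform
   of u is the L^2 limit of these functions. *)
Definition fourier_trunc (u : V -> R[i]) (k : nat) (xi : V) : R[i] :=
  fourier_cst%:C *
  cintegral leb [set x | enorm x <= k%:R] (fun x => u x * expi (- dot x xi)).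

Definition is_fourier (u v : V -> R[i]) :=
  L2 leb v /\
  (energy leb (fun xi => fourier_trunc u k xi - v xi)) @[k --> \oo] --> 0%E.

(* psi(|nabla|) e^{it Delta} u0 (x), with v the Fourier transform of u0, where
   frequencies are restricted to a compact shell in R^n \ {0}: psi is bounded
   there, so that the integral converges absolutely for every v in L^2. *)
Definition evolution_trunc (psi : R -> R) (v : V -> R[i]) (k : nat)
    (z : V * measurableTypeR R) : R[i] :=
  fourier_cst%:C *
  cintegral leb [set xi | k.+1%:R^-1 <= enorm xi <= k.+1%:R]
    (fun xi => expi (dot z.1 xi) * (psi (enorm xi))%:C *
               expi (- ((z.2 : R) * enorm xi ^+ 2)) * v xi).

(* The integral of w(|x|) |U(x,t)|^2 over R^n x R. *)
Definition weighted_energy (w : R -> R) (U : V * measurableTypeR R -> R[i]) :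
    \bar R :=
  (\int[leb \x @lebesgue_measure R]_z (w (enorm z.1) * normc2 (U z))%:E)%E.

(* U(x,t) = psi(|nabla|) e^{it Delta} u0 (x). Since psi is arbitrary at 0 and at
   infinity, psi(|xi|) v(xi) need not be integrable, square-integrable or even
   a tempered distribution, and the frequency integral is understood as an
   improper integral, converging in L^2(w(|x|) dx dt). *)
Definition is_evolution (w psi : R -> R) (v : V -> R[i])
    (U : V * measurableTypeR R -> R[i]) :=
  measurable_cfun U /\
  (weighted_energy w (fun z => evolution_trunc psi v k z - U z))
    @[k --> \oo] --> 0%E.

Definition smoothing_estimate (w psi : R -> R) (C : R) :=
  forall u0 v : V -> R[i], L2 leb u0 -> is_fourier u0 v ->
  exists2 U, is_evolution w psi v U &
    (weighted_energy w U <= C%:E * energy leb u0)%E.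

(* The infimum of the empty set is +oo. *)
Definition smoothing_constant (w psi : R -> R) : \bar R :=
  ereal_inf [set C%:E | C in [set C : R | 0 <= C /\ smoothing_estimate w psi C]].

(* [0 <= z] for z in R[i] means that z is real and non-negative. *)
Definition radial_fourier_ge0 (w : R -> R) :=
  forall (eps : R) (xi : V), 0 < eps ->
  0 <= cintegral leb setT (fun x =>
         (w (enorm x))%:C * (expR (- (eps * enorm x ^+ 2)))%:C *
         expi (- dot x xi)).

End smoothing.
Arguments smoothing_constant {R} n w psi.
Arguments radial_fourier_ge0 {R} n w.

(* Main.v *)
(* For frequencies xi, eta the weighted space-time norm of the evolution, damped
   by e^(-eps |x|^2) and e^(-tau |t|), is a quadratic form with the kernel
   W_n(xi - eta) h(|xi|^2 - |eta|^2), where W_n is the Fourier transform of the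
   weight in R^n and h is a Poisson kernel. The hypothesis makes this kernel
   non-negative, so that in R^(d+1) one may take absolute values, and AM-GM
   followed by averaging over spheres reduces the form to radial functions.
   A radial form in R^(d+1) is compared with a radial form in R^d by slicing
   spheres along the direction of xi: the integral of W_(d+1) along a line is at
   most 2 pi W_d, and the remaining inequality between the powers of the
   distance to the boundary of the slices is elementary. The estimate assumed in
   R^d bounds the form on radial functions there: non-negativity of the kernel
   makes the form monotone in the frequency cut-off, which replaces the limit
   defining the evolution. Plancherel's inequality comes from the same
   non-negative kernels, with e^(-delta |x|_1) as damping, and the evolution in
   R^(d+1) is obtained by completeness of the weighted L^2 space. *)

Require Import Defs.
From HB Require Import structures.
From mathcomp Require Import all_boot all_order all_algebra.
From mathcomp Require Import complex ring lra.
From mathcomp Require Import all_classical all_reals all_analysis.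
From mathcomp Require Import measurable_realfun.

Import Order.TTheory GRing.Theory Num.Theory.
Import numFieldNormedType.Exports.

Set Implicit Arguments.
Unset Strict Implicit.

Local Open Scope classical_set_scope.
Local Open Scope ring_scope.

(** * Measurability and iterated integrals *)

Notation leb R := (@lebesgue_measure R).
Notation lebn n := (lebesgue_tuple n).

Lemma measurable_inv (R : realType) : measurable_fun [set: R] (@GRing.inv R).
Proof.
have D0 : [set x : R | x != 0] = ~` [set 0].
  by apply/seteqP; split => x /= /eqP.
have mD : measurable [set x : R | x != 0].
  by rewrite D0; apply: measurableC; exact: measurable_set1.
rewrite -(setUv [set x : R | x != 0]); apply/measurable_funU => //.
  exact: measurableC.
split.
  apply: open_continuous_measurable_fun.
    by rewrite D0 openC; exact: (accessible_closed_set1 (hausdorff_accessible (@Rhausdorff R))).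
  by move=> x /set_mem /= x0; exact: inv_continuous.
apply: (eq_measurable_fun (cst 0 : R -> R)) => [x|]; last exact: measurable_cst.
by rewrite inE /= => /negP; rewrite negbK => /eqP ->; rewrite invr0.
Qed.

Lemma measurable_sqrt (R : realType) : measurable_fun [set: R] (@Num.sqrt R).
Proof. by apply: continuous_measurable_fun => x; exact: sqrt_continuous. Qed.

Lemma measurable_cos (R : realType) : measurable_fun [set: R] (@cos R).
Proof. by apply: continuous_measurable_fun => x; exact: continuous_cos. Qed.

Lemma measurable_sin (R : realType) : measurable_fun [set: R] (@sin R).
Proof. by apply: continuous_measurable_fun => x; exact: continuous_sin. Qed.

Lemma measurable_dot (R : realType) n :
  measurable_fun setT (fun z : Rn R n * Rn R n => dot z.1 z.2).
Proof.
apply: measurable_sum => i; apply: measurable_funM.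
  by apply: (@measurableT_comp _ _ _ _ _ _ (fun t : Rn R n => tnth t i)) => //;
     exact: measurable_tnth.
by apply: (@measurableT_comp _ _ _ _ _ _ (fun t : Rn R n => tnth t i)) => //;
   exact: measurable_tnth.
Qed.

Lemma measurable_fun_dot (R : realType) n d (T : measurableType d)
    (f g : T -> Rn R n) : measurable_fun setT f -> measurable_fun setT g ->
  measurable_fun setT (fun x => dot (f x) (g x)).
Proof.
by move=> mf mg; apply: (measurableT_comp (@measurable_dot R n) (measurable_fun_pair mf mg)).
Qed.

Lemma measurable_integral2 d1 d2 (T1 : measurableType d1)
    (T2 : measurableType d2) (R : realType)
    (m2 : {sigma_finite_measure set T2 -> \bar R}) (f : T1 -> T2 -> \bar R) :
  measurable_fun setT (fun z : T1 * T2 => f z.1 z.2) ->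
  (forall x y, 0 <= f x y)%E ->
  measurable_fun setT (fun x => \int[m2]_y f x y)%E.
Proof.
move=> mf f0.
exact: (measurable_fun_fubini_tonelli_F (fun z : T1 * T2 => f z.1 z.2) mf).
Qed.

Lemma tonelli2 d1 d2 (T1 : measurableType d1)
    (T2 : measurableType d2) (R : realType)
    (m1 : {sigma_finite_measure set T1 -> \bar R})
    (m2 : {sigma_finite_measure set T2 -> \bar R}) (f : T1 -> T2 -> \bar R) :
  measurable_fun setT (fun z : T1 * T2 => f z.1 z.2) ->
  (forall x y, 0 <= f x y)%E ->
  (\int[m1]_x \int[m2]_y f x y = \int[m2]_y \int[m1]_x f x y)%E.
Proof.
move=> mf f0.
exact: (fubini_tonelli (fun z : T1 * T2 => f z.1 z.2) mf).
Qed.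

Arguments tonelli2 {d1 d2 T1 T2 R m1 m2} f _ _.

Ltac mfun1 :=
  match goal with
  | |- measurable_fun _ (fun _ => (_)%:E) => apply/measurable_EFinP
  | |- measurable_fun _ (fun x => x) => exact: measurable_id
  | |- measurable_fun _ (Order.lt ?c) =>
      apply: (@measurable_fun_ltr _ _ _ _ (fun=> c) id)
  | |- measurable_fun _ (Order.le ?c) =>
      apply: (@measurable_fun_ler _ _ _ _ (fun=> c) id)
  | |- measurable_fun _ Num.sqrt => exact: measurable_sqrt
  | |- measurable_fun _ GRing.inv => exact: measurable_inv
  | |- measurable_fun _ cos => exact: measurable_cos
  | |- measurable_fun _ sin => exact: measurable_sin
  | |- measurable_fun _ expR => exact: measurable_expR
  | |- measurable_fun _ Num.norm => exact: normr_measurable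
  | |- measurable_fun _ (GRing.mul ?c) =>
      apply: (@measurable_funM _ _ _ _ (fun=> c) id)
  | |- measurable_fun _ (GRing.add ?c) =>
      apply: (@measurable_funD _ _ _ _ (fun=> c) id)
  | |- measurable_fun _ (GRing.opp) => exact: oppr_measurable
  | |- measurable_fun _ EFin => exact: EFin_measurable
  | |- measurable_fun _ fst => exact: measurable_fst
  | |- measurable_fun _ snd => exact: measurable_snd
  | |- measurable_fun _ (fun x => ?c) => exact: measurable_cst
  | |- measurable_fun _ (fun x => @fst _ _ (@?f x)) =>
      apply: (measurableT_comp measurable_fst)
  | |- measurable_fun _ (fun x => @snd _ _ (@?f x)) =>
      apply: (measurableT_comp measurable_snd)
  | |- measurable_fun _ (fun x => (@?f x, @?g x)) =>
      apply: measurable_fun_pair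
  | |- measurable_fun _ (fun x => (@?f x + @?g x)%E) =>
      apply: emeasurable_funD
  | |- measurable_fun _ (fun x => (@?f x * @?g x)%E) =>
      apply: emeasurable_funM
  | |- measurable_fun _ (fun x => - @?f x) =>
      apply: (measurableT_comp (@oppr_measurable _ setT))
  | |- measurable_fun _ (fun x => @?f x + @?g x) =>
      apply: measurable_funD
  | |- measurable_fun _ (fun x => @?f x * @?g x) =>
      apply: measurable_funM
  | |- measurable_fun _ (fun x => @?f x ^+ _) =>
      apply: (measurableT_comp (@exprn_measurable _ setT _))
  | |- measurable_fun _ (fun x => (@?f x)^-1) =>
      apply: (measurableT_comp (@measurable_inv _))
  | |- measurable_fun _ (fun x => expR (@?f x)) =>
      apply: (measurableT_comp (@measurable_expR _))
  | |- measurable_fun _ (fun x => cos (@?f x)) =>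
      apply: (measurableT_comp (@measurable_cos _))
  | |- measurable_fun _ (fun x => sin (@?f x)) =>
      apply: (measurableT_comp (@measurable_sin _))
  | |- measurable_fun _ (fun x => Num.sqrt (@?f x)) =>
      apply: (measurableT_comp (@measurable_sqrt _))
  | |- measurable_fun _ (fun x => `|@?f x|) =>
      apply: (measurableT_comp (@normr_measurable _ setT))
  | |- measurable_fun _ (fun x => @powR _ (@?f x) ?c) =>
      apply: (measurableT_comp (@measurable_powR _ c))
  | |- measurable_fun _ (fun x => fine (@?f x)) =>
      apply: (measurableT_comp (fine_measurable measurableT))
  | |- measurable_fun _ (fun x => @dot _ _ (@?f x) (@?g x)) =>
      apply: measurable_fun_dot
  | |- measurable_fun _ (@dot _ _ ?c) =>
      apply: (@measurable_fun_dot _ _ _ _ (fun=> c) id)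
  | |- measurable_fun _ (fun x => enorm (@?f x)) => rewrite /enorm
  | |- measurable_fun _ (fun x => tnth (@?f x) ?i) =>
      apply: (measurableT_comp (measurable_tnth i))
  | |- measurable_fun _ (fun x => @tcons _ _ (@?f x)) =>
      apply: (measurableT_comp (@measurable_tcons _ _))
  | |- measurable_fun _ (fun x => if _ then _ else _) =>
      apply: measurable_fun_ifT
  | |- measurable_fun _ (fun x => (@?f x < @?g x)%R) =>
      apply: measurable_fun_ltr
  | |- measurable_fun _ (fun x => (@?f x <= @?g x)%R) =>
      apply: measurable_fun_ler
  | |- measurable_fun _ (fun x => andb (@?f x) (@?g x)) =>
      apply: measurable_and
  | H : measurable_fun setT ?F |- measurable_fun _ (fun x => ?F (@?g x)) =>
      apply: (measurableT_comp H)
  | H : measurable_fun _ ?F |- measurable_fun _ ?F => exact: H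
  | |- measurable_fun _ (fun x => (\int[_]_y (@?f x y))%E) =>
      apply: measurable_integral2
  end.
Ltac mfun := repeat (mfun1; rewrite /=).

(** * Changes of variables *)

Section one_dim.
Context {R : realType}.
Implicit Types (f : measurableTypeR R -> \bar R) (a c : R).

Local Definition push (phi : measurableTypeR R -> measurableTypeR R)
  (mphi : measurable_fun setT phi) : {measure set (measurableTypeR R) -> \bar R} :=
  measure_function_pushforward__canonical__measure_function_Measure (leb R) mphi.

Lemma ge0_integral_shift f a : measurable_fun setT f -> (forall x, 0 <= f x)%E ->
  (\int[leb R]_x f (x + a)%R = \int[leb R]_x f x)%E.
Proof.
move=> mf f0.
pose phi : measurableTypeR R -> measurableTypeR R := fun x => x + a.
have mphi : measurable_fun setT phi by rewrite /phi; mfun.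
transitivity (\int[push mphi]_x f x)%E.
  by rewrite ge0_integral_pushforward// preimage_setT.
apply: eq_measure_integral => A mA _; apply/esym.
apply: (lebesgue_measure_unique (mu := push mphi)) => //= X [[x y] _ <-].
rewrite /pushforward (_ : phi @^-1` _ = `]x - a, y - a]%classic).
  by rewrite !lebesgue_measure_itv/= !lte_fin ltrD2r; case: ifP => // _;
     rewrite -!EFinD; congr EFin; ring.
apply/seteqP; split => z /=; rewrite !in_itv/=.
  by rewrite ltrBlDr lerBrDr.
by rewrite ltrBlDr lerBrDr.
Qed.

Lemma ge0_integral_scale f c : 0 < c -> measurable_fun setT f ->
  (forall x, 0 <= f x)%E ->
  (\int[leb R]_x f x = c%:E * \int[leb R]_x f (c * x)%R)%E.
Proof.
move=> c0 mf f0.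
pose phi : measurableTypeR R -> measurableTypeR R := fun x => c * x.
have mphi : measurable_fun setT phi by rewrite /phi; mfun.
pose nc : {nonneg R} := NngNum (ltW c0).
transitivity (\int[mscale nc (push mphi)]_x f x)%E; last first.
  by rewrite ge0_integral_mscale//= ge0_integral_pushforward// preimage_setT.
apply: eq_measure_integral => A mA _.
apply: (lebesgue_measure_unique (mu := mscale nc (push mphi))) => //= X [[x y] _ <-].
rewrite /mscale/= /pushforward (_ : phi @^-1` _ = `]x / c, y / c]%classic).
  rewrite !lebesgue_measure_itv/= !lte_fin ltr_pM2r ?invr_gt0//; case: ifP => _.
    by rewrite -!EFinD -EFinM; congr EFin; field; rewrite gt_eqF.
  by rewrite mule0.
by apply/seteqP; split => z /=; rewrite !in_itv/= /phi ltr_pdivrMr// ler_pdivlMr// mulrC.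
Qed.

Lemma ge0_integral_opp f : measurable_fun setT f -> (forall x, 0 <= f x)%E ->
  (\int[leb R]_x f (- x)%R = \int[leb R]_x f x)%E.
Proof.
move=> mf f0.
pose phi : measurableTypeR R -> measurableTypeR R := fun x => - x.
have mphi : measurable_fun setT phi by rewrite /phi; mfun.
transitivity (\int[push mphi]_x f x)%E.
  by rewrite ge0_integral_pushforward// preimage_setT.
apply: eq_measure_integral => A mA _; exact: lebesgue_measureN.
Qed.

End one_dim.

Section tuples.
Context {R : realType}.

Lemma dot_tcons n (a b : measurableTypeR R) (s t : Rn R n) :
  dot (tcons (a, s)) (tcons (b, t)) = a * b + dot s t.
Proof.
rewrite /dot big_ord_recl /= !(tnth_nth 0)/=; congr (_ + _).
by apply: eq_bigr => i _; rewrite !(tnth_nth 0).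
Qed.

Lemma tcons_tuncons n (t : Rn R n.+1) : tcons (tuncons t) = t.
Proof. by rewrite /tcons/tuncons/= [RHS]tuple_eta; exact: val_inj. Qed.

Lemma dot0l (s t : Rn R 0) : dot s t = 0.
Proof. by rewrite /dot big_ord0. Qed.

Lemma ge0_integral_tcons n (f : Rn R n.+1 -> \bar R) :
  measurable_fun setT f -> (forall x, 0 <= f x)%E ->
  (\int[lebn n.+1]_x f x = \int[leb R]_a \int[lebn n]_t f (tcons (a, t)))%E.
Proof.
move=> mf f0.
rewrite -(fubini_tonelli1 (fun z => f (tcons z)))//; last first.
  by apply: (measurableT_comp mf (@measurable_tcons R n)).
rewrite /= /lebesgue_cons ge0_integral_pushforward ?preimage_setT//.
exact: measurable_tcons.
Qed.

Lemma ge0_integral_tuple0 (f : Rn R 0 -> \bar R) :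
  measurable_fun setT f -> (\int[lebn 0]_x f x = f [tuple])%E.
Proof. by move=> mf; rewrite /= integral_dirac// diracT mul1e. Qed.

End tuples.

Section vectors.
Context {R : realType}.

Definition tadd n (s t : Rn R n) : Rn R n :=
  [tuple (tnth s i : R) + tnth t i | i < n].
Definition tscale n (c : R) (t : Rn R n) : Rn R n :=
  [tuple c * (tnth t i : R) | i < n].

Lemma measurable_fun_tadd n d (T : measurableType d) (f g : T -> Rn R n) :
  measurable_fun setT f -> measurable_fun setT g ->
  measurable_fun setT (fun x => tadd (f x) (g x)).
Proof.
move=> mf mg; apply/measurable_fun_tnthP => i.
rewrite (_ : _ \o _ = (fun x => (tnth (f x) i : R) + tnth (g x) i)); last first.
  by apply/funext => x /=; rewrite tnth_mktuple.
by mfun.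
Qed.

Lemma measurable_fun_tscale n d (T : measurableType d) (c : T -> R) (g : T -> Rn R n) :
  measurable_fun setT c -> measurable_fun setT g ->
  measurable_fun setT (fun x => tscale (c x) (g x)).
Proof.
move=> mf mg; apply/measurable_fun_tnthP => i.
rewrite (_ : _ \o _ = (fun x => c x * (tnth (g x) i : R))); last first.
  by apply/funext => x /=; rewrite tnth_mktuple.
by mfun.
Qed.

Lemma tadd_tcons n (a b : measurableTypeR R) (s t : Rn R n) :
  tadd (tcons (a, s)) (tcons (b, t)) = tcons (a + b, tadd s t).
Proof.
apply: eq_from_tnth => i; rewrite tnth_mktuple.
by case: (unliftP ord0 i) => [j ->|->]; rewrite ?tnthS ?tnth0 ?tnth_mktuple.
Qed.

Lemma tscale_tcons n (c : R) (b : measurableTypeR R) (t : Rn R n) :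
  tscale c (tcons (b, t)) = tcons (c * b, tscale c t).
Proof.
apply: eq_from_tnth => i; rewrite tnth_mktuple.
by case: (unliftP ord0 i) => [j ->|->]; rewrite ?tnthS ?tnth0 ?tnth_mktuple.
Qed.

End vectors.

Ltac mfun1v := first [mfun1 |
  match goal with
  | |- measurable_fun _ (tadd ?c) =>
      apply: (@measurable_fun_tadd _ _ _ _ (fun=> c) id)
  | |- measurable_fun _ (tscale ?c) =>
      apply: (@measurable_fun_tscale _ _ _ _ (fun=> c) id)
  | |- measurable_fun _ (fun x => tadd (@?f x) (@?g x)) =>
      apply: measurable_fun_tadd
  | |- measurable_fun _ (fun x => tscale (@?f x) (@?g x)) =>
      apply: measurable_fun_tscale
  end].
Ltac mfunv := repeat (mfun1v; rewrite /=).

Section tuple_change.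
Context {R : realType}.

Lemma ge0_integral_tadd n (f : Rn R n -> \bar R) (s : Rn R n) :
  measurable_fun setT f -> (forall x, 0 <= f x)%E ->
  (\int[lebn n]_x f (tadd x s) = \int[lebn n]_x f x)%E.
Proof.
elim: n f s => [|n IH] f s mf f0.
  rewrite !ge0_integral_tuple0; [|by mfunv|by mfunv].
  by rewrite (tuple0 (tadd _ _)).
rewrite -(tcons_tuncons s); case: (tuncons s) => {}s t.
rewrite !ge0_integral_tcons; [|by mfunv|by []|by mfunv|by []].
under eq_integral => a _.
  under eq_integral do rewrite tadd_tcons.
  rewrite (IH (fun x => f (tcons (a + s, x)))); [|by mfunv|by []].
  over.
rewrite (ge0_integral_shift (f := fun a => \int[lebn n]_x f (tcons (a, x)))%E); [by []|by mfunv|].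
by move=> x; exact: integral_ge0.
Qed.

Lemma ge0_integral_tscale n (f : Rn R n -> \bar R) (c : R) : 0 < c ->
  measurable_fun setT f -> (forall x, 0 <= f x)%E ->
  (\int[lebn n]_x f x = (c ^+ n)%:E * \int[lebn n]_x f (tscale c x))%E.
Proof.
move=> c0; elim: n f => [|n IH] f mf f0.
  rewrite !ge0_integral_tuple0; [|by mfunv|by mfunv].
  by rewrite (tuple0 (tscale _ _)) expr0 mul1e.
rewrite !ge0_integral_tcons; [|by mfunv|by []|by mfunv|by []].
under eq_integral => a _.
  rewrite (IH (fun x => f (tcons (a, x)))); [|by mfunv|by []].
  over.
rewrite ge0_integralZl; [|by []|by mfunv|..]; last 2 first.
- by move=> x _; exact: integral_ge0.
- by rewrite lee_fin exprn_ge0// ltW.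
rewrite [X in (_ * X = _)%E](ge0_integral_scale c0); last 2 first.
- by mfunv.
- by move=> x; exact: integral_ge0.
rewrite muleA -EFinM -exprSr; apply: (congr1 (fun z => (c ^+ n.+1)%:E * z)%E).
by apply: eq_integral => a _; apply: eq_integral => x _; rewrite tscale_tcons.
Qed.

Lemma ge0_integral_prod n (g : R -> R) (I : R) : measurable_fun setT g ->
  (forall x, 0 <= g x) -> (\int[leb R]_x (g x)%:E = I%:E)%E ->
  (\int[lebn n]_x (\prod_(i < n) g (tnth x i))%:E = (I ^+ n)%:E)%E.
Proof.
move=> mg g0 gI.
have mprod k : measurable_fun setT (fun x : Rn R k => \prod_(i < k) g (tnth x i)).
  apply: measurable_prod => i _.
  exact: (measurableT_comp mg (measurable_tnth i)).
elim: n => [|n IH].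
  rewrite ge0_integral_tuple0; last by apply/measurable_EFinP; exact: mprod.
  by rewrite big_ord0 expr0.
rewrite ge0_integral_tcons; last 2 first.
- by apply/measurable_EFinP; exact: mprod.
- by move=> x; rewrite lee_fin prodr_ge0.
under eq_integral => a _.
  under eq_integral => x _.
    rewrite big_ord_recl tnth0 /=.
    under eq_bigr do rewrite tnthS.
    rewrite EFinM /=; over.
  rewrite ge0_integralZl; [|by []|by apply/measurable_EFinP; exact: mprod|..]; last 2 first.
  + by move=> x _; rewrite lee_fin prodr_ge0.
  + by rewrite lee_fin.
  rewrite IH; over.
rewrite ge0_integralZr//=; last 3 first.
- by mfunv.
- by move=> x _; rewrite lee_fin.
- by rewrite lee_fin exprn_ge0// -lee_fin -gI integral_ge0// => x _; rewrite lee_fin.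
by rewrite gI -EFinM exprS.
Qed.

End tuple_change.

Section rotation.
Context {R : realType}.
Local Notation mR := (measurableTypeR R).

Lemma ge0_integral_shear1 (H : mR * mR -> \bar R) (t : R) :
  measurable_fun setT H -> (forall x, 0 <= H x)%E ->
  (\int[leb R]_b \int[leb R]_e H (b + t * e, e)%R =
   \int[leb R]_b \int[leb R]_e H (b, e))%E.
Proof.
move=> mH H0.
rewrite (tonelli2 (fun b e : mR => H (b + t * e, e)%R)); [|by mfunv|by []].
under eq_integral => e _.
  rewrite (ge0_integral_shift (f := fun b => H (b, e))); [|by mfunv|by []].
  over.
by rewrite -(tonelli2 (fun b e : mR => H (b, e))); [|by mfunv|by []].
Qed.

Lemma ge0_integral_shear2 (H : mR * mR -> \bar R) (t : R) :
  measurable_fun setT H -> (forall x, 0 <= H x)%E ->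
  (\int[leb R]_b \int[leb R]_e H (b, e + t * b)%R =
   \int[leb R]_b \int[leb R]_e H (b, e))%E.
Proof.
move=> mH H0; apply: eq_integral => b _.
by rewrite (ge0_integral_shift (f := fun e => H (b, e))); [|by mfunv|by []].
Qed.

(* A rotation of angle x is a product of three shears of slopes tan (x / 2), - sin x and tan (x / 2). *)
Lemma ge0_integral_rot (H : mR * mR -> \bar R) (c s : R) :
  measurable_fun setT H -> (forall x, 0 <= H x)%E ->
  c ^+ 2 + s ^+ 2 = 1 -> 0 < 1 + c ->
  (\int[leb R]_b \int[leb R]_e H (c * b + s * e, c * e - s * b)%R =
   \int[leb R]_b \int[leb R]_e H (b, e))%E.
Proof.
move=> mH H0 cs c1; set t := s / (1 + c).
have st : s * t = 1 - c.
  apply: (mulIf (lt0r_neq0 c1)); rewrite -mulrA divfK ?lt0r_neq0//.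
  have s2 : s ^+ 2 = 1 - c ^+ 2 by rewrite -cs; ring.
  by rewrite -expr2 s2; ring.
rewrite -[RHS](ge0_integral_shear1 t mH H0).
rewrite -[RHS](ge0_integral_shear2 (H := fun z => H (z.1 + t * z.2, z.2)) (- s));
  [|by mfunv|by []].
rewrite -[RHS](ge0_integral_shear1 (H := fun z => H (z.1 + t * (z.2 + - s * z.1), z.2 + - s * z.1)) t);
  [|by mfunv|by []].
apply: eq_integral => b _; apply: eq_integral => e _; rewrite /=; congr (H (_, _)).
  transitivity (b * (1 - s * t) + e * (2 * t - t * (s * t))); last by ring.
  rewrite st; congr (_ + _); first by ring.
  have -> : 2 * t - t * (1 - c) = t * (1 + c) by ring.
  by rewrite /t divfK ?lt0r_neq0// mulrC.
transitivity (e * (1 - s * t) - s * b); last by ring.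
by rewrite st; ring.
Qed.

Lemma ge0_integral_rad2 (F : R * R -> \bar R) (a e : R) :
  measurable_fun setT F -> (forall x, 0 <= F x)%E ->
  (\int[leb R]_x \int[leb R]_y F (x ^+ 2 + y ^+ 2, a * x + e * y)%R =
   \int[leb R]_x \int[leb R]_y F (x ^+ 2 + y ^+ 2, Num.sqrt (a ^+ 2 + e ^+ 2) * x)%R)%E.
Proof.
move=> mF F0.
wlog a0 : a / 0 <= a => [wlg|].
  have [|a0] := leP 0 a; first exact: wlg.
  have a0' : 0 <= - a by rewrite oppr_ge0 ltW.
  rewrite -[in RHS](sqrrN a) -(wlg _ a0').
  rewrite -[LHS](ge0_integral_opp); [|by mfunv|by move=> x; exact: integral_ge0].
  apply: eq_integral => x _; apply: eq_integral => y _.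
  by rewrite sqrrN mulrN mulNr.
set r := Num.sqrt _.
have r2 : r ^+ 2 = a ^+ 2 + e ^+ 2 by rewrite sqr_sqrtr// addr_ge0// sqr_ge0.
have [r0|r0] := eqVneq r 0.
  have /andP[/eqP -> /eqP ->] : (a == 0) && (e == 0).
    move: r2; rewrite r0 expr0n/= => /esym/eqP; rewrite paddr_eq0 ?sqr_ge0//.
    by rewrite !sqrf_eq0.
  by rewrite r0; apply: eq_integral => x _; apply: eq_integral => y _; rewrite !mul0r addr0.
have rp : 0 < r by rewrite lt_neqAle eq_sym r0 sqrtr_ge0.
have cs : (a / r) ^+ 2 + (e / r) ^+ 2 = 1.
  by rewrite !exprMn -mulrDl -r2 exprVn divff// sqrf_eq0.
have c1 : 0 < 1 + a / r by rewrite ltr_wpDr// divr_ge0// ltW.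
rewrite -[RHS](@ge0_integral_rot (fun z => F (z.1 ^+ 2 + z.2 ^+ 2, r * z.1)) (a / r) (e / r));
  [|by mfunv|by []|by []|by []].
apply: eq_integral => x _; apply: eq_integral => y _.
rewrite /=; congr (F (_, _)); last by field.
transitivity ((x ^+ 2 + y ^+ 2) * ((a / r) ^+ 2 + (e / r) ^+ 2)); last by ring.
by rewrite cs mulr1.
Qed.

Lemma dot_ge0 n (t : Rn R n) : 0 <= dot t t.
Proof. by rewrite /dot sumr_ge0// => i _; rewrite -expr2 sqr_ge0. Qed.

Lemma ge0_integral_rad n (F : R * R -> \bar R) (xi : Rn R n.+1) :
  measurable_fun setT F -> (forall x, 0 <= F x)%E ->
  (\int[lebn n.+1]_eta F (dot eta eta, dot xi eta) =
   \int[leb R]_b \int[lebn n]_t F (b ^+ 2 + dot t t, Num.sqrt (dot xi xi) * b)%R)%E.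
Proof.
elim: n F xi => [|n IH] F xi mF F0; rewrite -(tcons_tuncons xi);
    case: (tuncons xi) => {xi} a s;
    (rewrite ge0_integral_tcons; [|by mfunv|by []]).
  under eq_integral => b _.
    rewrite ge0_integral_tuple0; last by mfunv.
    rewrite !dot_tcons !dot0l !addr0.
    over.
  under [RHS]eq_integral => b _.
    rewrite ge0_integral_tuple0; last by mfunv.
    rewrite dot0l addr0 dot_tcons dot0l addr0 -expr2 sqrtr_sqr.
    over.
  have [a0|a0] := leP 0 a.
    by apply: eq_integral => b _; rewrite expr2 ger0_norm.
  rewrite -[LHS]ge0_integral_opp; [|by mfunv|by []].
  by apply: eq_integral => b _; rewrite mulrNN expr2 ltr0_norm// mulrN mulNr.
under eq_integral => b _.
  under eq_integral => t _ do rewrite !dot_tcons.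
  rewrite (IH (fun z => F (b * b + z.1, a * b + z.2))); [|by mfunv|by []].
  over.
pose G (z : R * R) := (\int[lebn n]_t F (z.1 + dot t t, z.2)%R)%E.
have mG : measurable_fun setT G by rewrite /G; mfunv.
have G0 z : (0 <= G z)%E by exact: integral_ge0.
transitivity (\int[leb R]_b \int[leb R]_e G (b ^+ 2 + e ^+ 2, a * b + Num.sqrt (dot s s) * e)%R)%E.
  apply: eq_integral => b _; apply: eq_integral => e _; apply: eq_integral => t _.
  by rewrite -!expr2 addrA.
rewrite (ge0_integral_rad2 _ _ mG G0); apply: eq_integral => b _.
rewrite ge0_integral_tcons; [|by mfunv|by []].
apply: eq_integral => e _; apply: eq_integral => t _.
rewrite !dot_tcons -!expr2 addrA sqr_sqrtr//.
exact: dot_ge0.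
Qed.

End rotation.

(** * Polar coordinates *)

Section polar.
Context {R : realType}.

(* The weight [s ^ (n / 2 - 1)] of polar coordinates in R^n, in the variable s = |x|^2. *)
Definition wt n (s : R) : R := if 0 < s then Num.sqrt s ^+ n / s else 0.

Definition shell (q : R) : R := if (1 <= q) && (q <= 4) then 1 else 0.

Definition sph n (f : Rn R n -> \bar R) (s : R) : \bar R :=
  (\int[lebn n]_x ((shell (dot x x))%:E *
     f (tscale (Num.sqrt s / Num.sqrt (dot x x)) x)))%E.

Lemma measurable_wt n : measurable_fun setT (wt n).
Proof. by rewrite /wt; mfun. Qed.

Lemma measurable_shell : measurable_fun setT shell.
Proof. by rewrite /shell; mfun. Qed.

Lemma wt_ge0 n s : 0 <= wt n s.
Proof.
by rewrite /wt; case: ifP => // s0; rewrite divr_ge0 ?exprn_ge0 ?sqrtr_ge0 ?ltW.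
Qed.

Lemma shell_ge0 s : 0 <= shell s.
Proof. by rewrite /shell; case: ifP. Qed.

Lemma wtM n (s t : R) : 0 < s -> wt n (s * t) = wt n s * wt n t.
Proof.
move=> s0; rewrite /wt s0 pmulr_rgt0//; case: ifPn => t0; last by rewrite mulr0.
by rewrite sqrtrM ?ltW// exprMn; field; rewrite !gt_eqF.
Qed.

Lemma dot_tscale n (a b : R) (x y : Rn R n) :
  dot (tscale a x) (tscale b y) = a * b * dot x y.
Proof.
rewrite /dot mulr_sumr; apply: eq_bigr => i _; rewrite !tnth_mktuple; ring.
Qed.

Lemma ge0_integral_neq0 n (f : Rn R n.+1 -> \bar R) :
  measurable_fun setT f -> (forall x, 0 <= f x)%E ->
  (\int[lebn n.+1]_x f x =
   \int[lebn n.+1]_x ((if (0 < dot x x)%R then 1 else 0)%:E * f x))%E.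
Proof.
move=> mf f0; rewrite !ge0_integral_tcons; last 4 first.
- by mfunv.
- by move=> x; rewrite mule_ge0// lee_fin; case: ifP.
- by mfunv.
- by [].
have m0 (g : Rn R n.+1 -> \bar R) : measurable_fun setT g -> (forall x, 0 <= g x)%E ->
    (\int[leb R]_a \int[lebn n]_t g (tcons (a, t)) =
     \int[leb R]_(a in (~` [set (0 : R)%R])) \int[lebn n]_t g (tcons (a, t)))%E.
  move=> mg g0; rewrite -setTD integral_setD1; first by [].
    by rewrite setTD; apply: measurableC; exact: measurable_set1.
  by apply: measurable_funTS; mfunv.
rewrite (m0 f mf f0) (m0 (fun x => (if 0 < dot x x then 1 else 0)%:E * f x)%E); last 2 first.
- by mfunv.
- by move=> x; rewrite mule_ge0// lee_fin; case: ifP.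
apply: eq_integral => a; rewrite inE/= => /eqP a0; apply: eq_integral => t _.
by rewrite dot_tcons ltr_pwDl ?dot_ge0// ?mul1e// -expr2 exprn_even_gt0.
Qed.

End polar.

Ltac mfun1w := first [mfun1v |
  match goal with
  | |- measurable_fun _ (wt _) => exact: measurable_wt
  | |- measurable_fun _ shell => exact: measurable_shell
  | |- measurable_fun _ (fun x => shell (@?f x)) =>
      apply: (measurableT_comp measurable_shell)
  | |- measurable_fun _ (fun x => wt _ (@?f x)) =>
      apply: (measurableT_comp (measurable_wt _))
  end].
Ltac mfunw := repeat (mfun1w; rewrite /=).

Section polar_formula.
Context {R : realType}.
Local Notation mR := (measurableTypeR R).

Lemma measurable_sph n (f : Rn R n -> \bar R) : measurable_fun setT f ->
  (forall x, 0 <= f x)%E -> measurable_fun setT (sph f).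
Proof.
move=> mf f0; rewrite /sph; mfunw.
by move=> x y; rewrite mule_ge0// lee_fin shell_ge0.
Qed.

Lemma sph_ge0 n (f : Rn R n -> \bar R) s :
  (forall x, 0 <= f x)%E -> (0 <= sph f s)%E.
Proof.
by move=> f0; apply: integral_ge0 => x _; rewrite mule_ge0// lee_fin shell_ge0.
Qed.

Let G n (q : R) : R := shell q * Num.sqrt q ^+ n.
Let H n (u q : R) : R := if 0 < u then G n (q / u) / u else 0.

Let G_ge0 n q : 0 <= G n q.
Proof. by rewrite mulr_ge0 ?shell_ge0 ?exprn_ge0 ?sqrtr_ge0. Qed.

Let H_ge0 n u q : 0 <= H n u q.
Proof. by rewrite /H; case: ifP => // u0; rewrite mulr_ge0 ?G_ge0 ?invr_ge0 ?ltW. Qed.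

Let mH n : measurable_fun setT (fun z : R * R => H n z.1 z.2).
Proof. by rewrite /H /G; mfunw. Qed.

Let mHf n d (T : measurableType d) (f g : T -> R) :
  measurable_fun setT f -> measurable_fun setT g ->
  measurable_fun setT (fun x => H n (f x) (g x)).
Proof. by move=> mf mg; rewrite /H /G; mfunw. Qed.

Let K n : \bar R := (\int[leb R]_v (H n v 1)%:E)%E.

Let HK n q : 0 < q -> (\int[leb R]_u (H n u q)%:E = K n)%E.
Proof.
move=> q0; rewrite (ge0_integral_scale q0); last 2 first.
- by apply/measurable_EFinP; apply: mHf; mfun.
- by move=> x; rewrite lee_fin.
rewrite -ge0_integralZl; [|by []| |by move=> x _; rewrite lee_fin|by rewrite lee_fin ltW].
  apply: eq_integral => u _; rewrite -EFinM; congr EFin.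
  rewrite /H pmulr_rgt0//; case: ifPn => u0; last by rewrite mulr0.
  rewrite (_ : q / (q * u) = 1 / u); first by field; rewrite !gt_eqF.
  by field; rewrite !gt_eqF.
by apply/measurable_EFinP; apply: mHf; mfun.
Qed.

Let K_fin n : exists2 k : R, 0 < k & K n = k%:E.
Proof.
have mHE : measurable_fun setT (fun v : mR => (H n v 1)%:E).
  by apply/measurable_EFinP; apply: mHf; mfun.
have K1 : ((3 / 4)%:E <= K n)%E.
  have : (\int[leb R]_(v in `[(4^-1)%R, (1:R)%R]) (1%:E) <= \int[leb R]_(v in `[(4^-1)%R, (1:R)%R]) (H n v 1)%:E)%E.
    apply: ge0_le_integral => //.
    - by apply: measurable_funTS.
    - move=> v /=; rewrite in_itv/= => /andP[v4 v1].
      have v0 : 0 < v by apply: lt_le_trans v4; rewrite invr_gt0.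
      have v1' : 1 <= v^-1 by rewrite invf_ge1.
      rewrite lee_fin /H v0 div1r /G /shell v1'/=.
      have -> /= : v^-1 <= 4 by rewrite -(invrK 4) lef_pV2 ?posrE ?invr_gt0.
      rewrite mul1r -[leLHS]mulr1 ler_pM// exprn_ege1//.
      by rewrite -[leLHS]sqrtr1; exact: ler_wsqrtr.
  rewrite integral_cst// mul1e [X in (X <= _)%E]lebesgue_measure_itv/= lte_fin ifT; last by lra.
  rewrite -EFinD (_ : 1 - 4^-1 = 3 / 4); last by lra.
  move=> /le_trans; apply.
  by apply: ge0_subset_integral => //= v _; rewrite lee_fin.
have K2 : (K n < +oo)%E.
  apply: (@le_lt_trans _ _ (\int[leb R]_(v in `[0%R, 1%R]) (4 * 2 ^+ n)%:E)%E); last first.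
    by rewrite integral_cst// [X in (_ * X)%E]lebesgue_measure_itv/= lte_fin ltr01 -EFinD -EFinM ltry.
  rewrite [leRHS]integral_mkcond/=; apply: ge0_le_integral => //.
  - by move=> v _; rewrite lee_fin.
  - by apply/(measurable_restrictT (cst (4 * 2 ^+ n)%:E)) => //; exact: measurable_cst.
  - move=> v _; rewrite /H /patch; case: ifPn => v0; last first.
      by case: ifP => // _; rewrite lee_fin mulr_ge0 ?exprn_ge0.
    rewrite /G /shell div1r; case: ifPn => [/andP[v1 v4]|_]; last first.
      by rewrite !mul0r; case: ifP => // _; rewrite lee_fin mulr_ge0 ?exprn_ge0.
    rewrite mem_set/=; last by rewrite in_itv/= (ltW v0)/= -invf_ge1.
    rewrite lee_fin mul1r mulrC ler_pM ?invr_ge0 ?exprn_ge0 ?sqrtr_ge0 ?(ltW v0)//.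
    rewrite lerXn2r ?nnegrE ?sqrtr_ge0//.
    rewrite -[leRHS](@ger0_norm _ 2)// -sqrtr_sqr; apply: ler_wsqrtr.
    by rewrite (_ : 2 ^+ 2 = 4)//; ring.
exists (fine (K n)).
  by rewrite fine_gt0// K2 andbT (lt_le_trans _ K1)// lte_fin; lra.
by rewrite fineK// ge0_fin_numE// (le_trans _ K1)// lee_fin; lra.
Qed.

Lemma polar n : exists2 c : R, 0 < c & forall f : Rn R n.+1 -> \bar R,
  measurable_fun setT f -> (forall x, 0 <= f x)%E ->
  (\int[lebn n.+1]_x f x = c%:E * \int[leb R]_s ((wt n.+1 s)%:E * sph f s))%E.
Proof.
have [k k0 kE] := K_fin n.+1; exists k^-1; first by rewrite invr_gt0.
move=> f mf f0.
have wsf s x : (0 <= (wt n.+1 s)%:E * ((shell (dot x x))%:E *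
     f (tscale (Num.sqrt s / Num.sqrt (dot x x)) x)))%E.
  by rewrite !mule_ge0 ?lee_fin ?wt_ge0 ?shell_ge0.
have wGf u (x : Rn R n.+1) : (0 <= (wt n.+1 u)%:E * ((G n.+1 (dot x x))%:E *
     f (tscale (Num.sqrt u) x)))%E.
  by rewrite !mule_ge0 ?lee_fin ?wt_ge0 ?G_ge0.
transitivity (k^-1%:E * (\int[lebn n.+1]_y ((\int[leb R]_u (H n.+1 u (dot y y))%:E) * f y)))%E.
  rewrite ge0_integral_neq0//.
  transitivity (k^-1%:E * (\int[lebn n.+1]_y (k%:E * ((if (0 < dot y y)%R then 1 else 0)%:E * f y))))%E.
    rewrite ge0_integralZl; [|by []|by mfunv| |by rewrite lee_fin ltW]; last first.
      by move=> x _; rewrite mule_ge0// lee_fin; case: ifP.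
    by rewrite muleA -EFinM mulVf ?gt_eqF// mul1e.
  congr (_ * _)%E; apply: eq_integral => y _; case: ifPn => y0.
    by rewrite mul1e HK// kE.
  rewrite mul0e mule0.
  rewrite [X in (X * _)%E](_ : _ = 0%E) ?mul0e// integral0_eq// => u _.
  have -> : dot y y = 0 by apply/eqP; rewrite eq_le dot_ge0 andbT leNgt.
  by rewrite /H mul0r /G /shell ler10/= mul0r mul0r if_same.
congr (_ * _)%E.
transitivity (\int[leb R]_u \int[lebn n.+1]_y ((H n.+1 u (dot y y))%:E * f y))%E.
  rewrite tonelli2; [|by mfunv; apply: mHf; mfunv|by move=> u y; rewrite mule_ge0// lee_fin].
  apply: eq_integral => y _.
  rewrite -ge0_integralZr//; last by move=> u _; rewrite lee_fin.
  by mfunv; apply: mHf; mfunv.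
transitivity (\int[leb R]_u \int[lebn n.+1]_x ((wt n.+1 u)%:E * ((G n.+1 (dot x x))%:E * f (tscale (Num.sqrt u) x))))%E.
  apply: eq_integral => u _; rewrite /H; case: (boolP (0 < u)) => u0 /=; last first.
    by rewrite /wt (negbTE u0) !integral0_eq// => x _; rewrite mul0e.
  have su : 0 < Num.sqrt u by rewrite sqrtr_gt0.
  rewrite (ge0_integral_tscale su); last 2 first.
  - by rewrite /G; mfunw.
  - by move=> x; rewrite mule_ge0// lee_fin divr_ge0 ?G_ge0 ?ltW.
  rewrite -ge0_integralZl; [|by []|by rewrite /G; mfunw| |by rewrite lee_fin exprn_ge0 ?ltW]; last first.
    by move=> x _; rewrite mule_ge0// lee_fin divr_ge0 ?G_ge0 ?ltW.
  apply: eq_integral => x _; rewrite dot_tscale.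
  have -> : Num.sqrt u * Num.sqrt u * dot x x / u = dot x x.
    by rewrite -expr2 sqr_sqrtr ?ltW//; field; rewrite gt_eqF.
  rewrite !muleA -!EFinM; congr (_ * _)%E; congr EFin.
  by rewrite /wt u0; ring.
transitivity (\int[lebn n.+1]_x \int[leb R]_u ((wt n.+1 u)%:E * ((G n.+1 (dot x x))%:E * f (tscale (Num.sqrt u) x))))%E.
  by rewrite tonelli2; [by []|by rewrite /G; mfunw|by []].
transitivity (\int[lebn n.+1]_x \int[leb R]_s ((wt n.+1 s)%:E * ((shell (dot x x))%:E *
     f (tscale (Num.sqrt s / Num.sqrt (dot x x)) x))))%E.
  apply: eq_integral => x _.
  rewrite /G; have [->|[-> x1]] : shell (dot x x) = 0 \/ shell (dot x x) = 1 /\ 1 <= dot x x.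
  - by rewrite /shell; case: ifP => [/andP[]|]; [right|left].
  - by rewrite mul0r !integral0_eq// => u _; rewrite mul0e mule0.
  have q0 : 0 < dot x x by exact: lt_le_trans x1.
  rewrite [RHS](ge0_integral_scale q0); last 2 first.
  - by mfunw.
  - by move=> s; rewrite !mule_ge0 ?lee_fin ?wt_ge0.
  rewrite -ge0_integralZl; [|by []|by mfunw| |by rewrite lee_fin ltW]; last first.
    by move=> s _; rewrite !mule_ge0 ?lee_fin ?wt_ge0.
  apply: eq_integral => u _; rewrite mul1e wtM//.
  rewrite !muleA -!EFinM sqrtrM ?ltW// mulrAC divff ?mul1r; last by rewrite gt_eqF// sqrtr_gt0.
  congr (_ * _)%E; congr EFin; rewrite /wt q0; field.
  by rewrite gt_eqF.
rewrite -tonelli2; [|by mfunw|by []].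
apply: eq_integral => s _; rewrite ge0_integralZl; [by []|by []|by mfunw| |by rewrite lee_fin wt_ge0].
by move=> x _; rewrite !mule_ge0 ?lee_fin ?shell_ge0.
Qed.

End polar_formula.

Section slicing.
Context {R : realType}.
Local Notation mR := (measurableTypeR R).

Lemma shell_integral_fin n : exists2 v : R, 0 <= v &
  (\int[@lebesgue_tuple R n]_x (shell (dot x x))%:E = v%:E)%E.
Proof.
have mS : measurable_fun setT (fun x : Rn R n => (shell (dot x x))%:E) by mfunw.
have i0 : (0 <= \int[@lebesgue_tuple R (n)]_x (shell (dot x x))%:E)%E.
  by apply: integral_ge0 => x _; rewrite lee_fin shell_ge0.
suff ifin : (\int[@lebesgue_tuple R (n)]_x (shell (dot x x))%:E < +oo)%E.
  exists (fine (\int[@lebesgue_tuple R (n)]_x (shell (dot x x))%:E)%E); first exact: fine_ge0.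
  by rewrite fineK// ge0_fin_numE.
pose g (s : R) : R := if (-2 <= s) && (s <= 2) then 1 else 0.
have mg : measurable_fun setT g by rewrite /g; mfun.
have g0 s : 0 <= g s by rewrite /g; case: ifP.
have gI : (\int[leb R]_x (g x)%:E = 4%:E)%E.
  transitivity (\int[leb R]_(x in `[(-2)%R, (2 : R)%R]) (cst 1%:E x))%E.
    rewrite [in RHS]integral_mkcond; apply: eq_integral => x _.
    by rewrite /patch /g mem_setE in_itv/=; case: ifP.
  rewrite integral_cst// mul1e [LHS]lebesgue_measure_itv/= lte_fin ifT; last by lra.
  by rewrite -EFinD; congr EFin; lra.
apply: (@le_lt_trans _ _ (\int[lebn n]_x (\prod_(i < n) g (tnth x i))%:E)%E).
  apply: ge0_le_integral => //.
  - by move=> x _; rewrite lee_fin shell_ge0.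
  - apply/measurable_EFinP; apply: measurable_prod => i _.
    exact: (measurableT_comp mg (measurable_tnth i)).
  - move=> x _; rewrite lee_fin /shell; case: ifPn => [/andP[_ x4]|_]; last first.
      by rewrite prodr_ge0.
    rewrite big1// => i _; rewrite /g ifT// -ler_norml.
    rewrite -(@ler_sqr _ `|_|) ?nnegrE// real_normK ?num_real// (le_trans _ (le_trans x4 _))//.
      by rewrite /dot (bigD1 i)//= -expr2 lerDl sumr_ge0// => j _; rewrite -expr2 sqr_ge0.
    by lra.
by rewrite (ge0_integral_prod n mg g0 gI) ltry.
Qed.

Lemma sph_radial n (f : Rn R n -> \bar R) (g : R -> \bar R) (s : R) : 0 < s ->
  measurable_fun setT f -> (forall x, 0 <= f x)%E -> (0 <= g s)%E ->
  sph (fun x => f x * g (dot x x))%E s = (sph f s * g s)%E.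
Proof.
move=> s0 mf f0 g0; rewrite /sph.
rewrite -ge0_integralZr//; last 2 first.
- by mfunw.
- by move=> x _; rewrite mule_ge0 ?lee_fin ?shell_ge0.
apply: eq_integral => x _; rewrite muleA.
have [->|x1] : shell (dot x x) = 0 \/ 1 <= dot x x.
- by rewrite /shell; case: ifP => [/andP[]|]; [right|left].
- by rewrite !mul0e.
congr (_ * g _)%E; rewrite dot_tscale -expr2 expr_div_n !sqr_sqrtr ?dot_ge0 ?ltW//.
by rewrite mulfVK// gt_eqF// (lt_le_trans _ x1).
Qed.

Lemma polar_radial n : exists c lam : R, [/\ 0 < c, 0 < lam,
  forall (f : Rn R n.+1 -> \bar R) (g : R -> \bar R),
    measurable_fun setT f -> (forall x, 0 <= f x)%E ->
    measurable_fun setT g -> (forall x, 0 <= g x)%E ->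
    (\int[lebn n.+1]_x (f x * g (dot x x)) =
     c%:E * \int[leb R]_s ((wt n.+1 s)%:E * (sph f s * g s)))%E &
  forall g : R -> \bar R, measurable_fun setT g -> (forall x, 0 <= g x)%E ->
    (\int[@lebesgue_tuple R (n.+1)]_x (g (dot x x)) =
     lam%:E * \int[leb R]_s ((wt n.+1 s)%:E * g s))%E].
Proof.
have [c c0 polarE] := @polar R n; have [v v0 vE] := shell_integral_fin n.+1.
have P1 (f : Rn R n.+1 -> \bar R) (g : R -> \bar R) :
    measurable_fun setT f -> (forall x, 0 <= f x)%E ->
    measurable_fun setT g -> (forall x, 0 <= g x)%E ->
    (\int[lebn n.+1]_x (f x * g (dot x x)) =
     c%:E * \int[leb R]_s ((wt n.+1 s)%:E * (sph f s * g s)))%E.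
  move=> mf f0 mg g0; rewrite (polarE (fun x => f x * g (dot x x))%E); last 2 first.
  - by mfunv.
  - by move=> x; rewrite mule_ge0.
  congr (_ * _)%E; apply: eq_integral => s _.
  have [s0|s0] := ltP 0 s; first by rewrite sph_radial.
  by rewrite /wt ltNge s0/= !mul0e.
have P2 (g : R -> \bar R) : measurable_fun setT g -> (forall x, 0 <= g x)%E ->
    (\int[@lebesgue_tuple R (n.+1)]_x (g (dot x x)) =
     (c * v)%:E * \int[leb R]_s ((wt n.+1 s)%:E * g s))%E.
  move=> mg g0.
  transitivity (\int[@lebesgue_tuple R (n.+1)]_x (1%:E * g (dot x x)))%E.
    by apply: eq_integral => x _; rewrite mul1e.
  rewrite (P1 (fun=> 1%:E) g (measurable_cst _) (fun=> lee01) mg g0).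
  rewrite EFinM -muleA; congr (_ * _)%E.
  rewrite -ge0_integralZl; [|by []|by mfunw| |by rewrite lee_fin]; last first.
    by move=> s _; rewrite mule_ge0 ?lee_fin ?wt_ge0.
  apply: eq_integral => s _; rewrite [RHS]muleCA; congr (_ * (_ * _))%E.
  by rewrite /sph -vE; apply: eq_integral => x _; rewrite mule1.
exists c, (c * v); split => //; rewrite mulr_gt0// lt_neqAle v0 andbT eq_sym.
apply/eqP => v00; have := P2 (fun=> 1%:E) (measurable_cst _) (fun=> lee01).
rewrite v00 mulr0 mul0e => /eqP; apply/negP; rewrite gt_eqF//.
pose g (s : R) : R := if (0 <= s) && (s <= 1) then 1 else 0.
have mg : measurable_fun setT g by rewrite /g; mfun.
have g0 s : 0 <= g s by rewrite /g; case: ifP.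
have gI : (\int[leb R]_x (g x)%:E = 1%:E)%E.
  transitivity (\int[leb R]_(x in `[0%R, 1%R]) (cst 1%:E x))%E.
    rewrite [in RHS]integral_mkcond; apply: eq_integral => x _.
    by rewrite /patch /g mem_setE in_itv/=; case: ifP.
  by rewrite integral_cst// mul1e [LHS]lebesgue_measure_itv/= lte_fin ltr01 oppr0 adde0.
apply: (@lt_le_trans _ _ (\int[lebn n.+1]_x (\prod_(i < n.+1) g (tnth x i))%:E)%E).
  by rewrite (ge0_integral_prod n.+1 mg g0 gI) expr1n.
apply: ge0_le_integral => //.
- by move=> x _; rewrite lee_fin prodr_ge0.
- apply/measurable_EFinP; apply: measurable_prod => i _.
  exact: (measurableT_comp mg (measurable_tnth i)).
- move=> x _; rewrite lee_fin; apply: prodr_ile1 => i _; rewrite g0 /= /g; case: ifP => //.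
Qed.

Lemma ge0_integral_slice n (lam : R) : 0 <= lam ->
  (forall g : R -> \bar R, measurable_fun setT g -> (forall x, 0 <= g x)%E ->
    (\int[@lebesgue_tuple R (n)]_x (g (dot x x)) =
     lam%:E * \int[leb R]_s ((wt n s)%:E * g s))%E) ->
  forall F : R * R -> \bar R, measurable_fun setT F -> (forall x, 0 <= F x)%E ->
  (\int[leb R]_b \int[lebn n]_t F (b ^+ 2 + dot t t, b)%R =
   lam%:E * \int[leb R]_s \int[leb R]_b ((wt n (s - b ^+ 2))%:E * F (s, b)))%E.
Proof.
move=> lam0 radial F mF F0.
rewrite -(tonelli2 (fun b s : mR => (wt n (s - b ^+ 2))%:E * F (s, b)))%E; last 2 first.
- by mfunw.
- by move=> x y; rewrite mule_ge0 ?lee_fin ?wt_ge0.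
rewrite -ge0_integralZl; [|by []|mfunw| |by rewrite lee_fin]; last 2 first.
- by move=> x y; rewrite mule_ge0 ?lee_fin ?wt_ge0.
- by move=> x _; apply: integral_ge0 => y _; rewrite mule_ge0 ?lee_fin ?wt_ge0.
apply: eq_integral => b _.
rewrite (radial (fun s => F (b ^+ 2 + s, b))); [|by mfun|by []].
congr (_ * _)%E.
rewrite -[RHS](ge0_integral_shift (b ^+ 2)); last 2 first.
- by mfunw.
- by move=> y; rewrite mule_ge0 ?lee_fin ?wt_ge0.
by apply: eq_integral => s _; rewrite addrK addrC.
Qed.

End slicing.

Section compare.
Context {R : realType}.
Local Notation mR := (measurableTypeR R).

Definition radial_cst n (lam : R) := 0 < lam /\
  forall g : R -> \bar R, measurable_fun setT g -> (forall x, 0 <= g x)%E ->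
    (\int[@lebesgue_tuple R n]_x (g (dot x x)) =
     lam%:E * \int[leb R]_s ((wt n s)%:E * g s))%E.

Lemma wtS n (s : R) : wt n.+1 s = Num.sqrt s * wt n s.
Proof. by rewrite /wt; case: ifP => _; rewrite ?mulr0// exprS mulrA. Qed.

Lemma wtSS n (s : R) : 0 < s -> wt n.+2 s = Num.sqrt s ^+ n.
Proof.
move=> s0; rewrite !wtS mulrA -expr2 sqr_sqrtr ?ltW// /wt s0.
by field; rewrite gt_eqF.
Qed.

Lemma radial_cst_slice n (lam1 lam2 : R) :
  radial_cst n.+1 lam1 -> radial_cst n.+2 lam2 ->
  (lam2%:E = lam1%:E * \int[leb R]_p (wt n.+1 (1 - p ^+ 2))%:E)%E.
Proof.
move=> [l1 rad1] [l2 rad2]; set I := (\int[leb R]_p _)%E.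
have I0 : (0 <= I)%E by apply: integral_ge0 => p _; rewrite lee_fin wt_ge0.
have mg : measurable_fun setT (fun s : R => (shell s)%:E) by mfunw.
have g0 (s : R) : (0 <= (shell s)%:E)%E by rewrite lee_fin shell_ge0.
set X := (\int[leb R]_s ((wt n.+2 s)%:E * (shell s)%:E))%E.
have X0 : (0 <= X)%E by apply: integral_ge0 => s _; rewrite mule_ge0 ?lee_fin ?wt_ge0 ?shell_ge0.
have E : (lam2%:E * X = lam1%:E * (I * X))%E.
  rewrite -(rad2 _ mg g0) ge0_integral_tcons; [|by mfunw|by []].
  under eq_integral do under eq_integral do rewrite dot_tcons -expr2.
  rewrite (ge0_integral_slice (ltW l1) rad1 (F := fun z => (shell z.1)%:E)); [|by mfunw|by []].
  congr (_ * _)%E.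
  rewrite -ge0_integralZl; [|by []|by mfunw| |by []]; last first.
    by move=> s _; rewrite mule_ge0 ?lee_fin ?wt_ge0 ?shell_ge0.
  apply: eq_integral => s _.
  have [s0|s0] := ltP 0 s; last first.
    rewrite [in RHS]/wt ltNge s0/= mul0e mule0 integral0_eq// => b _.
    by rewrite /wt subr_gt0 ltNge (le_trans s0) ?sqr_ge0//= mul0e.
  have rs : 0 < Num.sqrt s by rewrite sqrtr_gt0.
  rewrite (ge0_integral_scale rs); last 2 first.
  - by mfunw.
  - by move=> b; rewrite mule_ge0 ?lee_fin ?wt_ge0 ?shell_ge0.
  rewrite /= ge0_integralZr; [|by []|by mfunw| |by []]; last first.
    by move=> b _; rewrite lee_fin wt_ge0.
  rewrite [in RHS]muleA muleA; congr (_ * _)%E.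
  rewrite muleC -ge0_integralZr; [|by []|by mfunw| |by rewrite lee_fin ltW]; last first.
    by move=> b _; rewrite lee_fin wt_ge0.
  rewrite /I -ge0_integralZr; [|by []|by mfunw| |by rewrite lee_fin wt_ge0]; last first.
    by move=> b _; rewrite lee_fin wt_ge0.
  apply: eq_integral => b _; rewrite -!EFinM; congr EFin.
  rewrite exprMn sqr_sqrtr ?ltW// -[X in X - _]mulr1 -mulrBr wtM//.
  by rewrite [wt n.+2 s]wtS; ring.
have Xy : (X < +oo)%E.
  have [v v0 vE] := shell_integral_fin (R := R) n.+2.
  have := rad2 _ mg g0; rewrite vE -/X => vX.
  rewrite ltey; apply/eqP => Xoo; move: vX; rewrite Xoo gt0_muley ?lte_fin//.
have Xgt : (0 < X)%E.
  have : (\int[leb R]_(v in `[(1 : R)%R, (4 : R)%R]) (1%:E) <= X)%E.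
    rewrite integral_mkcond; apply: ge0_le_integral => //.
    - by move=> v _; rewrite /patch; case: ifP.
    - by apply/(measurable_restrictT (cst 1%:E)) => //; exact: measurable_cst.
    - by mfunw.
    move=> v _; rewrite /patch; case: ifPn => [|_]; last first.
      by rewrite mule_ge0// lee_fin ?wt_ge0 ?shell_ge0.
    rewrite inE/= in_itv/= => v14; rewrite /shell v14/= mule1 lee_fin.
    have /andP[v1 _] := v14.
    rewrite wtSS ?(lt_le_trans _ v1)// exprn_ege1// -[leLHS]sqrtr1.
    exact: ler_wsqrtr.
  rewrite integral_cst// mul1e [X in (X <= _)%E]lebesgue_measure_itv/= lte_fin ifT; last by lra.
  by apply: lt_le_trans; rewrite -EFinD lte_fin; lra.
have XE : X = (fine X)%:E by rewrite fineK// ge0_fin_numE.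
have fX : 0 < fine X by rewrite fine_gt0// Xgt.
have : (lam2%:E * X * (fine X)^-1%:E = lam1%:E * (I * X) * (fine X)^-1%:E)%E by rewrite E.
rewrite [in X in X -> _]XE -!muleA -!EFinM mulfV ?gt_eqF// mulr1 => ->.
by rewrite mule1.
Qed.

Lemma slice_key n (lam1 lam2 S s b : R) : 0 < S -> 0 < s -> 0 <= lam1 ->
  (lam2%:E = lam1%:E * \int[leb R]_p (wt n.+1 (1 - p ^+ 2))%:E)%E ->
  ((lam2 * Num.sqrt (Num.sqrt S) * wt n.+2 (s - b ^+ 2))%:E <=
   (lam1 * Num.sqrt (Num.sqrt s))%:E *
   \int[leb R]_y (wt n.+1 (s - (b + y ^+ 2 / (2 * Num.sqrt S)) ^+ 2))%:E)%E.
Proof.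
move=> S0 s0 l1 lE.
set r := Num.sqrt S; set rho := Num.sqrt s.
have r0 : 0 < r by rewrite sqrtr_gt0.
have rho0 : 0 < rho by rewrite sqrtr_gt0.
have sE : s = rho ^+ 2 by rewrite sqr_sqrtr ?ltW.
have [sb|sb] := ltP 0 (s - b ^+ 2); last first.
  rewrite [X in (lam2 * _ * X)%R]/wt ltNge sb/= mulr0 mule_ge0//.
    by rewrite lee_fin mulr_ge0 ?sqrtr_ge0.
  by apply: integral_ge0 => y _; rewrite lee_fin wt_ge0.
have /andP[b1 b2] : (- rho < b) && (b < rho).
  by rewrite -ltr_norml -sqrtr_sqr /rho ltr_sqrt// -subr_gt0.
have d0 : 0 < rho - b by rewrite subr_gt0.
have e0 : 0 < rho + b by rewrite -ltrBlDl sub0r.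
pose c := Num.sqrt (2 * r * (rho - b)).
have c0 : 0 < c by rewrite sqrtr_gt0 !mulr_gt0.
rewrite (ge0_integral_scale c0); last 2 first.
- by mfunw.
- by move=> y; rewrite lee_fin wt_ge0.
have mw : measurable_fun setT (fun p : mR => (wt n.+1 (1 - p ^+ 2))%:E) by mfunw.
have pw (p : R) : (((wt n.+1 (rho - b) * (wt n.+2 (rho + b) / Num.sqrt (2 * rho)))%:E *
    (wt n.+1 (1 - p ^+ 2))%:E)%E <=
    (wt n.+1 (s - (b + (c * p) ^+ 2 / (2 * r)) ^+ 2))%:E)%E.
  have [p1|p1] := ltP 0 (1 - p ^+ 2); last first.
    by rewrite [X in (_ * X%:E)%E]/wt ltNge p1/= mule0 lee_fin wt_ge0.
  set A := rho + b + (rho - b) * p ^+ 2.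
  have A1 : rho + b <= A by rewrite lerDl mulr_ge0 ?sqr_ge0 ?ltW.
  have A2 : A <= 2 * rho.
    have : (rho - b) * p ^+ 2 <= (rho - b) * 1 by rewrite ler_pM2l// -subr_ge0 ltW.
    by rewrite /A mulr1; lra.
  have A0 : 0 < A by apply: lt_le_trans A1.
  have -> : s - (b + (c * p) ^+ 2 / (2 * r)) ^+ 2 = (rho - b) * (A * (1 - p ^+ 2)).
    rewrite exprMn sqr_sqrtr; last by rewrite ltW// !mulr_gt0.
    by rewrite sE /A; field; rewrite gt_eqF.
  rewrite wtM// wtM// -EFinM lee_fin -mulrA ler_wpM2l ?wt_ge0//.
  rewrite ler_wpM2r ?wt_ge0// ler_pdivrMr ?sqrtr_gt0 ?mulr_gt0//.
  apply: (@le_trans _ _ (wt n.+2 A)).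
    by rewrite !wtSS// lerXn2r ?nnegrE ?sqrtr_ge0//; exact: ler_wsqrtr.
  by rewrite wtS mulrC ler_wpM2l ?wt_ge0//; exact: ler_wsqrtr.
apply: (@le_trans _ _ ((lam1 * Num.sqrt rho)%:E * (c%:E * \int[leb R]_p ((wt n.+1 (rho - b) * (wt n.+2 (rho + b) / Num.sqrt (2 * rho)))%:E *
    (wt n.+1 (1 - p ^+ 2))%:E)))%E); last first.
  rewrite lee_wpmul2l ?lee_fin ?mulr_ge0 ?sqrtr_ge0//.
  rewrite lee_wpmul2l ?lee_fin ?(ltW c0)//.
  apply: ge0_le_integral; [by []| |by mfunw|by mfunw|by move=> p _; exact: pw].
  by move=> p _; rewrite mule_ge0// lee_fin ?mulr_ge0 ?wt_ge0 ?invr_ge0 ?sqrtr_ge0.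
rewrite ge0_integralZl; [|by []|by []| |]; last 2 first.
- by move=> p _; rewrite lee_fin wt_ge0.
- by rewrite lee_fin ?mulr_ge0 ?wt_ge0 ?invr_ge0 ?sqrtr_ge0.
set k := wt _ _ * _.
suff kE : Num.sqrt rho * c * k = Num.sqrt r * wt n.+2 (s - b ^+ 2).
  rewrite [leRHS](_ : _ = ((Num.sqrt rho * c * k)%:E * lam2%:E)%E).
    by rewrite kE -EFinM lee_fin le_eqVlt; apply/orP; left; apply/eqP; ring.
  by rewrite lE !muleA -!EFinM; congr (_ * _)%E; congr EFin; ring.
have -> : s - b ^+ 2 = (rho - b) * (rho + b) by rewrite sE; ring.
rewrite wtM// [in RHS]wtS /k.
have cE : Num.sqrt rho * c = Num.sqrt r * Num.sqrt (rho - b) * Num.sqrt (2 * rho).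
  rewrite -!sqrtrM ?mulr_ge0 ?(ltW r0) ?(ltW d0) ?(ltW rho0)//.
  by congr Num.sqrt; ring.
rewrite cE; field; rewrite gt_eqF// sqrtr_gt0 mulr_gt0//.
Qed.

End compare.

(** * Comparison of radial forms in consecutive dimensions *)

Section radial_compare.
Context {R : realType} (n : nat) (l1 l2 l3 : R).
Hypotheses (rad1 : radial_cst n.+1 l1) (rad2 : radial_cst n.+2 l2)
  (rad3 : radial_cst n.+3 l3).
Variables (f Om : R -> R) (Hk : R * R -> R).
Hypotheses (mf : measurable_fun setT f) (mOm : measurable_fun setT Om)
  (mHk : measurable_fun setT Hk).
Hypotheses (f0 : forall x, 0 <= f x) (Om0 : forall x, 0 <= Om x)
  (Hk0 : forall x, 0 <= Hk x).
Local Notation mR := (measurableTypeR R).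

(* Weighted so that phi on R^(n+2) and f on R^(n+3) have the same L^2 norm. *)
Definition lower_dim (s : R) : R := Num.sqrt (l3 / l2) * Num.sqrt (Num.sqrt s) * f s.

Let phi := lower_dim.

Lemma measurable_lower_dim : measurable_fun setT phi.
Proof. by rewrite /phi /lower_dim; mfun. Qed.

Let mphi := measurable_lower_dim.

Lemma lower_dim_ge0 s : 0 <= phi s.
Proof. by rewrite /phi /lower_dim !mulr_ge0 ?sqrtr_ge0. Qed.

Let phi0 := lower_dim_ge0.

Let L1 (S s b : R) : R := f S * f s * Hk (S, s) * Om (S + s - 2 * (Num.sqrt S * b)).
Let L2 (S s b y : R) : R :=
  phi S * phi s * Hk (S, s) * Om (y ^+ 2 + S + s - 2 * (Num.sqrt S * b)).

Let L1_0 S s b : 0 <= L1 S s b.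
Proof. by rewrite /L1 !mulr_ge0. Qed.
Let L2_0 S s b y : 0 <= L2 S s b y.
Proof. by rewrite /L2 !mulr_ge0 ?phi0. Qed.

Let I1 (S s : R) : \bar R := (\int[leb R]_b ((wt n.+2 (s - b ^+ 2))%:E * (L1 S s b)%:E))%E.
Let J1 (S : R) : \bar R := (\int[leb R]_s I1 S s)%E.
Let I2 (S s : R) : \bar R := (\int[leb R]_b ((wt n.+1 (s - b ^+ 2))%:E * \int[leb R]_y (L2 S s b y)%:E))%E.
Let J2 (S : R) : \bar R := (\int[leb R]_s I2 S s)%E.

Let I1_0 S s : (0 <= I1 S s)%E.
Proof. by apply: integral_ge0 => b _; rewrite mule_ge0// lee_fin ?wt_ge0. Qed.

Let J1_0 S : (0 <= J1 S)%E.
Proof. by apply: integral_ge0 => s _; exact: I1_0. Qed.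

Let I2_0 S s : (0 <= I2 S s)%E.
Proof.
apply: integral_ge0 => b _; rewrite mule_ge0// ?lee_fin ?wt_ge0//.
by apply: integral_ge0 => y _; rewrite lee_fin.
Qed.

Let J2_0 S : (0 <= J2 S)%E.
Proof. by apply: integral_ge0 => s _; exact: I2_0. Qed.

Let mI1 : measurable_fun setT (fun z : R * R => I1 z.1 z.2).
Proof.
rewrite /I1 /L1; mfunw => z b.
by rewrite mule_ge0// lee_fin ?wt_ge0// !mulr_ge0.
Qed.

Let mI2 : measurable_fun setT (fun z : R * R => I2 z.1 z.2).
Proof.
rewrite /I2 /L2; mfunw.
  by move=> z y; rewrite lee_fin !mulr_ge0 ?phi0.
move=> z b; rewrite mule_ge0// ?lee_fin ?wt_ge0//.
by apply: integral_ge0 => y _; rewrite lee_fin !mulr_ge0 ?phi0.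
Qed.

Let mJ1 : measurable_fun setT J1.
Proof. exact: (@measurable_integral2 _ _ _ _ R (leb R) I1). Qed.

Let mJ2 : measurable_fun setT J2.
Proof. exact: (@measurable_integral2 _ _ _ _ R (leb R) I2). Qed.

Let upper_dimE :
  (\int[@lebesgue_tuple R n.+3]_xi \int[@lebesgue_tuple R n.+3]_eta
     (f (dot xi xi) * f (dot eta eta) * Hk (dot xi xi, dot eta eta) *
      Om (dot xi xi + dot eta eta - 2 * dot xi eta))%:E =
   \int[leb R]_S ((l3 * wt n.+3 S * l2)%:E * J1 S))%E.
Proof.
have [l2p r2] := rad2; have [l3p r3] := rad3.
pose G S := (l2%:E * J1 S)%E.
transitivity (\int[@lebesgue_tuple R n.+3]_xi G (dot xi xi))%E.
  apply: eq_integral => xi _.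
  rewrite (ge0_integral_rad (F := fun z => (f (dot xi xi) * f z.1 * Hk (dot xi xi, z.1) *
      Om (dot xi xi + z.1 - 2 * z.2))%:E)); last 2 first.
  - by mfun.
  - by move=> z; rewrite lee_fin !mulr_ge0.
  rewrite (ge0_integral_slice (ltW l2p) r2 (F := fun z => (L1 (dot xi xi) z.1 z.2)%:E)).
  - reflexivity.
  - by rewrite /L1; mfun.
  - by move=> z; rewrite lee_fin.
have mG : measurable_fun setT G.
  by apply: emeasurable_funM; [exact: measurable_cst|exact: mJ1].
have G0 S : (0 <= G S)%E by apply: mule_ge0; [rewrite lee_fin ltW|exact: J1_0].
rewrite (r3 G mG G0) -ge0_integralZl; [|by []| | |by rewrite lee_fin ltW].
- by apply: eq_integral => S _; rewrite /G !muleA -!EFinM.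
- by mfunw.
- by move=> S _; apply: mule_ge0; [rewrite lee_fin wt_ge0|exact: G0].
Qed.

Let lower_dimE :
  (\int[@lebesgue_tuple R n.+2]_xi \int[@lebesgue_tuple R n.+2]_eta \int[leb R]_y
     (phi (dot xi xi) * phi (dot eta eta) * Hk (dot xi xi, dot eta eta) *
      Om (y ^+ 2 + dot xi xi + dot eta eta - 2 * dot xi eta))%:E =
   \int[leb R]_S ((l2 * wt n.+2 S * l1)%:E * J2 S))%E.
Proof.
have [l2p r2] := rad2; have [l1p r1] := rad1.
pose G S := (l1%:E * J2 S)%E.
transitivity (\int[@lebesgue_tuple R n.+2]_xi G (dot xi xi))%E.
  apply: eq_integral => xi _.
  rewrite (ge0_integral_rad (F := fun z => (\int[leb R]_y (phi (dot xi xi) * phi z.1 * Hk (dot xi xi, z.1) *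
      Om (y ^+ 2 + dot xi xi + z.1 - 2 * z.2))%:E)%E)); last 2 first.
  - mfun; last by move=> z y; rewrite lee_fin !mulr_ge0 ?phi0.
  - by move=> z; apply: integral_ge0 => y _; rewrite lee_fin !mulr_ge0 ?phi0.
  rewrite (ge0_integral_slice (ltW l1p) r1 (F := fun z => (\int[leb R]_y (L2 (dot xi xi) z.1 z.2 y)%:E)%E)).
  - reflexivity.
  - by rewrite /L2; mfun; move=> z y; rewrite lee_fin !mulr_ge0 ?phi0.
  - by move=> z; apply: integral_ge0 => y _; rewrite lee_fin.
have mG : measurable_fun setT G.
  by apply: emeasurable_funM; [exact: measurable_cst|exact: mJ2].
have G0 S : (0 <= G S)%E by apply: mule_ge0; [rewrite lee_fin ltW|exact: J2_0].
rewrite (r2 G mG G0) -ge0_integralZl; [|by []| | |by rewrite lee_fin ltW].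
- by apply: eq_integral => S _; rewrite /G !muleA -!EFinM.
- by mfunw.
- by move=> S _; apply: mule_ge0; [rewrite lee_fin wt_ge0|exact: G0].
Qed.

Let shift_b (S s : R) : 0 < S ->
  (\int[leb R]_b ((wt n.+1 (s - b ^+ 2))%:E * \int[leb R]_y (L2 S s b y)%:E) =
   \int[leb R]_b ((phi S * phi s * Hk (S, s) * Om (S + s - 2 * (Num.sqrt S * b)))%:E *
     \int[leb R]_y (wt n.+1 (s - (b + y ^+ 2 / (2 * Num.sqrt S)) ^+ 2))%:E))%E.
Proof.
move=> S0; have r0 : 0 < Num.sqrt S by rewrite sqrtr_gt0.
transitivity (\int[leb R]_b \int[leb R]_y ((wt n.+1 (s - b ^+ 2))%:E * (L2 S s b y)%:E))%E.
  apply: eq_integral => b _; rewrite ge0_integralZl; [by []|by []|by rewrite /L2; mfun| |].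
    by move=> y _; rewrite lee_fin.
  by rewrite lee_fin wt_ge0.
transitivity (\int[leb R]_y \int[leb R]_b ((wt n.+1 (s - b ^+ 2))%:E * (L2 S s b y)%:E))%E.
  rewrite tonelli2; [by []|by rewrite /L2; mfunw|].
  by move=> b y; rewrite mule_ge0// lee_fin ?wt_ge0.
transitivity (\int[leb R]_y \int[leb R]_b ((wt n.+1 (s - (b + y ^+ 2 / (2 * Num.sqrt S)) ^+ 2))%:E *
   (phi S * phi s * Hk (S, s) * Om (S + s - 2 * (Num.sqrt S * b)))%:E))%E.
  apply: eq_integral => y _.
  rewrite -[LHS](ge0_integral_shift (y ^+ 2 / (2 * Num.sqrt S))); last 2 first.
  - by rewrite /L2; mfunw.
  - by move=> b; rewrite mule_ge0// lee_fin ?wt_ge0.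
  apply: eq_integral => b _; congr (_ * (_ * Om _)%:E)%E.
  by field; rewrite gt_eqF.
transitivity (\int[leb R]_b \int[leb R]_y ((wt n.+1 (s - (b + y ^+ 2 / (2 * Num.sqrt S)) ^+ 2))%:E *
   (phi S * phi s * Hk (S, s) * Om (S + s - 2 * (Num.sqrt S * b)))%:E))%E.
  rewrite tonelli2; [by []|by mfunw|].
  by move=> b y; rewrite mule_ge0// lee_fin ?wt_ge0// !mulr_ge0 ?phi0.
apply: eq_integral => b _; rewrite ge0_integralZr; [by rewrite muleC|by []|by mfunw| |].
  by move=> y _; rewrite lee_fin wt_ge0.
by rewrite lee_fin !mulr_ge0 ?phi0.
Qed.

Lemma radial_compare :
  (\int[@lebesgue_tuple R n.+3]_xi \int[@lebesgue_tuple R n.+3]_eta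
     (f (dot xi xi) * f (dot eta eta) * Hk (dot xi xi, dot eta eta) *
      Om (dot xi xi + dot eta eta - 2 * dot xi eta))%:E <=
   \int[@lebesgue_tuple R n.+2]_xi \int[@lebesgue_tuple R n.+2]_eta \int[leb R]_y
     (phi (dot xi xi) * phi (dot eta eta) * Hk (dot xi xi, dot eta eta) *
      Om (y ^+ 2 + dot xi xi + dot eta eta - 2 * dot xi eta))%:E)%E.
Proof.
rewrite upper_dimE lower_dimE.
have [l1p r1] := rad1; have [l2p r2] := rad2; have [l3p r3] := rad3.
have mwt a m c (J : mR -> \bar R) : measurable_fun setT J ->
    measurable_fun setT (fun S : mR => ((a * wt m S * c)%:E * J S)%E).
  by move=> mJ; apply: emeasurable_funM; [mfunw|].
apply: ge0_le_integral; [by []| |exact: mwt|exact: mwt|].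
  by move=> S _; apply: mule_ge0; [rewrite lee_fin !mulr_ge0 ?wt_ge0 ?ltW|exact: J1_0].
move=> S _; have [S0|S0] := ltP 0 S; last first.
  have E a m c X : ((a * wt m S * c)%:E * X = 0)%E by rewrite /wt ltNge S0/= mulr0 mul0r mul0e.
  by rewrite (E l3 n.+3 l2) (E l2 n.+2 l1).
have mI1' : measurable_fun setT (I1 S).
  exact: (measurableT_comp mI1 (@pair1_measurable _ _ _ _ S)).
have mI2' : measurable_fun setT (I2 S).
  exact: (measurableT_comp mI2 (@pair1_measurable _ _ _ _ S)).
rewrite -[leLHS]ge0_integralZl; [|by []|exact: mI1'|by move=> s _; exact: I1_0|]; last first.
  by rewrite lee_fin !mulr_ge0 ?wt_ge0 ?ltW.
rewrite -[leRHS]ge0_integralZl; [|by []|exact: mI2'|by move=> s _; exact: I2_0|]; last first.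
  by rewrite lee_fin !mulr_ge0 ?wt_ge0 ?ltW.
apply: ge0_le_integral; [by []| | | |].
- by move=> s _; apply: mule_ge0; [rewrite lee_fin !mulr_ge0 ?wt_ge0 ?ltW|exact: I1_0].
- by apply: emeasurable_funM; [exact: measurable_cst|exact: mI1'].
- by apply: emeasurable_funM; [exact: measurable_cst|exact: mI2'].
move=> s _; have [s0|s0] := ltP 0 s; last first.
  rewrite [X in (_ * X <= _)%E]integral0_eq ?mule0.
    by apply: mule_ge0; [rewrite lee_fin !mulr_ge0 ?wt_ge0 ?ltW|exact: I2_0].
  move=> b _; rewrite [X in (X%:E * _)%E]/wt subr_gt0 ltNge (le_trans s0) ?sqr_ge0//=.
  by rewrite mul0e.
rewrite [I2 S s]shift_b//.
rewrite -[leLHS]ge0_integralZl; [|by []|by rewrite /L1; mfunw| |]; last 2 first.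
- by move=> b _; rewrite mule_ge0// lee_fin ?wt_ge0.
- by rewrite lee_fin !mulr_ge0 ?wt_ge0 ?ltW.
rewrite -[leRHS]ge0_integralZl; [|by []| | |]; last 3 first.
- by mfunw; move=> z y; rewrite lee_fin wt_ge0.
- move=> b _; apply: mule_ge0; first by rewrite lee_fin !mulr_ge0 ?phi0.
  by apply: integral_ge0 => y _; rewrite lee_fin wt_ge0.
- by rewrite lee_fin !mulr_ge0 ?wt_ge0 ?ltW.
apply: ge0_le_integral; [by []| | | |].
- move=> b _; apply: mule_ge0; first by rewrite lee_fin !mulr_ge0 ?wt_ge0 ?ltW.
  by apply: mule_ge0; rewrite lee_fin ?wt_ge0 ?L1_0.
- by rewrite /L1; mfunw.
- by mfunw; move=> z y; rewrite lee_fin wt_ge0.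
move=> b _.
have key := slice_key b S0 s0 (ltW l1p) (radial_cst_slice rad1 rad2).
set X := (\int[leb R]_y _)%E in key *.
set O := Om _.
pose k := l3 * wt n.+2 S * Num.sqrt (Num.sqrt S) * (f S * f s * Hk (S, s) * O).
have O0 : 0 <= O by exact: Om0.
have k0 : 0 <= k.
  by rewrite /k mulr_ge0 // !mulr_ge0 ?wt_ge0 ?sqrtr_ge0 ?(ltW l3p).
have rr (x : R) : Num.sqrt (Num.sqrt x) * Num.sqrt (Num.sqrt x) = Num.sqrt x.
  by rewrite -expr2 sqr_sqrtr ?sqrtr_ge0.
have ll : Num.sqrt (l3 / l2) * Num.sqrt (l3 / l2) = l3 / l2.
  by rewrite -expr2 sqr_sqrtr// divr_ge0 ?ltW.
have := lee_wpmul2l (x := k%:E) _ key; rewrite lee_fin k0 => /(_ isT).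
rewrite !muleA -!EFinM => keyk; apply: le_trans (le_trans keyk _).
  rewrite lee_fin le_eqVlt; apply/orP; left; apply/eqP.
  have w3 : wt n.+3 S = Num.sqrt (Num.sqrt S) * Num.sqrt (Num.sqrt S) * wt n.+2 S.
    by rewrite wtS rr.
  by rewrite /k /L1 -/O w3; ring.
rewrite le_eqVlt; apply/orP; left; apply/eqP; congr (_ * _)%E; congr EFin.
rewrite /k /phi /lower_dim.
transitivity (l2 * wt n.+2 S * l1 * ((Num.sqrt (l3 / l2) * Num.sqrt (l3 / l2)) * (Num.sqrt (Num.sqrt S) * Num.sqrt (Num.sqrt s)) * (f S * f s * Hk (S, s) * O))); last by ring.
by rewrite ll; field; rewrite gt_eqF.
Qed.

End radial_compare.

Section kernel_compare.
Context {R : realType}.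
Local Notation mR := (measurableTypeR R).

Lemma mule_half (x : \bar R) : (0 <= x)%E -> ((2^-1)%:E * (x + x) = x)%E.
Proof.
case: x => [r _|_|//]; first by rewrite -EFinD -EFinM; congr EFin; field.
by rewrite addye// gt0_muley// lte_fin invr_gt0.
Qed.

Lemma schur_test d (T : measurableType d) (m : {sigma_finite_measure set T -> \bar R})
    (G h : T -> R) (K : T -> T -> R) :
  measurable_fun setT G -> measurable_fun setT h ->
  measurable_fun setT (fun z : T * T => K z.1 z.2) ->
  (forall x, 0 <= G x) -> (forall x, 0 < h x) -> (forall x y, 0 <= K x y) ->
  (forall x y, K x y = K y x) ->
  (\int[m]_x \int[m]_y (G x * G y * K x y)%:E <=
   \int[m]_x ((G x ^+ 2 / h x)%:E * \int[m]_y (h y * K x y)%:E))%E.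
Proof.
move=> mG mh mK G0 h0 K0 KC.
have hge x : 0 <= h x by exact: ltW.
pose u x y := G x ^+ 2 / h x * (h y * K x y).
have u0 x y : 0 <= u x y by rewrite !mulr_ge0 ?sqr_ge0 ?invr_ge0.
have mu1 x : measurable_fun setT (fun y => (u x y)%:E).
  rewrite /u; mfun; exact: (measurableT_comp mK (@pair1_measurable _ _ _ _ x)).
have mKs : measurable_fun setT (fun z : T * T => K z.2 z.1).
  by under eq_fun do rewrite KC.
have mu2 : measurable_fun setT (fun z : T * T => (u z.1 z.2)%:E) by rewrite /u; mfun.
have mu2C : measurable_fun setT (fun z : T * T => (u z.2 z.1)%:E) by rewrite /u; mfun.
have mu1C x : measurable_fun setT (fun y => (u y x)%:E).
  exact: (measurableT_comp mu2C (@pair1_measurable _ _ _ _ x)).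
have I0 x : (0 <= \int[m]_y (u x y)%:E)%E by apply: integral_ge0 => y _; rewrite lee_fin.
have I0C x : (0 <= \int[m]_y (u y x)%:E)%E by apply: integral_ge0 => y _; rewrite lee_fin.
have mI : measurable_fun setT (fun x => \int[m]_y (u x y)%:E)%E.
  by apply: (@measurable_integral2 _ _ _ _ R m (fun x y => (u x y)%:E)) => // x y; rewrite lee_fin.
have mIC : measurable_fun setT (fun x => \int[m]_y (u y x)%:E)%E.
  by apply: (@measurable_integral2 _ _ _ _ R m (fun x y => (u y x)%:E)) => // x y; rewrite lee_fin.
have -> : (\int[m]_x ((G x ^+ 2 / h x)%:E * \int[m]_y (h y * K x y)%:E) =
    \int[m]_x ((2^-1)%:E * (\int[m]_y (u x y)%:E + \int[m]_y (u y x)%:E)))%E.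
  rewrite [RHS]ge0_integralZl; [|by []|exact: emeasurable_funD| |by rewrite lee_fin]; last first.
    by move=> x _; apply: adde_ge0; [exact: I0|exact: I0C].
  rewrite ge0_integralD; [|by []|by move=> x _; exact: I0|exact: mI|by move=> x _; exact: I0C|exact: mIC].
  rewrite [X in (_ * (_ + X))%E](tonelli2 (fun x y => (u y x)%:E)); [|exact: mu2C|by move=> x y; rewrite lee_fin].
  rewrite mule_half; last by apply: integral_ge0 => x _; exact: I0.
  apply: eq_integral => x _; rewrite -ge0_integralZl; last 4 first.
  - by [].
  - by mfun; exact: (measurableT_comp mK (@pair1_measurable _ _ _ _ x)).
  - by move=> y _; rewrite lee_fin mulr_ge0.
  - by rewrite lee_fin divr_ge0 ?sqr_ge0.
  by apply: eq_integral => y _; rewrite -EFinM.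
apply: ge0_le_integral; [by []| | | |].
- by move=> x _; apply: integral_ge0 => y _; rewrite lee_fin !mulr_ge0.
- mfun; by move=> x y; rewrite lee_fin !mulr_ge0.
- by apply: emeasurable_funM; [exact: measurable_cst|exact: emeasurable_funD].
move=> x _; rewrite -ge0_integralD; [|by []| |exact: mu1| |exact: mu1C]; last 2 first.
- by move=> y _; rewrite lee_fin.
- by move=> y _; rewrite lee_fin.
rewrite -ge0_integralZl; [|by []|exact: emeasurable_funD| |by rewrite lee_fin]; last first.
  by move=> y _; apply: adde_ge0; rewrite lee_fin.
apply: ge0_le_integral; [by []| | | |].
- by move=> y _; rewrite lee_fin !mulr_ge0.
- by mfun; exact: (measurableT_comp mK (@pair1_measurable _ _ _ _ x)).
- by apply: emeasurable_funM; [exact: measurable_cst|exact: emeasurable_funD].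
move=> y _; rewrite -EFinD -EFinM lee_fin -subr_ge0 /u (KC y x).
have -> : 2^-1 * (G x ^+ 2 / h x * (h y * K x y) + G y ^+ 2 / h y * (h x * K x y)) -
    G x * G y * K x y = (G x * h y - G y * h x) ^+ 2 / (2 * h x * h y) * K x y.
  by field; rewrite !gt_eqF.
by rewrite mulr_ge0// divr_ge0 ?sqr_ge0// !mulr_ge0.
Qed.

Lemma gauss_integral_fin n : exists2 C : R, 0 <= C &
  (\int[@lebesgue_tuple R n]_x (expR (- dot x x))%:E = C%:E)%E.
Proof.
exists (Num.sqrt pi ^+ n); first by rewrite exprn_ge0// sqrtr_ge0.
rewrite -(ge0_integral_prod n (g := fun x => expR (- x ^+ 2))).
- apply: eq_integral => x _; congr EFin.
  by rewrite -expR_sum /dot sumrN; congr (expR (- _)); apply: eq_bigr => i _; rewrite expr2.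
- by mfun.
- by move=> x; exact: expR_ge0.
- exact: integralT_gauss.
Qed.

Variables (n : nat) (Om : R -> R) (Hk : R * R -> R) (A : R).
Hypotheses (mOm : measurable_fun setT Om) (mHk : measurable_fun setT Hk).
Hypotheses (Om0 : forall x, 0 <= Om x) (Hk0 : forall x, 0 <= Hk x)
  (HkC : forall s t, Hk (s, t) = Hk (t, s)) (A0 : 0 <= A).
Hypothesis star : forall phi : R -> R, measurable_fun setT phi -> (forall x, 0 <= phi x) ->
  (\int[@lebesgue_tuple R n.+2]_xi \int[@lebesgue_tuple R n.+2]_eta \int[leb R]_y
     (phi (dot xi xi) * phi (dot eta eta) * Hk (dot xi xi, dot eta eta) *
      Om (y ^+ 2 + dot xi xi + dot eta eta - 2 * dot xi eta))%:E <=
   A%:E * \int[@lebesgue_tuple R n.+2]_xi (phi (dot xi xi) ^+ 2)%:E)%E.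

Lemma dotC m (s t : Rn R m) : dot s t = dot t s.
Proof. by apply: eq_bigr => i _; rewrite mulrC. Qed.

Lemma kernel_compare_radial (l1 l2 l3 : R) (f : R -> R) :
  radial_cst n.+1 l1 -> radial_cst n.+2 l2 -> radial_cst n.+3 l3 ->
  measurable_fun setT f -> (forall x, 0 <= f x) ->
  (\int[@lebesgue_tuple R n.+3]_xi \int[@lebesgue_tuple R n.+3]_eta
     (f (dot xi xi) * f (dot eta eta) * Hk (dot xi xi, dot eta eta) *
      Om (dot xi xi + dot eta eta - 2 * dot xi eta))%:E <=
   A%:E * \int[@lebesgue_tuple R n.+3]_xi (f (dot xi xi) ^+ 2)%:E)%E.
Proof.
move=> rad1 rad2 rad3 mf f0.
apply: (le_trans (radial_compare rad1 rad2 rad3 mf mOm mHk f0 Om0 Hk0)).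
have mphi := measurable_lower_dim l2 l3 mf.
apply: (le_trans (star mphi (lower_dim_ge0 l2 l3 f0))).
have [l2p r2] := rad2; have [l3p r3] := rad3.
rewrite (r2 (fun s => (lower_dim l2 l3 f s ^+ 2)%:E)); [|by mfun|by move=> s; rewrite lee_fin sqr_ge0].
rewrite (r3 (fun s => (f s ^+ 2)%:E)); [|by mfun|by move=> s; rewrite lee_fin sqr_ge0].
rewrite le_eqVlt; apply/orP; left; apply/eqP; congr (_ * _)%E.
rewrite -[LHS]ge0_integralZl; [|by []|by mfunw| |by rewrite lee_fin ltW]; last first.
  by move=> s _; rewrite mule_ge0// lee_fin ?wt_ge0// sqr_ge0.
rewrite -[RHS]ge0_integralZl; [|by []|by mfunw| |by rewrite lee_fin ltW]; last first.
  by move=> s _; rewrite mule_ge0// lee_fin ?wt_ge0// sqr_ge0.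
apply: eq_integral => s _; rewrite -!EFinM; congr EFin.
rewrite /lower_dim !exprMn !sqr_sqrtr ?sqrtr_ge0 ?divr_ge0 ?ltW// [wt n.+3 s]wtS.
by field; rewrite gt_eqF.
Qed.

Lemma kernel_compare (G : Rn R n.+3 -> R) :
  measurable_fun setT G -> (forall x, 0 <= G x) ->
  (\int[@lebesgue_tuple R n.+3]_xi (G xi ^+ 2)%:E < +oo)%E ->
  (\int[@lebesgue_tuple R n.+3]_xi \int[@lebesgue_tuple R n.+3]_eta
     (G xi * G eta * Hk (dot xi xi, dot eta eta) *
      Om (dot xi xi + dot eta eta - 2 * dot xi eta))%:E <=
   A%:E * \int[@lebesgue_tuple R n.+3]_xi (G xi ^+ 2)%:E)%E.
Proof.
move=> mG G0 Goo.
have [c1 [l1 [_ l1p _ r1]]] := polar_radial (R := R) n.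
have [c2 [l2 [_ l2p _ r2]]] := polar_radial (R := R) n.+1.
have [c [l3 [cp l3p polG r3]]] := polar_radial (R := R) n.+2.
pose m s := ((c / l3)%:E * sph (fun x => (G x ^+ 2)%:E) s)%E.
have mG2 : measurable_fun setT (fun x => (G x ^+ 2)%:E) by mfun.
have G20 x : (0 <= (G x ^+ 2)%:E)%E by rewrite lee_fin sqr_ge0.
have m0 s : (0 <= m s)%E.
  by rewrite /m mule_ge0 ?sph_ge0// lee_fin divr_ge0 ?ltW.
have mm : measurable_fun setT m.
  by apply: emeasurable_funM; [exact: measurable_cst|exact: measurable_sph].
have polm (g : R -> \bar R) : measurable_fun setT g -> (forall x, 0 <= g x)%E ->
    (\int[@lebesgue_tuple R n.+3]_x ((G x ^+ 2)%:E * g (dot x x)) =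
     l3%:E * \int[leb R]_s ((wt n.+3 s)%:E * (m s * g s)))%E.
  move=> mg g0; rewrite (polG _ _ mG2 G20 mg g0).
  have i0 s : (0 <= (wt n.+3 s)%:E * (sph (fun x => (G x ^+ 2)%:E) s * g s))%E.
    by rewrite !mule_ge0 ?lee_fin ?wt_ge0 ?sph_ge0.
  have mi : measurable_fun setT (fun s => (wt n.+3 s)%:E * (sph (fun x => (G x ^+ 2)%:E) s * g s))%E.
    by apply: emeasurable_funM; [mfunw|apply: emeasurable_funM => //; exact: measurable_sph].
  transitivity (l3%:E * ((c / l3)%:E * \int[leb R]_s ((wt n.+3 s)%:E * (sph (fun x => (G x ^+ 2)%:E) s * g s))))%E.
    by rewrite muleA -EFinM; congr (_%:E * _)%E; field; rewrite gt_eqF.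
  congr (_ * _)%E; rewrite -ge0_integralZl; [|by []|exact: mi|by move=> s _; exact: i0|]; last first.
    by rewrite lee_fin divr_ge0 ?ltW.
  by apply: eq_integral => s _; rewrite /m muleCA -muleA.
have intm : (\int[leb R]_s ((wt n.+3 s)%:E * m s) < +oo)%E.
  have := polm (fun=> 1%:E) (measurable_cst _) (fun=> lee01).
  under eq_integral do rewrite mule1.
  under [in X in _ = X -> _]eq_integral do rewrite mule1.
  move=> E; move: Goo; rewrite E.
  have : (0 <= \int[leb R]_s ((wt n.+3 s)%:E * m s))%E.
    by apply: integral_ge0 => s _; rewrite mule_ge0 ?lee_fin ?wt_ge0.
  case: (\int[leb R]_s _)%E => [r| |]//; first by rewrite !ltry.
  by rewrite gt0_muley ?lte_fin// ltxx.
have aefin : {ae leb R, forall s : mR, setT s -> (wt n.+3 s)%:E * m s \is a fin_num}%E.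
  apply: integrable_ae => //; apply/integrableP; split.
    by apply: emeasurable_funM; [mfunw|].
  have mwm : measurable_fun setT (fun s => (wt n.+3 s)%:E * m s)%E by apply: emeasurable_funM; [mfunw|].
  apply: le_lt_trans intm; apply: ge0_le_integral; [exact: measurableT|by move=> s _; exact: abse_ge0| |exact: mwm|].
  - by apply: measurableT_comp => //; exact: mwm.
  - by move=> s _; rewrite gee0_abs// mule_ge0 ?lee_fin ?wt_ge0.
have [C C0 CE] := gauss_integral_fin n.+3.
apply/lee_addgt0Pr => e e0.
pose k := e / (A * C + 1).
have AC : 0 < A * C + 1 by rewrite ltr_wpDl// mulr_ge0.
have k0 : 0 < k by rewrite divr_gt0.
pose f s := Num.sqrt (fine (m s) + k * expR (- s)).
have fp s : 0 < f s.
  by rewrite sqrtr_gt0 ltr_wpDl ?fine_ge0// mulr_gt0// expR_gt0.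
have f0 s : 0 <= f s by exact: ltW.
have mf : measurable_fun setT f by rewrite /f; mfun.
have f2 s : f s ^+ 2 = fine (m s) + k * expR (- s).
  by rewrite sqr_sqrtr// addr_ge0 ?fine_ge0// mulr_ge0 ?expR_ge0 ?ltW.
pose B S := (\int[leb R]_b \int[@lebesgue_tuple R n.+2]_t
   (f (b ^+ 2 + dot t t) * Hk (S, b ^+ 2 + dot t t) *
    Om (S + (b ^+ 2 + dot t t) - 2 * (Num.sqrt S * b)))%:E)%E.
have mB : measurable_fun setT B.
  rewrite /B; mfunv; first by move=> z t; rewrite lee_fin !mulr_ge0.
  by move=> z b; apply: integral_ge0 => t _; rewrite lee_fin !mulr_ge0.
have B0 S : (0 <= B S)%E.
  by do 2 (apply: integral_ge0 => ? _); rewrite lee_fin !mulr_ge0.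
have BE xi : (\int[@lebesgue_tuple R n.+3]_eta
    (f (dot eta eta) * Hk (dot xi xi, dot eta eta) *
      Om (dot xi xi + dot eta eta - 2 * dot xi eta))%:E = B (dot xi xi))%E.
  rewrite (ge0_integral_rad (F := fun z => (f z.1 * Hk (dot xi xi, z.1) *
      Om (dot xi xi + z.1 - 2 * z.2))%:E)); [by []|by mfun|].
  by move=> z; rewrite lee_fin !mulr_ge0.
pose K (xi eta : Rn R n.+3) := Hk (dot xi xi, dot eta eta) * Om (dot xi xi + dot eta eta - 2 * dot xi eta).
have K0 (xi eta : Rn R n.+3) : 0 <= K xi eta by rewrite mulr_ge0.
have KC (xi eta : Rn R n.+3) : K xi eta = K eta xi.
  by rewrite /K HkC (dotC xi eta) [dot xi xi + _]addrC.
have mK : measurable_fun setT (fun z : Rn R n.+3 * Rn R n.+3 => K z.1 z.2).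
  by rewrite /K; mfun.
have mfd : measurable_fun setT (fun x : Rn R n.+3 => f (dot x x)) by mfun.
have LT := schur_test (@lebesgue_tuple R n.+3) mG mfd mK G0 (fun x => fp (dot x x)) K0 KC.
under eq_integral do under eq_integral do rewrite -[_ * Om _]mulrA.
apply: (le_trans LT) => {LT}.
pose g S := ((f S)^-1%:E * B S)%E.
have mg : measurable_fun setT g by rewrite /g; mfun.
have g0 S : (0 <= g S)%E by apply: mule_ge0; [rewrite lee_fin invr_ge0|exact: B0].
have -> : (\int[@lebesgue_tuple R n.+3]_xi ((G xi ^+ 2 / f (dot xi xi))%:E *
     \int[@lebesgue_tuple R n.+3]_eta (f (dot eta eta) * K xi eta)%:E) =
   \int[@lebesgue_tuple R n.+3]_xi ((G xi ^+ 2)%:E * g (dot xi xi)))%E.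
  apply: eq_integral => xi _; rewrite /g -BE muleA -EFinM; congr (_ * _)%E.
  by apply: eq_integral => eta _; rewrite mulrA.
rewrite (polm _ mg g0).
have fB0 S : (0 <= (f S)%:E * B S)%E by apply: mule_ge0; [rewrite lee_fin|exact: B0].
have mfB : measurable_fun setT (fun S => (f S)%:E * B S)%E by mfun.
apply: (@le_trans _ _ (l3%:E * \int[leb R]_s ((wt n.+3 s)%:E * ((f s)%:E * B s)))%E).
  apply: lee_wpmul2l; first by rewrite lee_fin ltW.
  apply: (@ae_ge0_le_integral _ _ R (leb R) setT); first by [].
  - move=> s _; apply: mule_ge0; first by rewrite lee_fin wt_ge0.
    by apply: mule_ge0; [exact: m0|exact: g0].
  - by apply: emeasurable_funM; [mfunw|exact: emeasurable_funM].
  - by move=> s _; apply: mule_ge0; [rewrite lee_fin wt_ge0|exact: fB0].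
  - by apply: emeasurable_funM; [mfunw|].
  apply: filterS aefin => s /(_ I) fin _.
  have [s0|s0] := ltP 0 s; last by rewrite /wt ltNge s0/= !mul0e.
  have ws : 0 < wt n.+3 s by rewrite wtSS// exprn_gt0// sqrtr_gt0.
  have mfin : m s = (fine (m s))%:E.
    rewrite fineK//; move: fin (m0 s); case: (m s) => //=.
    by rewrite gt0_muley ?lte_fin.
  rewrite lee_wpmul2l ?lee_fin ?wt_ge0// /g muleA lee_wpmul2r//.
  rewrite mfin -EFinM lee_fin ler_pdivrMr// -expr2 f2.
  by rewrite lerDl mulr_ge0 ?expR_ge0 ?ltW.
rewrite -(r3 _ mfB fB0).
have -> : (\int[@lebesgue_tuple R n.+3]_x ((f (dot x x))%:E * B (dot x x)) =
  \int[@lebesgue_tuple R n.+3]_xi \int[@lebesgue_tuple R n.+3]_eta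
     (f (dot xi xi) * f (dot eta eta) * Hk (dot xi xi, dot eta eta) *
      Om (dot xi xi + dot eta eta - 2 * dot xi eta))%:E)%E.
  apply: eq_integral => xi _; rewrite -BE -ge0_integralZl; last 4 first.
  - by [].
  - by mfun.
  - by move=> eta _; rewrite lee_fin !mulr_ge0.
  - by rewrite lee_fin ltW.
  by apply: eq_integral => eta _; rewrite -EFinM; congr EFin; rewrite !mulrA.
apply: (le_trans (kernel_compare_radial (conj l1p r1) (conj l2p r2) (conj l3p r3) mf (fun s => ltW (fp s)))).
apply: (@le_trans _ _ (A%:E * (\int[@lebesgue_tuple R n.+3]_xi (G xi ^+ 2)%:E + (k * C)%:E))%E).
  rewrite lee_wpmul2l ?lee_fin//.
  have -> : (\int[@lebesgue_tuple R n.+3]_xi (G xi ^+ 2)%:E = l3%:E * \int[leb R]_s ((wt n.+3 s)%:E * m s))%E.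
    have := polm (fun=> 1%:E) (measurable_cst _) (fun=> lee01).
    under eq_integral do rewrite mule1.
    by under [in X in _ = X -> _]eq_integral do rewrite mule1.
  have mE : measurable_fun setT (fun s : R => (k * expR (- s))%:E) by mfun.
  have E0 (s : R) : (0 <= (k * expR (- s))%:E)%E by rewrite lee_fin mulr_ge0 ?expR_ge0 ?ltW.
  have -> : ((k * C)%:E = l3%:E * \int[leb R]_s ((wt n.+3 s)%:E * (k * expR (- s))%:E))%E.
    rewrite -(r3 _ mE E0) EFinM -CE -ge0_integralZl; [|by []|by mfun| |by rewrite lee_fin ltW].
      by apply: eq_integral => x _; rewrite EFinM.
    by move=> x _; rewrite lee_fin expR_ge0.
  rewrite (r3 (fun s => (f s ^+ 2)%:E)); last 2 first.
  - by mfun.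
  - by move=> s; rewrite lee_fin sqr_ge0.
  have i1 s : (0 <= (wt n.+3 s)%:E * m s)%E by rewrite mule_ge0 ?lee_fin ?wt_ge0.
  have i2 s : (0 <= (wt n.+3 s)%:E * (k * expR (- s))%:E)%E.
    by rewrite mule_ge0 ?lee_fin ?wt_ge0// -lee_fin.
  have mi1 : measurable_fun setT (fun s => (wt n.+3 s)%:E * m s)%E.
    by apply: emeasurable_funM; [mfunw|].
  have mi2 : measurable_fun setT (fun s => (wt n.+3 s)%:E * (k * expR (- s))%:E)%E.
    by mfunw.
  rewrite -ge0_muleDr; [|by apply: integral_ge0|by apply: integral_ge0].
  apply: lee_wpmul2l; first by rewrite lee_fin ltW.
  rewrite -ge0_integralD; [|by []|by []|exact: mi1|by []|exact: mi2].
  apply: ge0_le_integral; [by []| | | |].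
  - by move=> s _; rewrite mule_ge0 ?lee_fin ?wt_ge0 ?sqr_ge0.
  - by mfunw.
  - exact: emeasurable_funD.
  move=> s _; rewrite -ge0_muleDr; [|exact: m0|exact: E0].
  apply: lee_wpmul2l; first by rewrite lee_fin wt_ge0.
  rewrite f2 EFinD; apply: leeD2r.
  by move: (m0 s); case: (m s) => [r| |]//= _; rewrite leey.
have [r r0 ->] : exists2 r, 0 <= r & (\int[@lebesgue_tuple R n.+3]_xi (G xi ^+ 2)%:E)%E = r%:E.
  have i0 : (0 <= \int[@lebesgue_tuple R n.+3]_xi (G xi ^+ 2)%:E)%E by exact: integral_ge0.
  exists (fine (\int[@lebesgue_tuple R n.+3]_xi (G xi ^+ 2)%:E)%E); first exact: fine_ge0.
  by rewrite fineK// ge0_fin_numE.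
rewrite -EFinD -!EFinM -EFinD lee_fin mulrDr lerD2l.
rewrite (_ : A * (k * C) = e * (A * C / (A * C + 1))); last first.
  by rewrite /k; field; rewrite gt_eqF.
by rewrite ler_piMr ?(ltW e0)// ler_pdivrMr// mul1r lerDl.
Qed.

End kernel_compare.

(** * Quadratic forms of oscillatory integrals *)

Section product_sigma_finite.
Context {R : realType} d1 d2 (T1 : measurableType d1) (T2 : measurableType d2)
  (m1 : {sigma_finite_measure set T1 -> \bar R})
  (m2 : {sigma_finite_measure set T2 -> \bar R}).

(* A copy of the product measure: the structure inferred on [m1 \x m2] itself
   requires subprobability measures. *)
Definition prod_measure : set (T1 * T2)%type -> \bar R := (m1 \x m2)%E.

HB.instance Definition _ := Measure.copy prod_measure (m1 \x m2)%E.

Let prod_measure_sigma_finite : sigma_finite setT prod_measure.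
Proof.
have /sigma_finiteP[F [FT Fnd Foo]] := sigma_finiteT m1.
have /sigma_finiteP[G [GT Gnd Goo]] := sigma_finiteT m2.
exists (fun i => F i `*` G i).
  rewrite -setXTT FT GT predeqE => -[x y]; split.
    move=> [/= [i _ Fix] [k _ Gky]]; exists (maxn i k) => //; split.
    - by move: x Fix; exact/subsetPset/Fnd/leq_maxl.
    - by move: y Gky; exact/subsetPset/Gnd/leq_maxr.
  by move=> [i _ []/= ? ?]; split; exists i.
move=> i; have [mF Foo'] := Foo i; have [mG Goo'] := Goo i.
split; first exact: measurableX.
by rewrite /prod_measure product_measure1E// lte_mul_pinfty// ge0_fin_numE.
Qed.

HB.instance Definition _ := @Measure_isSigmaFinite.Build _ _ _ prod_measure
  prod_measure_sigma_finite.

End product_sigma_finite.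

Section gram.
Context {R : realType} dX dY (X : measurableType dX) (Y : measurableType dY)
  (mu : {sigma_finite_measure set X -> \bar R})
  (nu : {sigma_finite_measure set Y -> \bar R}).
Variables (om : X -> R) (th : X -> Y -> R) (a b : Y -> R) (k : Y -> Y -> R).
Hypotheses (mom : measurable_fun setT om) (om0 : forall x, 0 <= om x)
  (iom : (\int[mu]_x (om x)%:E < +oo)%E)
  (mth : measurable_fun setT (fun z : X * Y => th z.1 z.2))
  (ma : measurable_fun setT a) (mb : measurable_fun setT b)
  (ia : (\int[nu]_y (`|a y|)%:E < +oo)%E) (ib : (\int[nu]_y (`|b y|)%:E < +oo)%E)
  (mk : measurable_fun setT (fun z : Y * Y => k z.1 z.2))
  (k0 : forall y z, 0 <= k y z)
  (kE : forall y z c, (\int[mu]_x (om x * cos (th x y - th x z + c))%:E =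
     (cos c * k y z)%:E)%E).

(* The real and imaginary parts of the integral of e^(i th) (a + i b). *)
Definition osc_re (x : X) : R := \int[nu]_y (a y * cos (th x y) - b y * sin (th x y)).
Definition osc_im (x : X) : R := \int[nu]_y (a y * sin (th x y) + b y * cos (th x y)).

Let rho y := `|a y| + `|b y|.
Let F1 x y := a y * cos (th x y) - b y * sin (th x y).
Let F2 x y := a y * sin (th x y) + b y * cos (th x y).

Let rho0 y : 0 <= rho y. Proof. exact: addr_ge0. Qed.

Let mrho : measurable_fun setT rho. Proof. by rewrite /rho; mfun. Qed.

Let irho : nu.-integrable setT (EFin \o rho).
Proof.
apply/integrableP; split; first by apply/measurable_EFinP.
under eq_integral do rewrite /= ger0_norm// EFinD.
rewrite ge0_integralD//; last 2 first.
- by apply/measurable_EFinP; mfun.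
- by apply/measurable_EFinP; mfun.
exact: lte_add_pinfty.
Qed.

Let mthx x : measurable_fun setT (th x).
Proof. exact: (measurableT_comp mth (@pair1_measurable _ _ _ _ x)). Qed.

Let mthz d (T : measurableType d) (f : T -> X) (g : T -> Y) :
  measurable_fun setT f -> measurable_fun setT g ->
  measurable_fun setT (fun z => th (f z) (g z)).
Proof. by move=> mf mg; apply: (measurableT_comp mth (measurable_fun_pair mf mg)). Qed.

Let mF1 x : measurable_fun setT (F1 x).
Proof. by have := mthx x => ?; rewrite /F1; mfun. Qed.
Let mF2 x : measurable_fun setT (F2 x).
Proof. by have := mthx x => ?; rewrite /F2; mfun. Qed.

Let F1le x y : `|F1 x y| <= rho y.
Proof.
rewrite (le_trans (ler_normB _ _))// lerD// normrM ler_piMr//.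
  exact: cos_max.
exact: sin_max.
Qed.

Let F2le x y : `|F2 x y| <= rho y.
Proof.
rewrite (le_trans (ler_normD _ _))// lerD// normrM ler_piMr//.
  exact: sin_max.
exact: cos_max.
Qed.

Let iF (F : Y -> R) : measurable_fun setT F -> (forall y, `|F y| <= rho y) ->
  nu.-integrable setT (EFin \o F).
Proof.
move=> mF Fle; apply: (le_integrable measurableT _ _ irho).
  exact/measurable_EFinP.
by move=> y _ /=; rewrite lee_fin (ger0_norm (rho0 y)).
Qed.

Let lin x (p q : R) : (\int[nu]_y (p * F1 x y + q * F2 x y)%:E =
  (p * osc_re x + q * osc_im x)%:E)%E.
Proof.
have i1 := iF (mF1 x) (F1le x); have i2 := iF (mF2 x) (F2le x).
have E1 : (\int[nu]_y (F1 x y)%:E = (osc_re x)%:E)%E.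
  by rewrite /osc_re /Rintegral fineK// (integrable_fin_num measurableT i1).
have E2 : (\int[nu]_y (F2 x y)%:E = (osc_im x)%:E)%E.
  by rewrite /osc_im /Rintegral fineK// (integrable_fin_num measurableT i2).
transitivity (\int[nu]_y (p%:E * (F1 x y)%:E + q%:E * (F2 x y)%:E))%E.
  by apply: eq_integral => y _; rewrite EFinD !EFinM.
rewrite integralD; [|by []|exact: integrableZl|exact: integrableZl].
by rewrite !integralZl// E1 E2.
Qed.

Let Z x (p : Y * Y) : R := om x * (F1 x p.1 * F1 x p.2 + F2 x p.1 * F2 x p.2).

Let ZE x p : Z x p = (a p.1 * a p.2 + b p.1 * b p.2) * (om x * cos (th x p.1 - th x p.2 + 0)) +
  (b p.2 * a p.1 - b p.1 * a p.2) * (om x * cos (th x p.1 - th x p.2 + (- (pi / 2)))).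
Proof. by rewrite /Z /F1 /F2 cosBpihalf addr0 cosB sinB; ring. Qed.

Let Zle x p : `|Z x p| <= om x * (2 * (rho p.1 * rho p.2)).
Proof.
rewrite /Z normrM ger0_norm// ler_wpM2l// (le_trans (ler_normD _ _))//.
by rewrite mulr_natl mulr2n !normrM lerD// ler_pM.
Qed.

Let mZ : measurable_fun setT (fun q : X * (Y * Y) => Z q.1 q.2).
Proof.
rewrite /Z /F1 /F2.
have m1 : measurable_fun setT (fun q : X * (Y * Y) => th q.1 q.2.1) by apply: mthz; mfun.
have m2 : measurable_fun setT (fun q : X * (Y * Y) => th q.1 q.2.2) by apply: mthz; mfun.
by mfun.
Qed.

Let rho2 : (\int[prod_measure nu nu]_p (rho p.1 * rho p.2)%:E < +oo)%E.
Proof.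
rewrite (fubini_tonelli1 (fun p : Y * Y => (rho p.1 * rho p.2)%:E)); last 2 first.
- by mfun.
- by move=> p; rewrite lee_fin mulr_ge0.
have [r rE] : exists r, (\int[nu]_y (rho y)%:E = r%:E)%E.
  by exists (fine (\int[nu]_y (rho y)%:E)%E); rewrite fineK// (integrable_fin_num measurableT irho).
rewrite /fubini_F; under eq_integral => y _.
  under eq_integral do rewrite /= EFinM.
  rewrite ge0_integralZl//; [|by mfun|by move=> *; rewrite lee_fin|by rewrite lee_fin].
  rewrite rE; over.
rewrite ge0_integralZr; [by rewrite rE -EFinM ltry|by []|by mfun|by move=> *; rewrite lee_fin|].
by rewrite -rE; apply: integral_ge0 => *; rewrite lee_fin.
Qed.

Let iZx x : (prod_measure nu nu).-integrable setT (fun p => (Z x p)%:E).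
Proof.
apply/integrableP; split.
  apply/measurable_EFinP.
  exact: (measurableT_comp mZ (@pair1_measurable _ _ _ _ x)).
apply: (@le_lt_trans _ _ (\int[prod_measure nu nu]_p ((om x * 2)%:E * (rho p.1 * rho p.2)%:E))%E).
  apply: ge0_le_integral; [by []|by []| | |].
  - apply: measurableT_comp => //; apply/measurable_EFinP.
    exact: (measurableT_comp mZ (@pair1_measurable _ _ _ _ x)).
  - by mfun.
  - by move=> p _; rewrite -EFinM lee_fin -mulrA; exact: Zle.
rewrite ge0_integralZl; [|by []|by mfun|by move=> p _; rewrite lee_fin mulr_ge0|by rewrite lee_fin mulr_ge0].
by rewrite lte_mul_pinfty// lee_fin mulr_ge0.
Qed.

Let iZ : (mu \x prod_measure nu nu)%E.-integrable setT (fun q => (Z q.1 q.2)%:E).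
Proof.
apply: (proj2 (@integrable12ltyP _ _ _ _ R mu (prod_measure nu nu) (fun q => (Z q.1 q.2)%:E) _)).
  exact/measurable_EFinP.
apply: (@le_lt_trans _ _ (\int[mu]_x ((om x)%:E * (2%:E * \int[prod_measure nu nu]_p (rho p.1 * rho p.2)%:E)))%E).
  apply: ge0_le_integral; [by []| | | |].
  - by move=> x _; apply: integral_ge0.
  - apply: (@measurable_integral2 _ _ _ _ R (prod_measure nu nu) (fun x p => `|(Z x p)%:E|%E)) => //.
    by apply: measurableT_comp => //; apply/measurable_EFinP.
  - by mfun.
  move=> x _; rewrite muleA -EFinM -ge0_integralZl; last 4 first.
  - by [].
  - by mfun.
  - by move=> p _; rewrite lee_fin mulr_ge0.
  - by rewrite lee_fin mulr_ge0.
  apply: ge0_le_integral; [by []|by []| | |].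
  - apply: measurableT_comp => //; apply/measurable_EFinP.
    exact: (measurableT_comp mZ (@pair1_measurable _ _ _ _ x)).
  - by mfun.
  - by move=> p _; rewrite -EFinM lee_fin -mulrA; exact: Zle.
have rho20 : (0 <= \int[prod_measure nu nu]_p (rho p.1 * rho p.2)%:E)%E.
  by apply: integral_ge0 => p _; rewrite lee_fin mulr_ge0.
rewrite ge0_integralZr; [|by []|by mfun|by move=> *; rewrite lee_fin|by rewrite mule_ge0].
rewrite lte_mul_pinfty//; first by apply: integral_ge0 => *; rewrite lee_fin.
  rewrite ge0_fin_numE//; by apply: integral_ge0 => *; rewrite lee_fin.
by rewrite lte_mul_pinfty.
Qed.

Lemma gramE : (\int[mu]_x (om x * (osc_re x ^+ 2 + osc_im x ^+ 2))%:E =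
  \int[prod_measure nu nu]_p ((a p.1 * a p.2 + b p.1 * b p.2) * k p.1 p.2)%:E)%E.
Proof.
transitivity (\int[mu]_x \int[prod_measure nu nu]_p (Z x p)%:E)%E.
  apply: eq_integral => x _.
  rewrite -(integral12_prod_meas1 (iZx x)) /fubini_F.
  transitivity (\int[nu]_y ((om x * osc_re x) * F1 x y + (om x * osc_im x) * F2 x y)%:E)%E.
    by rewrite lin; congr EFin; ring.
  apply: eq_integral => y _.
  transitivity (\int[nu]_z ((om x * F1 x y) * F1 x z + (om x * F2 x y) * F2 x z)%:E)%E.
    by rewrite lin; congr EFin; ring.
  by apply: eq_integral => z _; rewrite /Z /=; congr EFin; ring.
rewrite (integral12_prod_meas1 iZ) -(integral21_prod_meas1 iZ).
apply: eq_integral => -[y z] _; rewrite /fubini_G /=.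
have iomc c : mu.-integrable setT (fun x => (om x * cos (th x y - th x z + c))%:E).
  have my : measurable_fun setT (fun x => th x y).
    exact: (measurableT_comp mth (@pair2_measurable _ _ _ _ y)).
  have mz : measurable_fun setT (fun x => th x z).
    exact: (measurableT_comp mth (@pair2_measurable _ _ _ _ z)).
  have iomE : mu.-integrable setT (fun x => (om x)%:E).
    apply/integrableP; split; first exact/measurable_EFinP.
    by under eq_integral do rewrite /= ger0_norm//.
  apply: (le_integrable measurableT _ _ iomE); first by mfun.
  by move=> x _ /=; rewrite lee_fin normrM ler_piMr// cos_max.
transitivity (\int[mu]_x ((a y * a z + b y * b z)%:E * (om x * cos (th x y - th x z + 0))%:E +
   (b z * a y - b y * a z)%:E * (om x * cos (th x y - th x z + (- (pi / 2))))%:E))%E.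
  by apply: eq_integral => x _; rewrite -!EFinM -EFinD ZE.
rewrite integralD; [|by []|exact: integrableZl|exact: integrableZl].
rewrite !integralZl// !kE cos0 cosN cos_pihalf mul0r mule0 adde0 mul1r.
by rewrite -EFinM.
Qed.

Let normg y : Num.sqrt (a y ^+ 2 + b y ^+ 2) ^+ 2 = a y ^+ 2 + b y ^+ 2.
Proof. by rewrite sqr_sqrtr// addr_ge0// sqr_ge0. Qed.

Lemma gram_le : (\int[mu]_x (om x * (osc_re x ^+ 2 + osc_im x ^+ 2))%:E <=
  \int[nu]_y \int[nu]_z (Num.sqrt (a y ^+ 2 + b y ^+ 2) *
     Num.sqrt (a z ^+ 2 + b z ^+ 2) * k y z)%:E)%E.
Proof.
rewrite gramE -(fubini_tonelli1 (fun p : Y * Y => (Num.sqrt (a p.1 ^+ 2 + b p.1 ^+ 2) *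
     Num.sqrt (a p.2 ^+ 2 + b p.2 ^+ 2) * k p.1 p.2)%:E)); last 2 first.
- by mfun.
- by move=> p; rewrite lee_fin !mulr_ge0 ?sqrtr_ge0.
apply: (le_trans (lee_abs _)); apply: (le_trans (le_abse_integral _ _ _)) => //.
  by mfun.
apply: ge0_le_integral; [by []|by []| |by mfun|].
  by apply: measurableT_comp => //; mfun.
move=> [y z] _ /=; rewrite lee_fin normrM (ger0_norm (k0 y z)) ler_wpM2r//.
rewrite -ler_sqr ?nnegrE ?mulr_ge0 ?sqrtr_ge0// real_normK ?num_real// exprMn !normg.
rewrite -subr_ge0.
rewrite (_ : _ - _ = (a y * b z - b y * a z) ^+ 2) ?sqr_ge0//; ring.
Qed.

Lemma gram_ge0 : (forall y, 0 <= a y) -> (forall y, b y = 0) ->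
  (\int[mu]_x (om x * (osc_re x ^+ 2 + osc_im x ^+ 2))%:E =
   \int[nu]_y \int[nu]_z (a y * a z * k y z)%:E)%E.
Proof.
move=> a0 b0; rewrite gramE.
rewrite -(fubini_tonelli1 (fun p : Y * Y => (a p.1 * a p.2 * k p.1 p.2)%:E)); last 2 first.
- by mfun.
- by move=> p; rewrite lee_fin !mulr_ge0.
by apply: eq_integral => p _; rewrite !b0 mul0r addr0.
Qed.

End gram.

(** * Poisson kernels *)

Section poisson.
Context {R : realType}.
Local Notation mR := (measurableTypeR R).

Lemma continuous_of_is_derive (f df : R -> R) :
  (forall x : R, is_derive x 1 f (df x)) -> continuous f.
Proof.
move=> fd x; apply/differentiable_continuous/derivable1_diffP.
exact: ex_derive.
Qed.

Section half_line.
Variables (de x q : R).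
Hypotheses (de0 : 0 < de) (q1 : `|q| <= 1).
Let D := de ^+ 2 + x ^+ 2.
Let D0 : 0 < D. Proof. by rewrite ltr_pwDl ?exprn_gt0// sqr_ge0. Qed.
Let f (s : R) := expR (- de * s) * (1 + q * cos (x * s)).
Let F (s : R) := expR (- de * s) *
  (- de^-1 + q / D * (x * sin (x * s) - de * cos (x * s))).

Let dlin (c s : R) : is_derive s 1 (fun s : R => c * s) c.
Proof. by apply: is_derive_eq; rewrite [X in _ = X](_ : _ = c *: (1:R)) ?scaler0 ?add0r//; rewrite /GRing.scale/= ?mulr1. Qed.

Let dF (s : R) : is_derive s 1 F (f s).
Proof.
have de1 : is_derive s 1 (fun s => expR (- de * s)) (- de * expR (- de * s)).
  have := @is_derive1_comp _ expR (fun s => - de * s) s _ _ (is_derive_expR _) (dlin (- de) s).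
  by rewrite mulrC.
have ds1 : is_derive s 1 (fun s => sin (x * s)) (x * cos (x * s)).
  have := @is_derive1_comp _ sin (fun s => x * s) s _ _ (is_derive_sin _) (dlin x s).
  by rewrite mulrC.
have dc1 : is_derive s 1 (fun s => cos (x * s)) (- x * sin (x * s)).
  have := @is_derive1_comp _ cos (fun s => x * s) s _ _ (is_derive_cos _) (dlin x s).
  by rewrite mulrC mulrN mulNr.
have dB : is_derive s 1 (fun s => - de^-1 + q / D * (x * sin (x * s) - de * cos (x * s)))
    (0 + q / D * (x * (x * cos (x * s)) - de * (- x * sin (x * s)))).
  have := is_deriveD (is_derive_cst (- de^-1) s 1)
    (is_deriveZ (q / D) (is_deriveB (is_deriveZ x ds1) (is_deriveZ de dc1))).
  exact.
apply: (@is_derive_eq R _ _ F s 1 (f s) _ (is_deriveM de1 dB)).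
rewrite /GRing.scale/= /f /D; field.
by rewrite -/D !gt_eqF.
Qed.

Let f0 s : 0 <= f s.
Proof.
rewrite mulr_ge0 ?expR_ge0// -lerBlDl sub0r.
have : `|q * cos (x * s)| <= 1 by rewrite normrM mulr_ile1// cos_max.
by rewrite ler_norml => /andP[].
Qed.

Let cf : continuous f.
Proof.
have c1 (c : R) : continuous (fun s : R => c * s).
  by move=> s; apply: (continuous_of_is_derive (df := fun=> c)) => ?; exact: dlin.
move=> s; apply: (@continuousM _ _ (fun s => expR (- de * s))).
  by apply: continuous_comp; [exact: c1|exact: continuous_expR].
apply: continuousD; first exact: cvg_cst.
apply: continuousM; first exact: cvg_cst.
by apply: continuous_comp; [exact: c1|exact: continuous_cos].
Qed.

Let Fy : F s @[s --> +oo] --> (0 : R).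
Proof.
pose C := de^-1 + `|q / D| * (`|x| + de).
have Fle s : `|F s| <= C * expR (- de * s).
  rewrite /F normrM (ger0_norm (expR_ge0 _)) mulrC ler_wpM2r ?expR_ge0//.
  rewrite (le_trans (ler_normD _ _))// normrN (ger0_norm (_ : 0 <= de^-1)) ?invr_ge0 ?(ltW de0)//.
  rewrite lerD2l normrM ler_wpM2l// (le_trans (ler_normB _ _))// !normrM (gtr0_norm de0).
  by rewrite lerD// ler_piMr ?sin_max ?cos_max// ltW.
have e0 : expR (- de * s) @[s --> +oo] --> (0 : R).
  under eq_cvg do rewrite mulNr.
  apply: (@cvg_comp _ _ _ (fun s => de * s) (fun y => expR (- y)) _ (+oo)); last exact: cvgr_expR.
  by apply: gt0_cvgMry => //; exact: cvg_id.
have Ce0 : C * expR (- de * s) @[s --> +oo] --> (0 : R).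
  by rewrite -[X in _ --> X](mulr0 C); apply: cvgMl_tmp.
apply: (@squeeze_cvgr _ _ _ _ (fun s => - (C * expR (- de * s))) (fun s => C * expR (- de * s))).
- by near=> s; rewrite -ler_norml.
- by rewrite -oppr0; apply: cvgN.
- exact: Ce0.
Unshelve. all: by end_near. Qed.

Lemma half_line_integral :
  (\int[leb R]_(s in `[0%R, +oo[) (expR (- de * s) * (1 + q * cos (x * s)))%:E =
   (de^-1 + q * de / (de ^+ 2 + x ^+ 2))%:E)%E.
Proof.
rewrite (ge0_continuous_FTC2y (F := F) (f := f) (l := 0)).
- rewrite -EFinD; congr EFin.
  rewrite /F !mulr0 expR0 sin0 cos0 -/D; field.
  by rewrite !gt_eqF.
- by move=> s _; exact: f0.
- exact: continuous_subspaceT.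
- exact: Fy.
- by move=> s _; have := dF s => ?; exact: ex_derive.
- by apply: cvg_at_right_filter; apply: (continuous_of_is_derive dF).
- by move=> s _; rewrite derive1E; have := dF s => ?; rewrite derive_val.
Qed.

End half_line.
End poisson.

Section poisson_kernel.
Context {R : realType}.
Local Notation mR := (measurableTypeR R).

Definition pk (de x : R) : R := 2 * de / (de ^+ 2 + x ^+ 2).

Variable de : R.
Hypothesis de0 : 0 < de.

Lemma pk_ge0 x : 0 <= pk de x.
Proof. by rewrite /pk divr_ge0 ?mulr_ge0 ?addr_ge0 ?sqr_ge0// ltW. Qed.

Lemma measurable_pk : measurable_fun setT (pk de).
Proof. by rewrite /pk; mfun. Qed.

Lemma pk0 : pk de 0 = 2 / de.
Proof. by rewrite /pk expr0n addr0; field; rewrite gt_eqF. Qed.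

Lemma pk_le0 x : pk de x <= pk de 0.
Proof.
rewrite /pk ler_wpM2l ?mulr_ge0 ?(ltW de0)// lef_pV2 ?posrE ?expr0n ?addr0.
- by rewrite lerDl sqr_ge0.
- by rewrite ltr_pwDl ?exprn_gt0// sqr_ge0.
- by rewrite exprn_gt0.
Qed.

Lemma cos1_ge0 x : 0 <= 1 + cos x :> R.
Proof. by rewrite -lerBlDl sub0r cos_geN1. Qed.

Lemma pk_integral : (\int[leb R]_x (pk de x)%:E = (2 * pi)%:E)%E.
Proof.
rewrite (ge0_integral_scale de0); last 2 first.
- by apply/measurable_EFinP; exact: measurable_pk.
- by move=> x; rewrite lee_fin pk_ge0.
have m1 : measurable_fun setT (fun x : mR => (2 * (oneDsqr x)^-1)%:E).
  by rewrite /oneDsqr; mfun.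
transitivity (\int[leb R]_x (2 * (oneDsqr x)^-1)%:E)%E.
  rewrite -ge0_integralZl; [|by []| | |by rewrite lee_fin ltW].
  - apply: eq_integral => x _; rewrite -EFinM; congr EFin.
    have : oneDsqr x != 0 by rewrite gt_eqF// (lt_le_trans _ (oneDsqr_ge1 x)).
    have DE : de ^+ 2 + (de * x) ^+ 2 = de ^+ 2 * oneDsqr x by rewrite /oneDsqr; ring.
    by move=> ?; rewrite /pk DE; field; apply/andP; split => //; rewrite gt_eqF.
  - by rewrite /pk; mfun.
  - by move=> x _; rewrite lee_fin pk_ge0.
rewrite (@ge0_symfun_integralT R (fun x => 2 * (oneDsqr x)^-1)).
- transitivity (2%:E * (2%:E * \int[leb R]_(x in `[0%R, +oo[) ((oneDsqr x)^-1)%:E))%E.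
    have mo : measurable_fun (`[(0 : R), +oo[%classic : set mR) (fun x : mR => ((oneDsqr x)^-1)%:E).
      by apply: (@measurable_funTS _ _ _ _ _ (fun x : mR => ((oneDsqr x)^-1)%:E)); rewrite /oneDsqr; mfun.
    congr (_ * _)%E; rewrite -ge0_integralZl; [|by []|exact: mo| |by rewrite lee_fin].
      by rewrite -set_itvcy; apply: eq_integral => x _; rewrite EFinM.
    by move=> x _; rewrite lee_fin invr_ge0 (le_trans _ (oneDsqr_ge1 x)).
  by rewrite integral0y_oneDsqr -!EFinM; congr EFin; field.
- by move=> x; rewrite mulr_ge0// invr_ge0 (le_trans _ (oneDsqr_ge1 x)).
- by move=> x; apply: cvgMl_tmp; exact: continuous_oneDsqrV.
- by move=> x /=; rewrite /oneDsqr sqrrN.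
Qed.

(* Adding 1 to the cosine keeps every integrand non-negative, so that Tonelli's theorem suffices. *)
Lemma poisson1 x c :
  (\int[leb R]_s (expR (- (de * `|s|)) * (1 + cos (x * s + c)))%:E =
   (pk de 0 + cos c * pk de x)%:E)%E.
Proof.
pose f (s : R) := expR (- (de * `|s|)) * (1 + cos (x * s + c)).
have f0 s : 0 <= f s by rewrite mulr_ge0 ?expR_ge0 ?cos1_ge0.
have mf : measurable_fun setT (fun s : mR => (f s)%:E) by rewrite /f; mfun.
have mfN : measurable_fun setT (fun s : mR => (f (- s))%:E) by rewrite /f; mfun.
have E2 : (\int[leb R]_s (f s)%:E = \int[leb R]_s (2^-1 * (f s + f (- s)%R))%:E)%E.
  rewrite -[LHS]mule_half; last by apply: integral_ge0 => s _; rewrite lee_fin.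
  rewrite -[X in (_ * (_ + X))%E](ge0_integral_opp mf); last by move=> s; rewrite lee_fin.
  rewrite -ge0_integralD; [|by []| |by []| |by []]; last 2 first.
  - by move=> s _; rewrite lee_fin.
  - by move=> s _; rewrite lee_fin.
  rewrite -ge0_integralZl; [|by []|exact: emeasurable_funD| |by rewrite lee_fin]; last first.
    by move=> s _; rewrite adde_ge0// lee_fin.
  by apply: eq_integral => s _; rewrite -EFinD -EFinM.
rewrite E2.
pose g (s : R) := expR (- (de * `|s|)) * (1 + cos c * cos (x * s)).
transitivity (\int[leb R]_s (g s)%:E)%E.
  apply: eq_integral => s _; congr EFin; rewrite /f /g normrN mulrN !cosD cosN sinN.
  by field.
have cle : `|cos c| <= 1 by exact: cos_max.
have g0 s : 0 <= g s.
  apply: mulr_ge0; first exact: expR_ge0.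
  rewrite -lerBlDl sub0r.
  have : `|cos c * cos (x * s)| <= 1 by rewrite normrM mulr_ile1// cos_max.
  by rewrite ler_norml => /andP[].
have cg : continuous g.
  have c1 (k : R) : continuous (fun s : R => k * s).
    by move=> s; apply: cvgMl_tmp; exact: cvg_id.
  move=> s; apply: (@continuousM _ _ (fun s => expR (- (de * `|s|)))).
    apply: continuous_comp; last exact: continuous_expR.
    apply: continuousN; apply: continuousM; first exact: cvg_cst.
    exact: norm_continuous.
  apply: continuousD; first exact: cvg_cst.
  apply: continuousM; first exact: cvg_cst.
  by apply: continuous_comp; [exact: c1|exact: continuous_cos].
rewrite (ge0_symfun_integralT g0 cg); last first.
  by move=> s /=; rewrite /g normrN mulrN cosN.
have := half_line_integral x de0 cle; rewrite -set_itvcy => E.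
transitivity (2%:E * \int[leb R]_(s in `[0%R, +oo[) (expR (- de * s) * (1 + cos c * cos (x * s)))%:E)%E.
  apply: (congr1 (fun z => 2%:E * z)%E); apply: eq_integral => s; rewrite inE/= in_itv/= andbT => s0.
  by rewrite /g ger0_norm// mulNr.
rewrite E -EFinM; congr EFin; rewrite pk0 /pk; field.
by rewrite gt_eqF// ?gt_eqF// ltr_pwDl ?exprn_gt0// sqr_ge0.
Qed.

Definition l1norm n (x : Rn R n) : R := \sum_(i < n) `|(tnth x i : R)|.

Definition pkn n (x : Rn R n) : R := \prod_(i < n) pk de (tnth x i).

Lemma measurable_l1norm n : measurable_fun setT (@l1norm n).
Proof.
apply: measurable_sum => i; apply: (measurableT_comp (@normr_measurable R setT)).
exact: measurable_tnth.
Qed.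

Lemma measurable_pkn n : measurable_fun setT (@pkn n).
Proof.
apply: measurable_prod => i _; exact: (measurableT_comp measurable_pk (measurable_tnth i)).
Qed.

Lemma pkn_ge0 n (x : Rn R n) : 0 <= pkn x.
Proof. by apply: prodr_ge0 => i _; exact: pk_ge0. Qed.

Lemma pkn_integral n : (\int[@lebesgue_tuple R n]_x (pkn x)%:E = ((2 * pi) ^+ n)%:E)%E.
Proof.
exact: (ge0_integral_prod n measurable_pk pk_ge0 pk_integral).
Qed.

Lemma l1norm_tcons n (a : mR) (t : Rn R n) : l1norm (tcons (a, t)) = `|a : R| + l1norm t.
Proof.
rewrite /l1norm big_ord_recl tnth0; congr (_ + _).
by apply: eq_bigr => i _; rewrite tnthS.
Qed.

Lemma pkn_tcons n (a : mR) (t : Rn R n) : pkn (tcons (a, t)) = pk de a * pkn t.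
Proof.
rewrite /pkn big_ord_recl tnth0; congr (_ * _).
by apply: eq_bigr => i _; rewrite tnthS.
Qed.

Lemma pkn_le0 n (x : Rn R n) : pkn x <= pk de 0 ^+ n.
Proof.
rewrite -[n in X in _ <= X](card_ord n) -prodr_const.
by apply: ler_prod => i _; rewrite pk_ge0 pk_le0.
Qed.

Lemma poissonn n (x : Rn R n) c :
  (\int[@lebesgue_tuple R n]_t (expR (- (de * l1norm t)) * (1 + cos (dot x t + c)))%:E =
   (pk de 0 ^+ n + cos c * pkn x)%:E)%E.
Proof.
elim: n x c => [|n IH] x c.
  have ml := @measurable_l1norm 0.
  rewrite ge0_integral_tuple0; last by mfun.
  by rewrite dot0l /l1norm /pkn !big_ord0 mulr0 oppr0 expR0 expr0 add0r mul1r mulr1.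
have ml := @measurable_l1norm n.+1; have ml' := @measurable_l1norm n.
rewrite -(tcons_tuncons x); case: (tuncons x) => {}x y.
rewrite ge0_integral_tcons; last 2 first.
- by mfun.
- by move=> t; rewrite lee_fin mulr_ge0 ?expR_ge0 ?cos1_ge0.
set P0 := pk de 0 ^+ n; set P := pkn y.
have P0P : 0 <= P0 - P by rewrite subr_ge0 pkn_le0.
transitivity (\int[leb R]_a ((P0 - P)%:E * (2^-1 * (expR (- (de * `|a|)) * (1 + cos (0 * a + 0))))%:E +
   P%:E * (expR (- (de * `|a|)) * (1 + cos (x * a + c)))%:E))%E.
  apply: eq_integral => a _.
  transitivity (\int[@lebesgue_tuple R n]_t ((expR (- (de * `|a|)))%:E * (expR (- (de * l1norm t)) * (1 + cos (dot y t + (x * a + c))))%:E))%E.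
    apply: eq_integral => t _; rewrite -EFinM l1norm_tcons dot_tcons; congr EFin.
    have -> : expR (- (de * (`|a : R| + l1norm t))) = expR (- (de * `|a : R|)) * expR (- (de * l1norm t)).
      by rewrite -expRD; congr expR; ring.
    by rewrite -mulrA; congr (_ * (_ * (1 + cos _))); ring.
  rewrite ge0_integralZl; [|by []|by mfun| |by rewrite lee_fin expR_ge0]; last first.
    by move=> t _; rewrite lee_fin mulr_ge0 ?expR_ge0 ?cos1_ge0.
  rewrite IH -!EFinM -EFinD; congr EFin.
  by rewrite mul0r addr0 cos0 -/P0 -/P; field.
rewrite ge0_integralD; [|by []| |by mfun| |by mfun]; last 2 first.
- by move=> a _; rewrite -EFinM lee_fin !mulr_ge0 ?expR_ge0 ?cos1_ge0.
- by move=> a _; rewrite -EFinM lee_fin !mulr_ge0 ?expR_ge0 ?cos1_ge0 ?pkn_ge0.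
rewrite ge0_integralZl; [|by []|by mfun| |by rewrite lee_fin]; last first.
  by move=> a _; rewrite lee_fin !mulr_ge0 ?expR_ge0 ?cos1_ge0.
rewrite ge0_integralZl; [|by []|by mfun| |by rewrite lee_fin pkn_ge0]; last first.
  by move=> a _; rewrite lee_fin mulr_ge0 ?expR_ge0 ?cos1_ge0.
under eq_integral do rewrite EFinM.
rewrite ge0_integralZl; [|by []|by mfun| |by rewrite lee_fin]; last first.
  by move=> a _; rewrite lee_fin mulr_ge0 ?expR_ge0 ?cos1_ge0.
rewrite !poisson1 -!EFinM -EFinD; congr EFin.
by rewrite cos0 pkn_tcons exprS -/P0 -/P; field.
Qed.

Lemma integral_expl1 n :
  (\int[@lebesgue_tuple R n]_t (expR (- (de * l1norm t)))%:E = (pk de 0 ^+ n)%:E)%E.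
Proof.
have ml := @measurable_l1norm n.
have := poissonn [tuple 0 | i < n] 0.
have E (t : Rn R n) : dot [tuple 0 | i < n] t = 0.
  by rewrite /dot big1// => i _; rewrite tnth_mktuple mul0r.
under eq_integral do rewrite E addr0 cos0 mulrC EFinM.
rewrite ge0_integralZl; [|by []|by mfun|by move=> t _; rewrite lee_fin expR_ge0|by rewrite lee_fin addr_ge0].
have -> : pkn [tuple 0 | i < n] = pk de 0 ^+ n.
  rewrite -[n in RHS](card_ord n) -prodr_const.
  by apply: eq_bigr => i _; rewrite tnth_mktuple.
rewrite cos0 mul1r => /(congr1 (fun z => (2^-1)%:E * z)%E).
rewrite muleA -!EFinM (_ : 2^-1 * (1 + 1) = 1); last by field.
by rewrite mul1e => ->; congr EFin; field.
Qed.

Lemma poisson_cos n (x : Rn R n) c :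
  (\int[@lebesgue_tuple R n]_t (expR (- (de * l1norm t)) * cos (dot x t + c))%:E =
   (cos c * pkn x)%:E)%E.
Proof.
have ml := @measurable_l1norm n.
have ie : (@lebesgue_tuple R n).-integrable setT (fun t => (expR (- (de * l1norm t)))%:E).
  apply/integrableP; split; first by mfun.
  by under eq_integral do rewrite /= ger0_norm ?expR_ge0//; rewrite integral_expl1 ltry.
have i1 : (@lebesgue_tuple R n).-integrable setT (fun t => (expR (- (de * l1norm t)) * (1 + cos (dot x t + c)))%:E).
  apply/integrableP; split; first by mfun.
  under eq_integral do rewrite /= ger0_norm ?mulr_ge0 ?expR_ge0 ?cos1_ge0//.
  by rewrite poissonn ltry.
transitivity (\int[@lebesgue_tuple R n]_t ((expR (- (de * l1norm t)) * (1 + cos (dot x t + c)))%:E - (expR (- (de * l1norm t)))%:E))%E.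
  by apply: eq_integral => t _; rewrite -EFinB; congr EFin; ring.
rewrite integralB//; last first.
rewrite poissonn integral_expl1 -EFinB; congr EFin; ring.
Qed.

End poisson_kernel.

(** * Plancherel's inequality *)

Section fatou_le.
Context {R : realType} d (T : measurableType d) (mu : {measure set T -> \bar R}).

Lemma limn_einf_le (u v : (\bar R)^nat) (l : \bar R) :
  (forall j, u j <= v j)%E -> v @ \oo --> l -> (limn_einf u <= l)%E.
Proof.
move=> uv vl; have [<- _] := cvg_limn_einf_sup vl.
rewrite !limn_einf_lim; apply: lee_lim; [exact: is_cvg_einfs|exact: is_cvg_einfs|].
apply: nearW => j; apply: le_ereal_inf_tmp => _ [i ji <-].
by apply: le_trans (uv i); apply: ereal_inf_lbound; exists i.
Qed.

Lemma fatou_le (f_ : (T -> \bar R)^nat) (f : T -> \bar R) (B_ : (\bar R)^nat) (B : \bar R) :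
  (forall j, measurable_fun setT (f_ j)) -> (forall j x, 0 <= f_ j x)%E ->
  measurable_fun setT f -> (forall x, 0 <= f x)%E ->
  {ae mu, forall x, f_ ^~ x @ \oo --> f x} ->
  (forall j, \int[mu]_x f_ j x <= B_ j)%E -> B_ @ \oo --> B ->
  (\int[mu]_x f x <= B)%E.
Proof.
move=> mf_ f_0 mf f0 cvf le1 cvB.
apply: (le_trans _ (limn_einf_le le1 cvB)).
apply: (@le_trans _ _ (\int[mu]_x limn_einf (f_ ^~ x))%E); last first.
  by apply: fatou => // j x _; exact: f_0.
apply: ae_ge0_le_integral => //.
- by move=> x _; rewrite limn_einf_lim; apply: lime_ge; [exact: is_cvg_einfs|
    apply: nearW => j; apply: le_ereal_inf_tmp => _ [i _ <-]].
- have -> : (fun x => limn_einf (f_ ^~ x)) = (fun x => - limn_esup (fun j => - f_ j x))%E.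
    by apply/funext => x; rewrite (limn_esupN (f_ ^~ x)) oppeK.
  apply: measurableT_comp => //; apply: measurable_fun_limn_esup => j.
  exact: measurableT_comp.
- by apply: filterS cvf => x /cvg_limn_einf_sup[-> _] _.
Qed.

Lemma fatou_le_cst (f_ : (T -> \bar R)^nat) (f : T -> \bar R) (B : \bar R) :
  (forall j, measurable_fun setT (f_ j)) -> (forall j x, 0 <= f_ j x)%E ->
  measurable_fun setT f -> (forall x, 0 <= f x)%E ->
  (forall x, f_ ^~ x @ \oo --> f x) ->
  (forall j, \int[mu]_x f_ j x <= B)%E ->
  (\int[mu]_x f x <= B)%E.
Proof.
move=> mf_ f_0 mf f0 cvf le1; apply: (@fatou_le f_ f (fun=> B)) => //.
  exact: aeW.
exact: cvg_cst.
Qed.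

End fatou_le.

Lemma measurable_Rintegral2 (R : realType) d1 d2 (T1 : measurableType d1)
    (T2 : measurableType d2) (m2 : {sigma_finite_measure set T2 -> \bar R})
    (f : T1 -> T2 -> R) :
  measurable_fun setT (fun z : T1 * T2 => f z.1 z.2) ->
  measurable_fun setT (fun x => \int[m2]_y f x y).
Proof.
move=> mf; rewrite /Rintegral; apply: (measurableT_comp (fine_measurable measurableT)).
have mfE : measurable_fun setT (fun z : T1 * T2 => (f z.1 z.2)%:E) by apply/measurable_EFinP.
under eq_fun do rewrite integralE; apply: emeasurable_funB.
  apply: (@measurable_integral2 _ _ _ _ R m2 (fun x => ((EFin \o f x)^\+)%E)).
    rewrite (_ : (fun z => _) = ((fun z : T1 * T2 => (f z.1 z.2)%:E)^\+)%E); first exact: measurable_funepos.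
    by apply/funext => z; rewrite !funeposE.
  by move=> x y; rewrite funeposE le_max lexx orbT.
apply: (@measurable_integral2 _ _ _ _ R m2 (fun x => ((EFin \o f x)^\-)%E)).
  rewrite (_ : (fun z => _) = ((fun z : T1 * T2 => (f z.1 z.2)%:E)^\-)%E); first exact: measurable_funeneg.
  by apply/funext => z; rewrite !funenegE.
by move=> x y; rewrite funenegE le_max lexx orbT.
Qed.

Lemma measurable_osc_re (R : realType) dX dY (X : measurableType dX) (Y : measurableType dY)
    (nu : {sigma_finite_measure set Y -> \bar R}) (th : X -> Y -> R) (a b : Y -> R) :
  measurable_fun setT (fun z : X * Y => th z.1 z.2) ->
  measurable_fun setT a -> measurable_fun setT b ->
  measurable_fun setT (osc_re nu th a b).
Proof. by move=> mth ma mb; apply: measurable_Rintegral2; mfun. Qed.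

Lemma measurable_osc_im (R : realType) dX dY (X : measurableType dX) (Y : measurableType dY)
    (nu : {sigma_finite_measure set Y -> \bar R}) (th : X -> Y -> R) (a b : Y -> R) :
  measurable_fun setT (fun z : X * Y => th z.1 z.2) ->
  measurable_fun setT a -> measurable_fun setT b ->
  measurable_fun setT (osc_im nu th a b).
Proof. by move=> mth ma mb; apply: measurable_Rintegral2; mfun. Qed.

Section plancherel.
Context {R : realType} (n : nat).
Local Notation V := (Rn R n).
Local Notation leb := (@lebesgue_tuple R n).

Lemma dot_tadd (x y z : V) : dot (tadd x y) z = dot x z + dot y z.
Proof.
by rewrite /dot -big_split/=; apply: eq_bigr => i _; rewrite tnth_mktuple mulrDl.
Qed.

Lemma dot_tscalel c (x y : V) : dot (tscale c x) y = c * dot x y.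
Proof.
by rewrite /dot mulr_sumr; apply: eq_bigr => i _; rewrite tnth_mktuple mulrA.
Qed.

Definition tsub (x y : V) : V := tadd x (tscale (-1) y).

Lemma dot_tsubl (x y z : V) : dot (tsub x y) z = dot x z - dot y z.
Proof. by rewrite dot_tadd dot_tscalel mulN1r. Qed.

Lemma dot_tsub (x y : V) : dot (tsub x y) (tsub x y) = dot x x + dot y y - 2 * dot x y.
Proof.
rewrite dot_tsubl ![dot _ (tsub x y)]dotC !dot_tsubl (dotC y x); ring.
Qed.

Lemma measurable_fun_tsub d (T : measurableType d) (f g : T -> V) :
  measurable_fun setT f -> measurable_fun setT g ->
  measurable_fun setT (fun x => tsub (f x) (g x)).
Proof.
move=> mf mg; apply: measurable_fun_tadd => //.
by apply: measurable_fun_tscale => //; exact: measurable_cst.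
Qed.

Lemma ge0_integral_tsub (f : V -> \bar R) (y : V) : measurable_fun setT f ->
  (forall x, 0 <= f x)%E -> (\int[leb]_x f (tsub x y) = \int[leb]_x f x)%E.
Proof. exact: ge0_integral_tadd. Qed.

Lemma pkn_tsubC de (x y : V) : pkn de (tsub x y) = pkn de (tsub y x).
Proof.
apply: eq_bigr => i _; rewrite !tnth_mktuple /pk; congr (_ / (_ + _)).
by rewrite -sqrrN; congr (_ ^+ 2); ring.
Qed.

Variables (sg : R) (a b : V -> R).
Hypotheses (sg1 : sg = 1 \/ sg = - 1) (ma : measurable_fun setT a) (mb : measurable_fun setT b)
  (ia : (\int[leb]_y (`|a y|)%:E < +oo)%E) (ib : (\int[leb]_y (`|b y|)%:E < +oo)%E).

Let th (xi x : V) : R := sg * dot x xi.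

Let kE de (de0 : 0 < de) x y c :
  (\int[leb]_xi (expR (- (de * l1norm xi)) * cos (th xi x - th xi y + c))%:E =
   (cos c * pkn de (tsub x y))%:E)%E.
Proof.
have E xi : th xi x - th xi y = sg * dot (tsub x y) xi by rewrite /th dot_tsubl; ring.
under eq_integral do rewrite E.
case: sg1 => ->.
  by under eq_integral do rewrite mul1r; rewrite poisson_cos.
rewrite pkn_tsubC -poisson_cos//; apply: eq_integral => xi _.
by congr (_ * cos _)%:E; rewrite mulN1r !dot_tsubl; ring.
Qed.

Lemma plancherel_le :
  (\int[leb]_xi (osc_re leb th a b xi ^+ 2 + osc_im leb th a b xi ^+ 2)%:E <=
   ((2 * pi) ^+ n)%:E * \int[leb]_x (a x ^+ 2 + b x ^+ 2)%:E)%E.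
Proof.
have mth : measurable_fun setT (fun z : V * V => th z.1 z.2) by rewrite /th; mfun.
have ml := @measurable_l1norm R n.
have mre : measurable_fun setT (osc_re leb th a b).
  exact: measurable_osc_re.
have mim : measurable_fun setT (osc_im leb th a b).
  exact: measurable_osc_im.
pose de_ j : R := j.+1%:R^-1.
have de0 j : 0 < de_ j by rewrite invr_gt0.
apply: (@fatou_le_cst R _ _ leb (fun j xi => (expR (- (de_ j * l1norm xi)) * (osc_re leb th a b xi ^+ 2 + osc_im leb th a b xi ^+ 2))%:E)).
- by move=> j; mfun.
- by move=> j x; rewrite lee_fin mulr_ge0 ?expR_ge0 ?addr_ge0 ?sqr_ge0.
- by mfun.
- by move=> x; rewrite lee_fin addr_ge0 ?sqr_ge0.
- move=> xi; apply: cvg_EFin; first exact: nearW.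
  rewrite -[X in _ --> X]mul1r; apply: cvgMr_tmp.
  rewrite -expR0; apply: continuous_cvg; first exact: continuous_expR.
  rewrite -oppr0; apply: cvgN; rewrite -(mul0r (l1norm xi)); apply: cvgMr_tmp.
  exact: cvg_harmonic.
move=> j; pose k x y := pkn (de_ j) (tsub x y).
have mk : measurable_fun setT (fun z : V * V => k z.1 z.2).
  apply: (measurableT_comp (measurable_pkn (de_ j) (n := n))).
  by apply: measurable_fun_tsub; mfun.
have k0 x y : 0 <= k x y by exact: pkn_ge0.
apply: (le_trans (gram_le (k := k) _ _ _ mth ma mb ia ib mk k0 _)).
- by mfun.
- by move=> x; exact: expR_ge0.
- by rewrite integral_expl1// ltry.
- by move=> *; exact: kE.
have m1 : measurable_fun setT (fun y => Num.sqrt (a y ^+ 2 + b y ^+ 2)) by mfun.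
apply: (le_trans (schur_test leb (h := fun=> 1) m1 (measurable_cst _) mk _ _ k0 _)).
- by move=> x; exact: sqrtr_ge0.
- by [].
- by move=> x y; exact: pkn_tsubC.
rewrite -ge0_integralZl; [|by []|by mfun|by move=> *; rewrite lee_fin addr_ge0 ?sqr_ge0|by rewrite lee_fin exprn_ge0// mulr_ge0 ?pi_ge0].
rewrite le_eqVlt; apply/orP; left; apply/eqP; apply: eq_integral => x _.
rewrite divr1 sqr_sqrtr ?addr_ge0 ?sqr_ge0// muleC; congr (_ * _)%E.
transitivity (\int[leb]_y (fun z => (pkn (de_ j) z)%:E) (tsub y x))%E.
  by apply: eq_integral => y _; rewrite mul1r /k pkn_tsubC.
rewrite (ge0_integral_tsub (f := fun z => (pkn (de_ j) z)%:E)).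
- exact: pkn_integral.
- by apply/measurable_EFinP; exact: measurable_pkn.
- by move=> y; rewrite lee_fin pkn_ge0.
Qed.

End plancherel.

(** * Kernels of the damped evolution *)

Section radial_kernel.
Context {R : realType}.
Local Notation mR := (measurableTypeR R).

Lemma poisson1_cos (de x c : R) : 0 < de ->
  (\int[leb R]_s (expR (- (de * `|s|)) * cos (x * s + c))%:E = (cos c * pk de x)%:E)%E.
Proof.
move=> de0.
have E0 : (\int[leb R]_s (expR (- (de * `|s|)))%:E = (pk de 0)%:E)%E.
  have := poisson1 de0 0 0.
  under eq_integral do rewrite mul0r addr0 cos0 mulrC EFinM.
  rewrite ge0_integralZl; [|by []|by mfun|by move=> t _; rewrite lee_fin expR_ge0|by rewrite lee_fin addr_ge0].
  rewrite cos0 mul1r => /(congr1 (fun z => (2^-1)%:E * z)%E).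
  rewrite muleA -!EFinM (_ : 2^-1 * (1 + 1) = 1); last by field.
  by rewrite mul1e => ->; congr EFin; field.
have ie : (leb R).-integrable setT (fun t : mR => (expR (- (de * `|t|)))%:E).
  apply/integrableP; split; first by mfun.
  by under eq_integral do rewrite /= ger0_norm ?expR_ge0//; rewrite E0 ltry.
have i1 : (leb R).-integrable setT (fun t : mR => (expR (- (de * `|t|)) * (1 + cos (x * t + c)))%:E).
  apply/integrableP; split; first by mfun.
  under eq_integral do rewrite /= ger0_norm ?mulr_ge0 ?expR_ge0 ?cos1_ge0//.
  by rewrite poisson1// ltry.
transitivity (\int[leb R]_t ((expR (- (de * `|t|)) * (1 + cos (x * t + c)))%:E - (expR (- (de * `|t|)))%:E))%E.
  by apply: eq_integral => t _; rewrite -EFinB; congr EFin; ring.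
rewrite integralB//; rewrite poisson1// E0 -EFinB; congr EFin; ring.
Qed.

Lemma expl1_fin (de : R) : 0 < de -> (\int[leb R]_s (expR (- (de * `|s|)))%:E = (pk de 0)%:E)%E.
Proof.
move=> de0; have := poisson1_cos 0 0 de0; rewrite cos0 mul1r => <-.
by apply: eq_integral => s _; rewrite mul0r addr0 cos0 mulr1.
Qed.

Lemma expl1_cos_integrable (de x c : R) : 0 < de ->
  (leb R).-integrable setT (fun t : mR => (expR (- (de * `|t|)) * cos (x * t + c))%:E).
Proof.
move=> de0; have ie : (leb R).-integrable setT (fun t : mR => (expR (- (de * `|t|)))%:E).
  apply/integrableP; split; first by mfun.
  by under eq_integral do rewrite /= ger0_norm ?expR_ge0//; rewrite expl1_fin// ltry.
apply: (le_integrable measurableT _ _ ie); first by mfun.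
by move=> t _ /=; rewrite lee_fin normrM ler_piMr// cos_max.
Qed.

Variables (n : nat) (g : R -> R).
Local Notation V := (Rn R n).
Local Notation lebV := (@lebesgue_tuple R n).
Hypotheses (mg : measurable_fun setT g) (g0 : forall q, 0 <= g q)
  (ig : (\int[lebV]_x (g (dot x x))%:E < +oo)%E).

(* The Fourier transform of the radial function g(|x|^2). *)
Definition rft (z : V) : R := \int[lebV]_x (g (dot x x) * cos (dot z x)).

Hypothesis sin0 : forall z, \int[lebV]_x (g (dot x x) * sin (dot z x)) = 0.

Let ig' : lebV.-integrable setT (fun x => (g (dot x x))%:E).
Proof.
apply/integrableP; split; first by mfun.
by under eq_integral do rewrite /= ger0_norm//.
Qed.

Lemma rft_integrable (f : V -> R) : measurable_fun setT f -> (forall x, `|f x| <= 1) ->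
  lebV.-integrable setT (fun x => (g (dot x x) * f x)%:E).
Proof.
move=> mf f1; apply: (le_integrable measurableT _ _ ig'); first by mfun.
by move=> x _ /=; rewrite lee_fin normrM ler_piMr.
Qed.

Lemma measurable_rft : measurable_fun setT rft.
Proof. by apply: measurable_Rintegral2; mfun. Qed.

Lemma rft_cos z c :
  (\int[lebV]_x (g (dot x x) * cos (dot z x + c))%:E = (cos c * rft z)%:E)%E.
Proof.
have ic : lebV.-integrable setT (fun x => (g (dot x x) * cos (dot z x))%:E).
  by apply: rft_integrable; [mfun|move=> x; exact: cos_max].
have isn : lebV.-integrable setT (fun x => (g (dot x x) * sin (dot z x))%:E).
  by apply: rft_integrable; [mfun|move=> x; exact: sin_max].
transitivity (\int[lebV]_x ((cos c)%:E * (g (dot x x) * cos (dot z x))%:E -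
    (sin c)%:E * (g (dot x x) * sin (dot z x))%:E))%E.
  by apply: eq_integral => x _; rewrite cosD -!EFinM -EFinB; congr EFin; ring.
rewrite integralB; [|by []|exact: integrableZl|exact: integrableZl].
rewrite !integralZl//.
have -> : (\int[lebV]_x (g (dot x x) * cos (dot z x))%:E = (rft z)%:E)%E.
  by rewrite /rft /Rintegral fineK// (integrable_fin_num measurableT ic).
have -> : (\int[lebV]_x (g (dot x x) * sin (dot z x))%:E = 0%:E)%E.
  by rewrite -(sin0 z) /Rintegral fineK// (integrable_fin_num measurableT isn).
by rewrite mule0 sube0 -EFinM.
Qed.

Section evolution_kernel.
Variable tau : R.
Hypothesis tau0 : 0 < tau.
Hypothesis rft0 : forall z, 0 <= rft z.

Let om (z : V * mR) : R := g (dot z.1 z.1) * expR (- (tau * `|z.2|)).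

Definition phase (z : V * mR) (xi : V) : R := dot z.1 xi - z.2 * dot xi xi.

Definition evk (xi eta : V) : R := rft (tsub xi eta) * pk tau (dot xi xi - dot eta eta).

Lemma measurable_phase : measurable_fun setT (fun z : (V * mR) * V => phase z.1 z.2).
Proof. by rewrite /phase; mfun. Qed.

Lemma measurable_evk : measurable_fun setT (fun z : V * V => evk z.1 z.2).
Proof.
rewrite /evk; apply: measurable_funM.
  by apply: (measurableT_comp measurable_rft); apply: measurable_fun_tsub; mfun.
by apply: (measurableT_comp (measurable_pk tau)); mfun.
Qed.

Lemma evk_ge0 xi eta : 0 <= evk xi eta.
Proof. by rewrite mulr_ge0// pk_ge0. Qed.

Let mom : measurable_fun setT om.
Proof. by rewrite /om; mfun. Qed.

Let om0 z : 0 <= om z.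
Proof. by rewrite mulr_ge0 ?expR_ge0. Qed.

Let iom : (\int[prod_measure lebV (leb R)]_z (om z)%:E < +oo)%E.
Proof.
rewrite (fubini_tonelli1 (fun z => (om z)%:E)); last 2 first.
- exact/measurable_EFinP.
- by move=> z; rewrite lee_fin.
rewrite /fubini_F /om; under eq_integral => x _.
  under eq_integral do rewrite /= EFinM.
  rewrite ge0_integralZl; [|by []|by mfun|by move=> *; rewrite lee_fin expR_ge0|by rewrite lee_fin].
  rewrite expl1_fin//; over.
rewrite ge0_integralZr; [|by []|by mfun|by move=> *; rewrite lee_fin|by rewrite lee_fin pk_ge0].
apply: lte_mul_pinfty => //; last by rewrite ltry.
  by apply: integral_ge0 => *; rewrite lee_fin.
by rewrite ge0_fin_numE//; apply: integral_ge0 => *; rewrite lee_fin.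
Qed.

Let kE xi eta c :
  (\int[prod_measure lebV (leb R)]_z (om z * cos (phase z xi - phase z eta + c))%:E =
   (cos c * evk xi eta)%:E)%E.
Proof.
have iz : (lebV \x leb R)%E.-integrable setT (fun z => (om z * cos (phase z xi - phase z eta + c))%:E).
  have io : (lebV \x leb R)%E.-integrable setT (fun z => (om z)%:E).
    apply/integrableP; split; first exact/measurable_EFinP.
    by under eq_integral do rewrite /= ger0_norm//; exact: iom.
  apply: (le_integrable measurableT _ _ io); first by rewrite /phase; mfun.
  by move=> z _ /=; rewrite lee_fin normrM ler_piMr// cos_max.
rewrite -[LHS](integral12_prod_meas1 iz) /fubini_F /=.
set s := dot xi xi - dot eta eta.
transitivity (\int[lebV]_x ((pk tau s)%:E * (g (dot x x) * cos (dot (tsub xi eta) x + c))%:E))%E.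
  apply: eq_integral => x _.
  transitivity (\int[leb R]_t ((g (dot x x))%:E * (expR (- (tau * `|t|)) * cos (- s * t + (dot (tsub xi eta) x + c)))%:E))%E.
    apply: eq_integral => t _; rewrite -EFinM /om /= -mulrA; congr (_ * (_ * cos _))%:E.
    by rewrite /phase/= dot_tsubl /s (dotC xi) (dotC eta); ring.
  rewrite integralZl; [|by []|exact: expl1_cos_integrable].
  rewrite poisson1_cos// -!EFinM; congr EFin.
  by rewrite /pk sqrrN; ring.
rewrite integralZl//; last first.
  by apply: rft_integrable; [mfun|move=> x; exact: cos_max].
by rewrite rft_cos -EFinM; congr EFin; rewrite /evk -/s; ring.
Qed.

Variables (a b : V -> R).
Hypotheses (ma : measurable_fun setT a) (mb : measurable_fun setT b)
  (ia : (\int[lebV]_y (`|a y|)%:E < +oo)%E) (ib : (\int[lebV]_y (`|b y|)%:E < +oo)%E).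

Lemma evolution_le :
  (\int[lebV \x leb R]_z (g (dot z.1 z.1) * expR (- (tau * `|z.2|)) *
     (osc_re lebV phase a b z ^+ 2 + osc_im lebV phase a b z ^+ 2))%:E <=
   \int[lebV]_xi \int[lebV]_eta (Num.sqrt (a xi ^+ 2 + b xi ^+ 2) *
     Num.sqrt (a eta ^+ 2 + b eta ^+ 2) * evk xi eta)%:E)%E.
Proof.
exact: (gram_le mom om0 iom measurable_phase ma mb ia ib measurable_evk evk_ge0 kE).
Qed.

Lemma evolution_ge0 : (forall x, 0 <= a x) -> (forall x, b x = 0) ->
  (\int[lebV \x leb R]_z (g (dot z.1 z.1) * expR (- (tau * `|z.2|)) *
     (osc_re lebV phase a b z ^+ 2 + osc_im lebV phase a b z ^+ 2))%:E =
   \int[lebV]_xi \int[lebV]_eta (a xi * a eta * evk xi eta)%:E)%E.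
Proof.
exact: (gram_ge0 mom om0 iom measurable_phase ma mb ia ib measurable_evk evk_ge0 kE).
Qed.

End evolution_kernel.
End radial_kernel.

Section rft_radial.
Context {R : realType}.
Variables (n : nat) (g : R -> R).
Hypotheses (mg : measurable_fun setT g) (g0 : forall q, 0 <= g q)
  (ig : (\int[@lebesgue_tuple R n.+1]_x (g (dot x x))%:E < +oo)%E).

Definition axis (r : R) : Rn R n.+1 := tcons (r, [tuple 0 | i < n]).

Lemma dot_axis r : dot (axis r) (axis r) = r ^+ 2.
Proof.
rewrite dot_tcons -expr2 /dot big1 ?addr0// => i _.
by rewrite !tnth_mktuple mulr0.
Qed.

Lemma rft_1cos (z : Rn R n.+1) :
  (\int[@lebesgue_tuple R n.+1]_x (g (dot x x) * (1 + cos (dot z x)))%:E =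
   \int[@lebesgue_tuple R n.+1]_x (g (dot x x))%:E + (rft g z)%:E)%E.
Proof.
have ic : (@lebesgue_tuple R n.+1).-integrable setT (fun x => (g (dot x x) * cos (dot z x))%:E).
  by apply: rft_integrable => //; [mfun|move=> x; exact: cos_max].
have i1 : (@lebesgue_tuple R n.+1).-integrable setT (fun x => (g (dot x x))%:E).
  apply/integrableP; split; first by mfun.
  by under eq_integral do rewrite /= ger0_norm//.
transitivity (\int[@lebesgue_tuple R n.+1]_x ((g (dot x x))%:E + (g (dot x x) * cos (dot z x))%:E))%E.
  by apply: eq_integral => x _; rewrite -EFinD; congr EFin; ring.
rewrite integralD//; congr (_ + _)%E.
by rewrite /rft /Rintegral fineK// (integrable_fin_num measurableT ic).
Qed.

Lemma rft_radial (z z' : Rn R n.+1) : dot z z = dot z' z' -> rft g z = rft g z'.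
Proof.
move=> zz; have E (y : Rn R n.+1) : (\int[@lebesgue_tuple R n.+1]_x (g (dot x x) * (1 + cos (dot y x)))%:E =
    \int[leb R]_b \int[@lebesgue_tuple R n]_t (g (b ^+ 2 + dot t t) * (1 + cos (Num.sqrt (dot y y) * b)))%:E)%E.
  rewrite (ge0_integral_rad (F := fun z => (g z.1 * (1 + cos z.2))%:E)); [by []|by mfun|].
  by move=> q; rewrite lee_fin mulr_ge0// cos1_ge0.
have := E z; rewrite zz -E !rft_1cos.
have [r ->] : exists r, (\int[@lebesgue_tuple R n.+1]_x (g (dot x x))%:E = r%:E)%E.
  exists (fine (\int[@lebesgue_tuple R n.+1]_x (g (dot x x))%:E)%E).
  by rewrite fineK// ge0_fin_numE// integral_ge0// => x _; rewrite lee_fin.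
by rewrite -!EFinD => -[] /addrI.
Qed.

End rft_radial.

Lemma continuous_cvg_seq {R : realType} (h : R -> R) (f : nat -> R) (a : R) :
  {for a, continuous h} -> f @ \oo --> a -> h (f j) @[j --> \oo] --> h a.
Proof. exact: continuous_cvg. Qed.

Section dominated.
Context {R : realType} d (T : measurableType d) (mu : {measure set T -> \bar R}).

Lemma dominated_cvg_real (f_ : nat -> T -> R) (f G : T -> R) :
  (forall j, measurable_fun setT (f_ j)) -> measurable_fun setT f -> measurable_fun setT G ->
  {ae mu, forall x, f_ ^~ x @ \oo --> f x} ->
  (forall j x, `|f_ j x| <= G x) -> (\int[mu]_x (G x)%:E < +oo)%E ->
  (\int[mu]_x (f_ j x)%:E)%E @[j --> \oo] --> (\int[mu]_x (f x)%:E)%E.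
Proof.
move=> mf_ mf mG cvf fG iG.
have G0 x : 0 <= G x by exact: le_trans (fG 0%N x).
have iG' : mu.-integrable setT (fun x => (G x)%:E).
  apply/integrableP; split; first by mfun.
  by under eq_integral do rewrite /= (ger0_norm (G0 _)).
have mfE j : measurable_fun setT (fun x => (f_ j x)%:E) by mfun.
have mE : measurable_fun setT (fun x => (f x)%:E) by mfun.
have cE : {ae mu, forall x, setT x -> (fun j => (f_ j x)%:E) @ \oo --> (f x)%:E}.
  by apply: filterS cvf => x fx _; apply: cvg_EFin => //; exact: nearW.
have bE : {ae mu, forall x j, setT x -> (`|(f_ j x)%:E| <= (G x)%:E)%E}.
  by apply: aeW => x j _; rewrite lee_fin.
by have [] := dominated_convergence measurableT mfE mE cE iG' bE.
Qed.

End dominated.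

Section slice_continuity.
Context {R : realType}.
Variables (n : nat) (g : R -> R).
Local Notation V := (Rn R n.+2).
Local Notation lebV := (@lebesgue_tuple R n.+2).
Local Notation mR := (measurableTypeR R).
Hypotheses (mg : measurable_fun setT g) (g0 : forall q, 0 <= g q)
  (ig : (\int[lebV]_x (g (dot x x))%:E < +oo)%E).
Variable zeta : V.

Let h (x : V) : \bar R := (1 + cos (dot zeta x))%:E.

Let mh : measurable_fun setT h. Proof. by rewrite /h; mfun. Qed.
Let h0 x : (0 <= h x)%E. Proof. by rewrite lee_fin cos1_ge0. Qed.

Let sphr (s : R) : R := fine (sph h s).

Let sph_fin : exists2 M : R, 0 <= M & forall s, sph h s = (sphr s)%:E /\ 0 <= sphr s <= M.
Proof.
have [v v0 vE] := shell_integral_fin (R := R) n.+2.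
exists (v * 2); first by rewrite mulr_ge0.
move=> s; have le : (sph h s <= (v * 2)%:E)%E.
  rewrite EFinM -vE -ge0_integralZr; [|by []|by mfunw|by move=> x _; rewrite lee_fin shell_ge0|by rewrite lee_fin].
  apply: ge0_le_integral; [by []| |by rewrite /h; mfunw|by mfunw|].
  - by move=> x _; rewrite mule_ge0 ?lee_fin ?shell_ge0.
  - move=> x _; rewrite -!EFinM lee_fin; apply: ler_wpM2l; first exact: shell_ge0.
    by rewrite -[2]/(1 + 1) lerD2l; apply: le_trans (ler_norm _) (cos_max _).
have s0 := sph_ge0 s h0.
have fn : sph h s \is a fin_num by rewrite ge0_fin_numE// (le_lt_trans le)// ltry.
by rewrite fineK//; split => //; rewrite -!lee_fin fineK// s0.
Qed.

Let sph_cvg (s_ : nat -> R) (s : R) : s_ @ \oo --> s -> sphr (s_ j) @[j --> \oo] --> sphr s.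
Proof.
move=> cs; have [M M0 E] := sph_fin; apply: fine_cvg; rewrite -(E s).1 /sph.
have [v v0 vE] := shell_integral_fin (R := R) n.+2.
apply: (dominated_cvg_real (G := fun x => shell (dot x x) * 2)).
- by move=> j; mfunw.
- by mfunw.
- by mfunw.
- apply: aeW => x; apply: cvgM; first exact: cvg_cst.
  apply: cvgD; first exact: cvg_cst.
  apply: (continuous_cvg_seq (h := cos)); first exact: continuous_cos.
  rewrite dotC dot_tscalel; under eq_fun do rewrite dotC dot_tscalel.
  apply: cvgM; last exact: cvg_cst.
  apply: cvgM; last exact: cvg_cst.
  by apply: (continuous_cvg_seq (h := Num.sqrt)) => //; exact: sqrt_continuous.
- move=> j x; rewrite normrM (ger0_norm (shell_ge0 _)); apply: ler_wpM2l; first exact: shell_ge0.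
  rewrite ger0_norm ?cos1_ge0//.
  by rewrite -[2]/(1 + 1) lerD2l; apply: le_trans (ler_norm _) (cos_max _).
- under eq_integral do rewrite EFinM.
  rewrite ge0_integralZr; [|by []|by mfunw|by move=> x _; rewrite lee_fin shell_ge0|by rewrite lee_fin].
  by rewrite vE -EFinM ltry.
Qed.

Definition slice_int (z : R) : \bar R :=
  (\int[lebV]_x (g (z ^+ 2 + dot x x) * (1 + cos (dot zeta x)))%:E)%E.

Let wt_le (s t : R) : s <= t -> wt n.+2 s <= wt n.+2 t.
Proof.
move=> st; have [s0|s0] := ltP 0 s; last first.
  by rewrite {1}/wt ltNge s0/= wt_ge0.
by rewrite !wtSS// ?(lt_le_trans s0)// lerXn2r ?nnegrE ?sqrtr_ge0// ler_wsqrtr.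
Qed.

Lemma slice_int_cvg : exists2 M : R, (forall z, slice_int z <= M%:E)%E &
  forall z_ : nat -> R, z_ @ \oo --> (0 : R) -> slice_int (z_ j) @[j --> \oo] --> slice_int 0.
Proof.
have [c [lam [c0 lam0 P1 P2]]] := polar_radial (R := R) n.+1.
have [M M0 E] := sph_fin.
pose f (z s : R) : R := wt n.+2 (s - z ^+ 2) * sphr (s - z ^+ 2) * g s.
have msph : measurable_fun setT (sphr : mR -> R).
  by apply: (measurableT_comp (fine_measurable measurableT)); exact: measurable_sph.
have mf z : measurable_fun setT (f z : mR -> R).
  rewrite /f; apply: measurable_funM => //; apply: measurable_funM; first by mfunw.
  by apply: (measurableT_comp msph); mfun.
have f0 z s : 0 <= f z s.
  by rewrite !mulr_ge0 ?wt_ge0//; have [_ /andP[]] := E (s - z ^+ 2).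
have sE z : slice_int z = (c%:E * \int[leb R]_s (f z s)%:E)%E.
  rewrite -(ge0_integral_shift (f := fun s => (f z s)%:E) (z ^+ 2)); last 2 first.
  - apply: (proj2 (measurable_EFinP _ _)); exact: (mf z).
  - by move=> s; rewrite lee_fin.
  have := P1 h (fun q => (g (z ^+ 2 + q))%:E) mh h0; rewrite /slice_int => P1'.
  transitivity (\int[lebn n.+2]_x (h x * (g (z ^+ 2 + dot x x))%:E))%E.
    by apply: eq_integral => x _; rewrite -EFinM mulrC.
  rewrite P1'; [|by mfun|by move=> q; rewrite lee_fin].
  congr (_ * _)%E; apply: eq_integral => s _.
  by rewrite (E s).1 /f addrK muleA -!EFinM (addrC s).
have iG : (\int[leb R]_s (wt n.+2 s * M * g s)%:E < +oo)%E.
  have mgE : measurable_fun setT (fun q => (g q)%:E) by mfun.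
  have gE0 q : (0 <= (g q)%:E)%E by rewrite lee_fin.
  have gE := P2 _ mgE gE0.
  have : (\int[leb R]_s ((wt n.+2 s)%:E * (g s)%:E) < +oo)%E.
    rewrite -(mule1 (integral _ _ _)) (_ : 1%:E = (lam^-1 * lam)%:E)%E; last by rewrite mulVf// gt_eqF.
    rewrite EFinM muleC -muleA -gE lte_mul_pinfty//; first by rewrite lee_fin invr_ge0 ltW.
  move=> iw; have : (M%:E * \int[leb R]_s ((wt n.+2 s)%:E * (g s)%:E) < +oo)%E.
    by rewrite lte_mul_pinfty.
  rewrite -ge0_integralZl; [|by []|by mfunw|by move=> s _; rewrite mule_ge0 ?lee_fin ?wt_ge0|by rewrite lee_fin].
  congr (_ < _)%E; apply: eq_integral => s _; rewrite -!EFinM; congr EFin; ring.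
have fG z s : `|f z s| <= wt n.+2 s * M * g s.
  rewrite ger0_norm// ler_wpM2r// ler_pM ?wt_ge0//.
  - by have [_ /andP[]] := E (s - z ^+ 2).
  - by apply: wt_le; rewrite lerBlDr lerDl sqr_ge0.
  - by have [_ /andP[]] := E (s - z ^+ 2).
exists (c * fine (\int[leb R]_s (wt n.+2 s * M * g s)%:E)%E).
  move=> z; rewrite sE EFinM fineK; last first.
    by rewrite ge0_fin_numE//; apply: integral_ge0 => s _; rewrite lee_fin !mulr_ge0 ?wt_ge0.
  apply: lee_wpmul2l; first by rewrite lee_fin ltW.
  apply: ge0_le_integral; [by []|by move=> *; rewrite lee_fin|by apply: (proj2 (measurable_EFinP _ _)); exact: (mf z)|by mfunw|].
  by move=> s _; rewrite lee_fin; apply: le_trans (ler_norm _) (fG _ _).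
move=> z_ cz; rewrite sE; under eq_fun do rewrite sE.
apply: cvgeZl => //.
apply: (@dominated_cvg_real R _ mR (leb R) (fun j => f (z_ j)) (f 0) (fun s => wt n.+2 s * M * g s)).
- by move=> j; exact: mf.
- exact: mf.
- by mfunw.
- apply: aeW => s; rewrite /f; apply: cvgM; last exact: cvg_cst.
  have sz : s - z_ j ^+ 2 @[j --> \oo] --> s - 0 ^+ 2.
    apply: cvgB; first exact: cvg_cst.
    by rewrite expr2; under eq_fun do rewrite expr2; exact: cvgM.
  apply: cvgM; last exact: sph_cvg.
  rewrite expr0n/= subr0 in sz *.
  have [s0|s0] := ltP 0 s; last first.
    rewrite {2}/wt ltNge s0/=; apply: cvg_near_cst; apply: nearW => j.
    by rewrite /wt ifF// ltNge (le_trans _ s0)// lerBlDr lerDl sqr_ge0.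
  rewrite (wtSS n s0).
  apply: (@cvg_trans _ (Num.sqrt (s - z_ j ^+ 2) ^+ n @[j --> \oo])).
    apply: near_eq_cvg; near=> j; rewrite wtSS//.
    by near: j; exact: (cvgr_gt s).
  apply: (continuous_cvg_seq (h := fun x : R => x ^+ n)); first exact: exprn_continuous.
  by apply: (continuous_cvg_seq (h := Num.sqrt)) => //; exact: sqrt_continuous.
- by move=> j s; exact: fG.
- exact: iG.
Unshelve. all: by end_near.
Qed.

End slice_continuity.

(** * Descent to one dimension less *)

Section descent.
Context {R : realType}.
Variables (n : nat) (g : R -> R).
Local Notation V := (Rn R n.+2).
Local Notation lebV := (@lebesgue_tuple R n.+2).
Local Notation mR := (measurableTypeR R).
Hypotheses (mg : measurable_fun setT g) (g0 : forall q, 0 <= g q)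
  (ig : (\int[lebV]_x (g (dot x x))%:E < +oo)%E)
  (ig' : (\int[@lebesgue_tuple R n.+3]_x (g (dot x x))%:E < +oo)%E).

Let slice_ge0 zeta z : (0 <= slice_int g (zeta : V) z)%E.
Proof. by apply: integral_ge0 => x _; rewrite lee_fin mulr_ge0// cos1_ge0. Qed.

Let measurable_slice zeta : measurable_fun setT (fun z : mR => slice_int g (zeta : V) z).
Proof.
rewrite /slice_int; apply: (@measurable_integral2 _ _ _ _ R _ (fun (z : mR) x => (g (z ^+ 2 + dot x x) * (1 + cos (dot zeta x)))%:E)).
  by mfun.
by move=> z x; rewrite lee_fin mulr_ge0// cos1_ge0.
Qed.

Let ka (j : nat) : R := j.+1%:R^-1.

Let ka0 j : 0 < ka j.
Proof. by rewrite invr_gt0. Qed.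

Lemma poisson_slice_cvg zeta :
  (\int[leb R]_z ((pk (ka j) z)%:E * slice_int g (zeta : V) z))%E @[j --> \oo] -->
  ((2 * pi)%:E * slice_int g zeta 0)%E.
Proof.
have [M SM Scvg] := slice_int_cvg mg g0 ig zeta.
pose S z := fine (slice_int g zeta z).
have SE z : slice_int g zeta z = (S z)%:E.
  by rewrite fineK// ge0_fin_numE// (le_lt_trans (SM z))// ltry.
have S0 z : 0 <= S z by rewrite -lee_fin -SE.
have mS : measurable_fun setT (S : mR -> R).
  by apply: (measurableT_comp (fine_measurable measurableT)); exact: measurable_slice.
have E j : (\int[leb R]_z ((pk (ka j) z)%:E * slice_int g (zeta : V) z) =
    \int[leb R]_u (pk 1 u * S (ka j * u))%:E)%E.
  rewrite (ge0_integral_scale (f := fun z => ((pk (ka j) z)%:E * slice_int g zeta z)%E) (ka0 j)); last 2 first.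
  - by apply: emeasurable_funM; [apply/measurable_EFinP; exact: measurable_pk|exact: measurable_slice].
  - by move=> z; rewrite mule_ge0 ?lee_fin ?pk_ge0.
  rewrite -ge0_integralZl; [|by []| | |by rewrite lee_fin ltW]; last 2 first.
  - apply: emeasurable_funM; first by apply/measurable_EFinP; apply: (measurableT_comp (measurable_pk _)); mfun.
    by apply: (measurableT_comp (measurable_slice zeta)); mfun.
  - by move=> z _; rewrite mule_ge0 ?lee_fin ?pk_ge0.
  apply: eq_integral => u _; rewrite SE -!EFinM mulrA; congr (_ * _)%:E.
  have := ka0 j; rewrite /pk; set k := ka j => k0; field.
  by rewrite !gt_eqF// ?ltr_pwDl// ?exprn_gt0 ?sqr_ge0// mulr_gt0.
under eq_fun do rewrite E.
have -> : ((2 * pi)%:E * slice_int g zeta 0 = \int[leb R]_u (pk 1 u * S 0)%:E)%E.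
  rewrite SE -(pk_integral (R := R) ltr01).
  rewrite -ge0_integralZr; [|by []|by apply/measurable_EFinP; exact: measurable_pk| |by rewrite lee_fin].
    by apply: eq_integral => u _; rewrite EFinM.
  by move=> u _; rewrite lee_fin pk_ge0.
have mSk j : measurable_fun setT (fun u : mR => pk 1 u * S (ka j * u)).
  apply: measurable_funM; first exact: measurable_pk.
  by apply: (measurableT_comp mS); mfun.
apply: (@dominated_cvg_real R _ mR (leb R) (fun j (u : mR) => pk 1 u * S (ka j * u))
  (fun u => pk 1 u * S 0) (fun u => pk 1 u * M)).
- by [].
- by apply: measurable_funM; [exact: measurable_pk|mfun].
- by apply: measurable_funM; [exact: measurable_pk|mfun].
- apply: aeW => u; apply: cvgM; first exact: cvg_cst.
  apply: fine_cvg; rewrite -SE; apply: Scvg.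
  rewrite -(mul0r u); apply: cvgM; last exact: cvg_cst.
  exact: cvg_harmonic.
- move=> j u; rewrite normrM !ger0_norm ?pk_ge0//.
  by rewrite ler_wpM2l ?pk_ge0// -lee_fin -SE.
- under eq_integral do rewrite EFinM.
  rewrite ge0_integralZr; [|by []|by apply/measurable_EFinP; exact: measurable_pk| |].
  + by rewrite pk_integral// -EFinM ltry.
  + by move=> u _; rewrite lee_fin pk_ge0.
  + by rewrite lee_fin (le_trans (S0 0))// -lee_fin -SE.
Qed.

Let o : V := [tuple (0 : R) | i < n.+2].

Let slice0 (z : R) : (\int[lebV]_x (g (z ^+ 2 + dot x x))%:E)%E = (2^-1%:E * slice_int g o z)%E.
Proof.
rewrite -ge0_integralZl; [|by []|by mfun| |by rewrite lee_fin invr_ge0]; last first.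
  by move=> x _; rewrite lee_fin mulr_ge0// cos1_ge0.
apply: eq_integral => x _; rewrite -EFinM; congr EFin.
rewrite (_ : dot o x = 0) ?cos0; last first.
  by rewrite /dot big1// => i _; rewrite /o tnth_mktuple mul0r.
by field.
Qed.

Variable zeta : V.
Hypothesis rft0 : forall z : Rn R n.+3, 0 <= rft g z.

Let A k := (\int[leb R]_z \int[lebV]_x (g (z ^+ 2 + dot x x) * (pk k 0 + cos (dot zeta x) * pk k z))%:E)%E.

Let A1 k : 0 < k -> (A k = \int[leb R]_y (expR (- (k * `|y|)) * rft g (tcons (y : mR, zeta)))%:E +
  (pk k 0)%:E * \int[@lebesgue_tuple R n.+3]_x (g (dot x x))%:E)%E.
Proof.
move=> k0.
have mrft : measurable_fun setT (fun y : mR => rft g (tcons (y, zeta))).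
  by apply: (measurableT_comp (measurable_rft mg)); mfunv.
pose F (z : mR) (x : V) (y : mR) : \bar R := (g (z ^+ 2 + dot x x) * (expR (- (k * `|y|)) * (1 + cos (z * y + dot zeta x))))%:E.
have F0 z x y : (0 <= F z x y)%E by rewrite lee_fin !mulr_ge0 ?expR_ge0 ?cos1_ge0.
transitivity (\int[leb R]_z \int[lebV]_x \int[leb R]_y F z x y)%E.
  apply: eq_integral => z _; apply: eq_integral => x _.
  rewrite /F; under eq_integral do rewrite EFinM.
  rewrite ge0_integralZl; [by rewrite poisson1// -EFinM|by []|by mfun| |by rewrite lee_fin].
  by move=> y _; rewrite lee_fin !mulr_ge0 ?expR_ge0 ?cos1_ge0.
transitivity (\int[leb R]_z \int[leb R]_y \int[lebV]_x F z x y)%E.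
  by apply: eq_integral => z _; rewrite (tonelli2 (fun x y => F z x y)); [|rewrite /F; mfun|].
rewrite (tonelli2 (fun z y => \int[lebV]_x F z x y)%E); last 2 first.
- by rewrite /F; mfun; move=> *; rewrite lee_fin !mulr_ge0 ?expR_ge0 ?cos1_ge0.
- by move=> z y; apply: integral_ge0.
transitivity (\int[leb R]_y ((expR (- (k * `|y|)) * rft g (tcons (y : mR, zeta)))%:E +
   (expR (- (k * `|y|)))%:E * \int[@lebesgue_tuple R n.+3]_x (g (dot x x))%:E))%E.
  apply: eq_integral => y _.
  transitivity ((expR (- (k * `|y|)))%:E * \int[@lebesgue_tuple R n.+3]_x (g (dot x x) * (1 + cos (dot (tcons (y : mR, zeta)) x)))%:E)%E.
    rewrite ge0_integral_tcons; [|by mfunv|by move=> x; rewrite lee_fin mulr_ge0 ?cos1_ge0].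
    rewrite -ge0_integralZl; [|by []| | |by rewrite lee_fin expR_ge0]; last 2 first.
    - apply: (@measurable_integral2 _ _ _ _ R _ (fun (z : mR) (t : V) => (g (dot (tcons (z, t)) (tcons (z, t))) * (1 + cos (dot (tcons (y : mR, zeta)) (tcons (z, t)))))%:E)).
        by mfunv.
      by move=> z t; rewrite lee_fin mulr_ge0 ?cos1_ge0.
    - by move=> z _; apply: integral_ge0 => t _; rewrite lee_fin mulr_ge0 ?cos1_ge0.
    apply: eq_integral => z _.
    rewrite -ge0_integralZl; [|by []|by mfunv| |by rewrite lee_fin expR_ge0]; last first.
      by move=> t _; rewrite lee_fin mulr_ge0 ?cos1_ge0.
    apply: eq_integral => x _; rewrite /F -EFinM !dot_tcons /=; congr EFin.
    by rewrite (mulrC z y) expr2; ring.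
  rewrite rft_1cos// ge0_muleDr; first by rewrite -EFinM addeC.
    by apply: integral_ge0 => x _; rewrite lee_fin.
  by rewrite lee_fin.
have B0 : (0 <= \int[@lebesgue_tuple R n.+3]_x (g (dot x x))%:E)%E.
  by apply: integral_ge0 => x _; rewrite lee_fin.
rewrite ge0_integralD; [|by []| |by mfun| |by mfun]; last 2 first.
- by move=> y _; rewrite lee_fin mulr_ge0 ?expR_ge0.
- by move=> y _; rewrite mule_ge0 ?lee_fin ?expR_ge0.
congr (_ + _)%E; rewrite ge0_integralZr; [by rewrite expl1_fin|by []|by mfun| |by []].
by move=> y _; rewrite lee_fin expR_ge0.
Qed.

Let A2 k : 0 < k ->
  (A k + \int[leb R]_z ((pk k z)%:E * (\int[lebV]_x (g (z ^+ 2 + dot x x))%:E)) =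
   \int[leb R]_z ((pk k z)%:E * slice_int g zeta z) +
   (pk k 0)%:E * \int[@lebesgue_tuple R n.+3]_x (g (dot x x))%:E)%E.
Proof.
move=> k0; rewrite ge0_integral_tcons; [|by mfunv|by move=> x; rewrite lee_fin].
have mpk := measurable_pk (R := R) k.
have pc z x : 0 <= pk k 0 + cos (dot zeta x) * pk k z.
  have := pk_le0 k0 z; have := pk_ge0 k0 z; have := cos_geN1 (dot zeta x); nra.
have mpkE : measurable_fun setT (fun z : mR => (pk k z)%:E) by apply/measurable_EFinP.
have mI : measurable_fun setT (fun z : mR => \int[lebV]_x (g (z ^+ 2 + dot x x))%:E)%E.
  apply: (@measurable_integral2 _ _ _ _ R _ (fun (z : mR) (x : V) => (g (z ^+ 2 + dot x x))%:E)); first by mfun.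
  by move=> z x; rewrite lee_fin.
have I0 z : (0 <= \int[lebV]_x (g (z ^+ 2 + dot x x))%:E)%E by apply: integral_ge0 => x _; rewrite lee_fin.
have mpk1 : measurable_fun setT (fun z : mR * V => pk k z.1).
  exact: (measurableT_comp mpk measurable_fst).
rewrite -[X in (_ = _ + X)%E]ge0_integralZl; [|by []| | |by rewrite lee_fin pk_ge0]; last 2 first.
- by under eq_fun do under eq_integral do rewrite dot_tcons -expr2.
- by move=> z _; apply: integral_ge0 => x _; rewrite lee_fin.
rewrite -ge0_integralD; [|by []| | | |exact: emeasurable_funM]; last 3 first.
- by move=> z _; apply: integral_ge0 => x _; rewrite lee_fin mulr_ge0.
- apply: (@measurable_integral2 _ _ _ _ R _ (fun (z : mR) (x : V) => (g (z ^+ 2 + dot x x) * (pk k 0 + cos (dot zeta x) * pk k z))%:E)).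
    apply/measurable_EFinP; apply: measurable_funM; first by mfun.
    apply: measurable_funD; first by mfun.
    by apply: measurable_funM; [mfun|].
  by move=> z x; rewrite lee_fin mulr_ge0.
- by move=> z _; rewrite mule_ge0 ?lee_fin ?pk_ge0.
rewrite -ge0_integralD; [|by []| |by apply: emeasurable_funM| | ]; last 3 first.
- by move=> z _; rewrite mule_ge0 ?lee_fin ?pk_ge0.
- move=> z _; rewrite mule_ge0 ?lee_fin ?pk_ge0//.
  by apply: integral_ge0 => x _; rewrite lee_fin.
- apply: emeasurable_funM; first by mfun.
  by under eq_fun do under eq_integral do rewrite dot_tcons -expr2.
apply: eq_integral => z _.
under [X in (_ = _ + _ * X)%E]eq_integral do rewrite dot_tcons -expr2.
have pkz0 y : (0 <= (pk k y)%:E)%E by rewrite lee_fin pk_ge0.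
have gc0 x : 0 <= g (z ^+ 2 + dot x x) * (1 + cos (dot zeta x)) by rewrite mulr_ge0// cos1_ge0.
have pkr0 y : 0 <= pk k y by rewrite pk_ge0.
rewrite /slice_int -!ge0_integralZl; try (first [exact: measurableT | exact: pkz0 | by mfun |
  by move=> x _; rewrite lee_fin]).
rewrite -!ge0_integralD; try (first [exact: measurableT | by mfun |
  by move=> x _; rewrite lee_fin mulr_ge0 | by move=> x _; rewrite mule_ge0// lee_fin]).
by apply: eq_integral => x _; rewrite -!EFinM -!EFinD; congr EFin; ring.
Qed.

Let poisson_slice_fin z k : 0 < k -> (\int[leb R]_t ((pk k t)%:E * slice_int g (z : V) t) \is a fin_num)%E.
Proof.
move=> k0; have [M SM _] := slice_int_cvg mg g0 ig z.
rewrite ge0_fin_numE; last by apply: integral_ge0 => t _; rewrite mule_ge0// lee_fin pk_ge0.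
have M0 : (0 <= M%:E)%E by exact: le_trans (slice_ge0 z 0) (SM 0).
apply: (@le_lt_trans _ _ (\int[leb R]_t ((pk k t)%:E * M%:E))%E).
  have mpkE : measurable_fun setT (fun z : mR => (pk k z)%:E).
    by apply/measurable_EFinP; exact: measurable_pk.
  apply: ge0_le_integral; [by []| | | |].
  - by move=> t _; rewrite mule_ge0// lee_fin pk_ge0.
  - by apply: emeasurable_funM; [exact: mpkE|exact: measurable_slice].
  - by apply: emeasurable_funM; [exact: mpkE|exact: measurable_cst].
  - by move=> t _; apply: lee_wpmul2l; [rewrite lee_fin pk_ge0|exact: SM].
rewrite ge0_integralZr; [|by []|by apply/measurable_EFinP; exact: measurable_pk| |by []].
  by rewrite pk_integral// -EFinM ltry.
by move=> u _; rewrite lee_fin pk_ge0.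
Qed.

Let balance k : 0 < k ->
  (\int[leb R]_y (expR (- (k * `|y|)) * rft g (tcons (y : mR, zeta)))%:E =
   \int[leb R]_z ((pk k z)%:E * slice_int g zeta z) -
   2^-1%:E * \int[leb R]_z ((pk k z)%:E * slice_int g o z))%E.
Proof.
move=> k0; have := A2 k0; rewrite A1//.
have -> : (\int[leb R]_z ((pk k z)%:E * (\int[lebV]_x (g (z ^+ 2 + dot x x))%:E)) =
    2^-1%:E * \int[leb R]_z ((pk k z)%:E * slice_int g o z))%E.
  rewrite -ge0_integralZl; [|by []| | |by rewrite lee_fin invr_ge0]; last 2 first.
  - by apply: emeasurable_funM; [apply/measurable_EFinP; exact: measurable_pk|exact: measurable_slice].
  - by move=> z _; rewrite mule_ge0 ?lee_fin ?pk_ge0.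
  by apply: eq_integral => z _; rewrite slice0 muleCA.
have Bf : (\int[@lebesgue_tuple R n.+3]_x (g (dot x x))%:E)%E \is a fin_num.
  by rewrite ge0_fin_numE//; apply: integral_ge0 => x _; rewrite lee_fin.
have pf : ((pk k 0)%:E * \int[@lebesgue_tuple R n.+3]_x (g (dot x x))%:E)%E \is a fin_num.
  by rewrite fin_numM.
have Jof : (2^-1%:E * \int[leb R]_z ((pk k z)%:E * slice_int g o z))%E \is a fin_num.
  by rewrite fin_numM// poisson_slice_fin.
move: (_ * \int[leb R]_z _)%E Jof => J Jf.
move: (_ * \int[_]_z _)%E pf => pB pf.
move: (\int[_]_z _)%E => L; move: (\int[_]_y _)%E => Jz E.
by rewrite -[Jz](addeK _ pf) -E -addeA (addeC pB) addeA addeK// addeK.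
Qed.

Lemma rft_descent :
  (\int[leb R]_y (rft g (tcons (y : mR, zeta)))%:E <= (2 * pi * rft g zeta)%:E)%E.
Proof.
have mrft : measurable_fun setT (fun y : mR => rft g (tcons (y, zeta))).
  by apply: (measurableT_comp (measurable_rft mg)); mfunv.
have cJ : (\int[leb R]_z ((pk (ka j) z)%:E * slice_int g zeta z) -
   2^-1%:E * \int[leb R]_z ((pk (ka j) z)%:E * slice_int g o z))%E @[j --> \oo] -->
   ((2 * pi)%:E * slice_int g zeta 0 - 2^-1%:E * ((2 * pi)%:E * slice_int g o 0))%E.
  have fo : slice_int g o 0 \is a fin_num.
    have [M SM _] := slice_int_cvg mg g0 ig o.
    by rewrite ge0_fin_numE// (le_lt_trans (SM 0))// ltry.
  apply: cvgeB; first by rewrite fin_num_adde_defl// fin_numN !fin_numM.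
    exact: poisson_slice_cvg.
  by apply: cvgeZl => //; exact: poisson_slice_cvg.
have E : ((2 * pi)%:E * slice_int g zeta 0 - 2^-1%:E * ((2 * pi)%:E * slice_int g o 0))%E = (2 * pi * rft g zeta)%:E.
  rewrite muleCA -slice0.
  have -> : slice_int g zeta 0 = (\int[lebV]_x (g (dot x x) * (1 + cos (dot zeta x)))%:E)%E.
    by apply: eq_integral => x _; rewrite expr0n/= add0r.
  have -> : (\int[lebV]_x (g (0 ^+ 2 + dot x x))%:E = \int[lebV]_x (g (dot x x))%:E)%E.
    by apply: eq_integral => x _; rewrite expr0n/= add0r.
  rewrite rft_1cos//.
  have Bf : (\int[lebV]_x (g (dot x x))%:E)%E \is a fin_num.
    by rewrite ge0_fin_numE//; apply: integral_ge0 => x _; rewrite lee_fin.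
  move: Bf; move: (\int[_]_x _)%E => [b _| |] //.
  by rewrite -(EFinD b) -!EFinM -EFinB; congr EFin; ring.
rewrite -E; apply: (@fatou_le R _ mR (leb R)
  (fun j y => (expR (- (ka j * `|y|)) * rft g (tcons (y : mR, zeta)))%:E) _ _ _ _ _ _ _ _ _ cJ).
- by move=> j; mfun.
- by move=> j y; rewrite lee_fin mulr_ge0 ?expR_ge0.
- by mfun.
- by move=> y; rewrite lee_fin.
- apply: aeW => y; apply: cvg_EFin; first exact: nearW.
  rewrite -[X in _ --> X]mul1r -expR0; apply: cvgM; last exact: cvg_cst.
  apply: (continuous_cvg_seq (h := expR)); first exact: continuous_expR.
  rewrite -oppr0 -(mul0r `|y|); apply: cvgN; apply: cvgM; last exact: cvg_cst.
  exact: cvg_harmonic.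
- by move=> j; rewrite balance.
Qed.

End descent.

Section Rintegral_fubini.
Context {R : realType} d1 d2 (T1 : measurableType d1) (T2 : measurableType d2)
  (m1 : {sigma_finite_measure set T1 -> \bar R})
  (m2 : {sigma_finite_measure set T2 -> \bar R}).
Variables (f : T1 -> T2 -> R) (p : T1 -> R) (q : T2 -> R).
Hypotheses (mf : measurable_fun setT (fun z : T1 * T2 => f z.1 z.2))
  (mp : measurable_fun setT p) (mq : measurable_fun setT q)
  (p0 : forall x, 0 <= p x) (q0 : forall y, 0 <= q y)
  (fpq : forall x y, `|f x y| <= p x * q y)
  (ip : (\int[m1]_x (p x)%:E < +oo)%E) (iq : (\int[m2]_y (q y)%:E < +oo)%E).

Let mfE : measurable_fun setT (fun z : T1 * T2 => (f z.1 z.2)%:E).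
Proof. exact/measurable_EFinP. Qed.

Let ix x : m2.-integrable setT (EFin \o f x).
Proof.
have mfx : measurable_fun setT (f x) by exact: (measurableT_comp mf (@pair1_measurable _ _ _ _ x)).
apply/integrableP; split; first exact/measurable_EFinP.
apply: (@le_lt_trans _ _ (\int[m2]_y ((p x)%:E * (q y)%:E))%E).
  apply: ge0_le_integral; [by []|by []| |by mfun|by move=> y _; rewrite /= -EFinM lee_fin].
  by apply: measurableT_comp => //; exact/measurable_EFinP.
rewrite ge0_integralZl; [|by []|by mfun|by move=> y _; rewrite lee_fin|by rewrite lee_fin].
by rewrite lte_mul_pinfty// lee_fin.
Qed.

Let iy y : m1.-integrable setT (EFin \o f^~ y).
Proof.
have mfy : measurable_fun setT (f^~ y) by exact: (measurableT_comp mf (@pair2_measurable _ _ _ _ y)).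
apply/integrableP; split; first exact/measurable_EFinP.
apply: (@le_lt_trans _ _ (\int[m1]_x ((p x)%:E * (q y)%:E))%E).
  apply: ge0_le_integral; [by []|by []| |by mfun|by move=> x _; rewrite /= -EFinM lee_fin].
  by apply: measurableT_comp => //; exact/measurable_EFinP.
rewrite ge0_integralZr; [|by []|by mfun|by move=> x _; rewrite lee_fin|by rewrite lee_fin].
by rewrite muleC lte_mul_pinfty// lee_fin.
Qed.

Let ixy : (m1 \x m2)%E.-integrable setT (fun z => (f z.1 z.2)%:E).
Proof.
have mfn : measurable_fun setT (fun z : T1 * T2 => (`|f z.1 z.2|)%:E) by mfun.
apply/integrable12ltyP; first exact: mfE.
have q_fin : (\int[m2]_y (q y)%:E \is a fin_num)%E.
  by rewrite ge0_fin_numE// integral_ge0// => y _; rewrite lee_fin.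
apply: (@le_lt_trans _ _ (\int[m1]_x ((p x)%:E * \int[m2]_y (q y)%:E))%E).
  apply: ge0_le_integral; [by []|by move=> x _; apply: integral_ge0| | |].
  - by apply: (@measurable_integral2 _ _ _ _ R m2 (fun x y => `|(f x y)%:E|%E)); [mfun|by []].
  - by mfun.
  - move=> x _; rewrite -ge0_integralZl; [|by []|by mfun|by move=> y _; rewrite lee_fin|by rewrite lee_fin].
    apply: ge0_le_integral; [by []|by []| |by mfun|by move=> y _; rewrite /= -EFinM lee_fin].
    by apply: (measurableT_comp mfn (@pair1_measurable _ _ _ _ x)).
rewrite ge0_integralZr; [|by []|by mfun|by move=> x _; rewrite lee_fin|].
  rewrite muleC lte_mul_pinfty//.
  by apply: integral_ge0 => y _; rewrite lee_fin.
by apply: integral_ge0 => y _; rewrite lee_fin.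
Qed.

Lemma Rintegral_fubini : \int[m1]_x \int[m2]_y f x y = \int[m2]_y \int[m1]_x f x y.
Proof.
rewrite {1 3}/Rintegral; congr fine.
transitivity (\int[m1]_x \int[m2]_y (f x y)%:E)%E.
  by apply: eq_integral => x _; rewrite /Rintegral fineK//; exact: integrable_fin_num (ix x).
transitivity (\int[m2]_y \int[m1]_x (f x y)%:E)%E.
  by rewrite (integral12_prod_meas1 ixy) -(integral21_prod_meas1 ixy).
by apply: eq_integral => y _; rewrite /Rintegral fineK//; exact: integrable_fin_num (iy y).
Qed.

End Rintegral_fubini.

Section weighted_limit.
Context {R : realType} d (T : measurableType d) (mu : {measure set T -> \bar R}).

Lemma Re_sub (x y : R[i]) : complex.Re (x - y) = complex.Re x - complex.Re y.
Proof. by case: x; case: y. Qed.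

Lemma Im_sub (x y : R[i]) : complex.Im (x - y) = complex.Im x - complex.Im y.
Proof. by case: x; case: y. Qed.

Lemma normc2_ge0 (x : R[i]) : 0 <= normc2 x.
Proof. by rewrite addr_ge0 ?sqr_ge0. Qed.

Lemma normc2_young (x y : R[i]) (t : R) : 0 < t ->
  normc2 x <= (1 + t) * normc2 y + (1 + t^-1) * normc2 (x - y).
Proof.
move=> t0; rewrite /normc2 Re_sub Im_sub.
move: (complex.Re x) (complex.Im x) (complex.Re y) (complex.Im y) => a b p q.
rewrite -subr_ge0 (_ : _ - _ = (t * p - (a - p)) ^+ 2 / t + (t * q - (b - q)) ^+ 2 / t); last first.
  by field; rewrite gt_eqF.
by rewrite addr_ge0// divr_ge0 ?sqr_ge0// ltW.
Qed.

Lemma measurable_normc2 (f : T -> R[i]) : measurable_cfun f -> measurable_fun setT (fun x => normc2 (f x)).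
Proof. by move=> [m1 m2]; rewrite /normc2; mfun. Qed.

Lemma measurable_cfunB (f g : T -> R[i]) : measurable_cfun f -> measurable_cfun g ->
  measurable_cfun (fun x => f x - g x).
Proof.
move=> [m1 m2] [m3 m4]; split.
  by under eq_fun do rewrite Re_sub; exact: measurable_funB.
by under eq_fun do rewrite Im_sub; exact: measurable_funB.
Qed.

Lemma young_limit (X I : \bar R) (e : nat -> \bar R) : (0 <= I)%E -> e @ \oo --> 0%E ->
  (forall t : R, 0 < t -> \forall m \near \oo, (X <= (1 + t)%:E * I + (1 + t^-1)%:E * e m)%E) ->
  (X <= I)%E.
Proof.
move=> I0 ce H.
have {ce}H t : 0 < t -> (X <= (1 + t)%:E * I)%E.
  move=> t0.
  have cvg1 : ((1 + t)%:E * I + (1 + t^-1)%:E * e m)%E @[m --> \oo] --> ((1 + t)%:E * I + (1 + t^-1)%:E * 0)%E.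
    apply: cvgeD; first by rewrite mule0 fin_num_adde_defl.
      exact: cvg_cst.
    by apply: cvgeZl.
  by rewrite mule0 adde0 in cvg1; apply: (cvge_to_ge cvg1); exact: H.
move: I0 H; case: I => [r|_ _|//]; last by rewrite leey.
rewrite lee_fin => r0 H; apply/lee_addgt0Pr => e' e0.
have r1 : 0 < r + 1 by rewrite ltr_pwDr.
apply: (le_trans (H (e' / (r + 1)) _)); first by rewrite divr_gt0.
rewrite -EFinM -EFinD lee_fin mulrDl mul1r lerD2l mulrAC ler_pdivrMr//.
by rewrite ler_pM2l// lerDl.
Qed.

Variable om : T -> R.
Hypotheses (mom : measurable_fun setT om) (om0 : forall x, 0 <= om x).

Lemma weighted_young (f g : T -> R[i]) (t : R) : measurable_cfun f -> measurable_cfun g -> 0 < t ->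
  (\int[mu]_x (om x * normc2 (f x))%:E <= (1 + t)%:E * \int[mu]_x (om x * normc2 (g x))%:E +
     (1 + t^-1)%:E * \int[mu]_x (om x * normc2 (f x - g x))%:E)%E.
Proof.
move=> mf mg t0.
have mN h : measurable_cfun h -> measurable_fun setT (fun x => (om x * normc2 (h x))%:E).
  by move=> mh; have := measurable_normc2 mh => ?; mfun.
have N0 (c : R[i]) x : (0 <= (om x * normc2 c)%:E)%E by rewrite lee_fin mulr_ge0 ?normc2_ge0.
have t1 : 0 <= 1 + t by rewrite addr_ge0// ltW.
have t2 : 0 <= 1 + t^-1 by rewrite addr_ge0// invr_ge0 ltW.
have mfg := mN _ (measurable_cfunB mf mg).
rewrite -!ge0_integralZl; try (first [exact: measurableT | by rewrite lee_fin | exact: mN | exact: mfg | by move=> x _; exact: N0]).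
rewrite -ge0_integralD; try (first [exact: measurableT | by move=> x _; apply: mule_ge0; [rewrite lee_fin|exact: N0] |
  by apply: emeasurable_funM; [exact: measurable_cst|(exact: mN || exact: mfg)]]).
apply: ge0_le_integral; [by []|by move=> x _; exact: N0|exact: mN| |].
  by apply: emeasurable_funD; apply: emeasurable_funM; first [exact: measurable_cst | exact: mN | exact: mfg].
move=> x _; rewrite -!EFinM -EFinD lee_fin mulrCA [X in _ + X]mulrCA -mulrDr.
by apply: ler_wpM2l => //; exact: normc2_young.
Qed.

Lemma weighted_limit_le (F : nat -> T -> R[i]) (U : T -> R[i]) (X : \bar R) :
  (forall m, measurable_cfun (F m)) -> measurable_cfun U ->
  (\int[mu]_x (om x * normc2 (F m x - U x))%:E)%E @[m --> \oo] --> 0%E ->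
  (\forall m \near \oo, X <= \int[mu]_x (om x * normc2 (F m x))%:E)%E ->
  (X <= \int[mu]_x (om x * normc2 (U x))%:E)%E.
Proof.
move=> mF mU cF XF; apply: (young_limit _ cF).
  by apply: integral_ge0 => x _; rewrite lee_fin mulr_ge0 ?normc2_ge0.
by move=> t t0; apply: filterS XF => m XF; apply: (le_trans XF); exact: weighted_young.
Qed.

Lemma weighted_limit_ge (F : nat -> T -> R[i]) (U : T -> R[i]) (B : \bar R) :
  (forall m, measurable_cfun (F m)) -> measurable_cfun U ->
  (\int[mu]_x (om x * normc2 (F m x - U x))%:E)%E @[m --> \oo] --> 0%E ->
  (forall m, \int[mu]_x (om x * normc2 (F m x))%:E <= B)%E ->
  (\int[mu]_x (om x * normc2 (U x))%:E <= B)%E.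
Proof.
move=> mF mU cF FB; have B0 : (0 <= B)%E.
  by apply: le_trans (FB 0%N); apply: integral_ge0 => x _; rewrite lee_fin mulr_ge0 ?normc2_ge0.
apply: (young_limit B0 cF) => t t0; apply: nearW => m.
apply: (le_trans (weighted_young mU (mF m) t0)); apply: leeD.
  by apply: lee_wpmul2l => //; rewrite lee_fin addr_ge0// ltW.
apply: lee_wpmul2l; first by rewrite lee_fin addr_ge0// invr_ge0 ltW.
rewrite le_eqVlt; apply/orP; left; apply/eqP; apply: eq_integral => x _.
by rewrite /normc2 !Re_sub !Im_sub; congr (_ * _)%:E; ring.
Qed.

End weighted_limit.

(** * Frequency shells *)

Section cutoff.
Context {R : realType}.
Local Notation mR := (measurableTypeR R).
Variable psi : R -> R.

(* The smoothing function restricted to the k-th frequency shell, in the variable S = |xi|^2. *)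
Definition shellcut k (S : R) : R :=
  if (k.+1%:R^-1 <= Num.sqrt S) && (Num.sqrt S <= k.+1%:R) then psi (Num.sqrt S) else 0.

Hypotheses (cpsi : {within `]0, +oo[%classic, continuous psi})
  (psi0 : forall r : R, 0 < r -> 0 <= psi r).

Lemma cut_ge0 k S : 0 <= shellcut k S.
Proof.
rewrite /shellcut; case: ifP => // /andP[kS _]; apply: psi0.
by rewrite (lt_le_trans _ kS)// invr_gt0.
Qed.

Let psi_continuous r : 0 < r -> {for r, continuous psi}.
Proof.
move=> r0; have o : open (`]0, +oo[%classic : set R) by exact: interval_open.
have := cpsi; rewrite continuous_open_subspace// => /(_ r); apply.
by rewrite inE/= in_itv/= r0.
Qed.

Lemma measurable_cut k : measurable_fun setT (shellcut k : mR -> R).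
Proof.
have mp : measurable_fun setT (psi \_ (`]0, +oo[%classic : set R) : mR -> R).
  apply/(measurable_restrictT _ (measurable_itv `]0%R, +oo[)).
  apply: open_continuous_measurable_fun; first exact: interval_open.
  by move=> r; rewrite inE/= in_itv/= andbT; exact: psi_continuous.
pose f (S : mR) : R := (psi \_ (`]0, +oo[%classic : set R)) (Num.sqrt S).
have mf : measurable_fun setT f.
  by apply: (measurableT_comp mp); mfun.
rewrite (_ : shellcut k = fun S : mR => if (k.+1%:R^-1 <= Num.sqrt S) && (Num.sqrt S <= k.+1%:R) then f S else 0).
  by mfun.
apply/funext => S; rewrite /shellcut; case: ifP => // /andP[kS _].
by rewrite /f patchE mem_setE in_itv/= (lt_le_trans _ kS)// invr_gt0.
Qed.

Lemma cut_bound k : exists2 M : R, 0 <= M & forall S, shellcut k S <= M.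
Proof.
have k1 : k.+1%:R^-1 <= k.+1%:R :> R.
  by rewrite (@le_trans _ _ 1)// ?invf_le1// ler1n.
have cw : {within `[(k.+1%:R^-1 : R), k.+1%:R], continuous psi}.
  apply: continuous_in_subspaceT => r; rewrite inE/= in_itv/= => /andP[r1 _].
  by apply: psi_continuous; rewrite (lt_le_trans _ r1)// invr_gt0.
have [c cI H] := EVT_max k1 cw.
have c0 : 0 <= psi c.
  by apply: psi0; move: cI; rewrite in_itv/= => /andP[r1 _]; rewrite (lt_le_trans _ r1)// invr_gt0.
exists (psi c) => // S; rewrite /shellcut; case: ifP => // kS.
by apply: H; rewrite in_itv.
Qed.

Lemma le_cut k m S : (k <= m)%N -> shellcut k S <= shellcut m S.
Proof.
move=> km; rewrite {1}/shellcut; case: ifPn => [/andP[k1 k2]|_]; last exact: cut_ge0.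
rewrite /shellcut ifT//; apply/andP; split.
  by apply: le_trans k1; rewrite lef_pV2 ?posrE// ler_nat.
by apply: (le_trans k2); rewrite ler_nat.
Qed.

Lemma cut_cvg k (S_ : nat -> R) (S : R) : Num.sqrt S != k.+1%:R^-1 -> Num.sqrt S != k.+1%:R ->
  S_ @ \oo --> S -> shellcut k (S_ j) @[j --> \oo] --> shellcut k S.
Proof.
move=> S1 S2 cS.
have cs : Num.sqrt (S_ j) @[j --> \oo] --> Num.sqrt S.
  by apply: (continuous_cvg_seq (h := Num.sqrt)) => //; exact: sqrt_continuous.
rewrite /shellcut; have [l1|l1] := ltP (Num.sqrt S) k.+1%:R^-1.
  apply: cvg_near_cst; near=> j.
  by rewrite leNgt ifF//; apply/negbTE; rewrite negb_and negbK; apply/orP; left; near: j; exact: (cvgr_lt _ cs).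
have [l2|l2] := ltP k.+1%:R (Num.sqrt S).
  rewrite /=; apply: cvg_near_cst; near=> j.
  by rewrite ifF//; apply/negbTE; rewrite negb_and -!ltNge; apply/orP; right; near: j; exact: (cvgr_gt _ cs).
rewrite /=.
have {}l1 : k.+1%:R^-1 < Num.sqrt S by rewrite lt_neqAle eq_sym S1.
have {}l2 : Num.sqrt S < k.+1%:R by rewrite lt_neqAle S2.
apply: (@cvg_trans _ (psi (Num.sqrt (S_ j)) @[j --> \oo])).
  apply: near_eq_cvg; near=> j; rewrite ifT//; apply/andP; split; apply: ltW; near: j.
    exact: (cvgr_gt _ cs).
  exact: (cvgr_lt _ cs).
apply: (continuous_cvg_seq (h := psi)) => //; apply: psi_continuous.
by apply: lt_trans l1; rewrite invr_gt0.
Unshelve. all: by end_near. Qed.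

End cutoff.

Section representation.
Context {R : realType} (n : nat).
Local Notation V := (Rn R n).
Local Notation lebV := (@lebesgue_tuple R n).
Local Notation mR := (measurableTypeR R).

Lemma evolution_truncE (psi : R -> R) (v : V -> R[i]) k z :
  evolution_trunc psi v k z =
  Complex (fourier_cst n * osc_re lebV (@phase R n) (fun x => shellcut psi k (dot x x) * complex.Re (v x))
            (fun x => shellcut psi k (dot x x) * complex.Im (v x)) z)
   (fourier_cst n * osc_im lebV (@phase R n) (fun x => shellcut psi k (dot x x) * complex.Re (v x))
            (fun x => shellcut psi k (dot x x) * complex.Im (v x)) z).
Proof.
rewrite /evolution_trunc /cintegral; set D := [set _ | _].
have memD x : (x \in D) = (k.+1%:R^-1 <= Num.sqrt (dot x x)) && (Num.sqrt (dot x x) <= k.+1%:R).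
  by apply/idP/idP; rewrite inE.
rewrite 2!(Rintegral_mkcond _ D).
set f := (X in Complex (Rintegral _ _ X) _); set h := (X in Complex _ (Rintegral _ _ X)).
rewrite (_ : f = fun x => shellcut psi k (dot x x) * complex.Re (v x) * cos (phase z x) -
    shellcut psi k (dot x x) * complex.Im (v x) * sin (phase z x)); last first.
  apply/funext => x; rewrite /f patchE memD /= /shellcut /enorm /phase /expi.
  rewrite cosB sinB; case: ifP => _; last by rewrite !mul0r subr0.
  rewrite (sqr_sqrtr (dot_ge0 x)) sinN cosN /=; case: (v x) => a b /=; ring.
rewrite (_ : h = fun x => shellcut psi k (dot x x) * complex.Re (v x) * sin (phase z x) +
    shellcut psi k (dot x x) * complex.Im (v x) * cos (phase z x)); last first.
  apply/funext => x; rewrite /h patchE memD /= /shellcut /enorm /phase /expi.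
  rewrite cosB sinB; case: ifP => _; last by rewrite !mul0r addr0.
  rewrite (sqr_sqrtr (dot_ge0 x)) sinN cosN /=; case: (v x) => a b /=; ring.
by apply/eqP; rewrite eq_complex /=; apply/andP; split; apply/eqP; rewrite /osc_re /osc_im; ring.
Qed.

Lemma normc2_evolution (psi : R -> R) (v : V -> R[i]) k z :
  normc2 (evolution_trunc psi v k z) = fourier_cst n ^+ 2 *
   (osc_re lebV (@phase R n) (fun x => shellcut psi k (dot x x) * complex.Re (v x))
            (fun x => shellcut psi k (dot x x) * complex.Im (v x)) z ^+ 2 +
    osc_im lebV (@phase R n) (fun x => shellcut psi k (dot x x) * complex.Re (v x))
            (fun x => shellcut psi k (dot x x) * complex.Im (v x)) z ^+ 2).
Proof. by rewrite evolution_truncE /normc2 /= !exprMn mulrDr. Qed.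

Definition inball k (x : V) : R := if enorm x <= k%:R then 1 else 0.

Lemma fourier_truncE (u : V -> R[i]) k xi :
  fourier_trunc u k xi =
  Complex (fourier_cst n * osc_re lebV (fun xi x => -1 * dot x xi) (fun x => inball k x * complex.Re (u x))
            (fun x => inball k x * complex.Im (u x)) xi)
   (fourier_cst n * osc_im lebV (fun xi x => -1 * dot x xi) (fun x => inball k x * complex.Re (u x))
            (fun x => inball k x * complex.Im (u x)) xi).
Proof.
rewrite /fourier_trunc /cintegral; set D := [set _ | _].
have memD x : (x \in D) = (enorm x <= k%:R) by apply/idP/idP; rewrite inE.
rewrite 2!(Rintegral_mkcond _ D).
set f := (X in Complex (Rintegral _ _ X) _); set h := (X in Complex _ (Rintegral _ _ X)).
rewrite (_ : f = fun x => inball k x * complex.Re (u x) * cos (-1 * dot x xi) -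
    inball k x * complex.Im (u x) * sin (-1 * dot x xi)); last first.
  apply/funext => x; rewrite /f patchE memD /= /inball /expi !mulN1r.
  case: ifP => _; last by rewrite !mul0r subr0.
  by case: (u x) => a b /=; ring.
rewrite (_ : h = fun x => inball k x * complex.Re (u x) * sin (-1 * dot x xi) +
    inball k x * complex.Im (u x) * cos (-1 * dot x xi)); last first.
  apply/funext => x; rewrite /h patchE memD /= /inball /expi !mulN1r.
  case: ifP => _; last by rewrite !mul0r addr0.
  by case: (u x) => a b /=; ring.
by apply/eqP; rewrite eq_complex /=; apply/andP; split; apply/eqP; rewrite /osc_re /osc_im; ring.
Qed.

Lemma fourier_cst_gt0 : 0 < fourier_cst n :> R.
Proof. by rewrite invr_gt0 exprn_gt0// sqrtr_gt0 mulr_gt0// pi_gt0. Qed.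

Lemma fourier_cst_sq : fourier_cst n ^+ 2 * (2 * pi) ^+ n = 1 :> R.
Proof.
have p0 : 0 < (2 * pi : R) by rewrite mulr_gt0// pi_gt0.
rewrite /fourier_cst -exprVn -exprM mulnC exprM -exprMn exprVn sqr_sqrtr ?ltW//.
by rewrite mulVf ?expr1n// gt_eqF.
Qed.

Lemma measurable_evolution_trunc (psi : R -> R) (v : V -> R[i]) k :
  measurable_fun setT (shellcut psi k : mR -> R) -> measurable_cfun v ->
  measurable_cfun (evolution_trunc psi v k).
Proof.
move=> mc [m1 m2].
have mcd : measurable_fun setT (fun x : V => shellcut psi k (dot x x)).
  by apply: (measurableT_comp mc); mfun.
have mp := @measurable_phase R n.
have m3 := measurable_funM mcd m1; have m4 := measurable_funM mcd m2.
split; under eq_fun do rewrite evolution_truncE /=.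
  by apply: measurable_funM; [exact: measurable_cst|exact: measurable_osc_re].
by apply: measurable_funM; [exact: measurable_cst|exact: measurable_osc_im].
Qed.

Lemma measurable_inball k : measurable_fun setT (inball k).
Proof. by rewrite /inball /enorm; mfun. Qed.

Lemma measurable_fourier_trunc (u : V -> R[i]) k : measurable_cfun u ->
  measurable_cfun (fourier_trunc u k).
Proof.
move=> [m1 m2].
have mi := measurable_inball k.
have mp : measurable_fun setT (fun z : V * V => -1 * dot z.2 z.1) by mfun.
have m3 := measurable_funM mi m1; have m4 := measurable_funM mi m2.
split; under eq_fun do rewrite fourier_truncE /=.
  apply: measurable_funM; [exact: measurable_cst|].
  exact: (@measurable_osc_re _ _ _ _ _ _ (fun xi x : V => -1 * dot x xi)).
apply: measurable_funM; [exact: measurable_cst|].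
exact: (@measurable_osc_im _ _ _ _ _ _ (fun xi x : V => -1 * dot x xi)).
Qed.

End representation.

Section osc_linear.
Context {R : realType} dX dY (X : measurableType dX) (Y : measurableType dY)
  (nu : {sigma_finite_measure set Y -> \bar R}).
Variable th : X -> Y -> R.
Hypothesis mth : measurable_fun setT (fun z : X * Y => th z.1 z.2).

Definition absint (a : Y -> R) := measurable_fun setT a /\ (\int[nu]_y (`|a y|)%:E < +oo)%E.

Lemma absint_integrable a (h : Y -> R) : absint a -> measurable_fun setT h ->
  (forall y, `|h y| <= 1) -> nu.-integrable setT (EFin \o (fun y => a y * h y)).
Proof.
move=> [ma ia] mh h1; have ia' : nu.-integrable setT (EFin \o a).
  by apply/integrableP; split; [exact/measurable_EFinP|under eq_integral do rewrite /=].
apply: (le_integrable measurableT _ _ ia').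
  by apply/measurable_EFinP; apply: measurable_funM.
by move=> y _ /=; rewrite lee_fin normrM ler_piMr.
Qed.

Let mthx x : measurable_fun setT (th x).
Proof. exact: (measurableT_comp mth (@pair1_measurable _ _ _ _ x)). Qed.

Lemma osc_cos_integrable a x : absint a -> nu.-integrable setT (EFin \o (fun y => a y * cos (th x y))).
Proof.
move=> ha; apply: absint_integrable => //; last by move=> y; exact: cos_max.
by apply: (measurableT_comp (@measurable_cos R)); exact: mthx.
Qed.

Lemma osc_sin_integrable a x : absint a -> nu.-integrable setT (EFin \o (fun y => a y * sin (th x y))).
Proof.
move=> ha; apply: absint_integrable => //; last by move=> y; exact: sin_max.
by apply: (measurableT_comp (@measurable_sin R)); exact: mthx.
Qed.

Lemma osc_reE a b x : absint a -> absint b ->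
  osc_re nu th a b x = \int[nu]_y (a y * cos (th x y)) - \int[nu]_y (b y * sin (th x y)).
Proof.
move=> ha hb; rewrite -RintegralB//; first exact: osc_cos_integrable.
exact: osc_sin_integrable.
Qed.

Lemma osc_imE a b x : absint a -> absint b ->
  osc_im nu th a b x = \int[nu]_y (a y * sin (th x y)) + \int[nu]_y (b y * cos (th x y)).
Proof.
move=> ha hb; rewrite -RintegralD//; first exact: osc_sin_integrable.
exact: osc_cos_integrable.
Qed.

Lemma absintB a1 a2 : absint a1 -> absint a2 -> absint (fun y => a1 y - a2 y).
Proof.
move=> [m1 i1] [m2 i2]; split; first exact: measurable_funB.
apply: (@le_lt_trans _ _ (\int[nu]_y ((`|a1 y|)%:E + (`|a2 y|)%:E))%E).
  apply: ge0_le_integral; [by []|by []| | |].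
  - by apply/measurable_EFinP; apply: measurableT_comp => //; exact: measurable_funB.
  - by apply: emeasurable_funD; apply/measurable_EFinP; apply: measurableT_comp.
  - by move=> y _; rewrite -EFinD lee_fin ler_normB.
rewrite ge0_integralD//; [exact: lte_add_pinfty| |];
  by apply/measurable_EFinP; apply: measurableT_comp.
Qed.

Lemma osc_reB a1 a2 b1 b2 x : absint a1 -> absint a2 -> absint b1 -> absint b2 ->
  osc_re nu th (fun y => a1 y - a2 y) (fun y => b1 y - b2 y) x =
  osc_re nu th a1 b1 x - osc_re nu th a2 b2 x.
Proof.
move=> A1 A2 B1 B2; rewrite !osc_reE//; try exact: absintB.
under eq_Rintegral do rewrite mulrBl.
rewrite RintegralB//; [|exact: osc_cos_integrable|exact: osc_cos_integrable].
under [X in _ - X = _]eq_Rintegral do rewrite mulrBl.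
rewrite RintegralB//; [|exact: osc_sin_integrable|exact: osc_sin_integrable].
ring.
Qed.

Lemma osc_imB a1 a2 b1 b2 x : absint a1 -> absint a2 -> absint b1 -> absint b2 ->
  osc_im nu th (fun y => a1 y - a2 y) (fun y => b1 y - b2 y) x =
  osc_im nu th a1 b1 x - osc_im nu th a2 b2 x.
Proof.
move=> A1 A2 B1 B2; rewrite !osc_imE//; try exact: absintB.
under eq_Rintegral do rewrite mulrBl.
rewrite RintegralB//; [|exact: osc_sin_integrable|exact: osc_sin_integrable].
under [X in _ + X = _]eq_Rintegral do rewrite mulrBl.
rewrite RintegralB//; [|exact: osc_cos_integrable|exact: osc_cos_integrable].
ring.
Qed.

Lemma osc_im0E a x : osc_im nu th a (fun=> 0) x = \int[nu]_y (a y * sin (th x y)).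
Proof. by apply: eq_Rintegral => y _; rewrite mul0r addr0. Qed.

Lemma osc_re0E a x : osc_re nu th a (fun=> 0) x = \int[nu]_y (a y * cos (th x y)).
Proof. by apply: eq_Rintegral => y _; rewrite mul0r subr0. Qed.

Lemma absint0 : absint (fun=> 0).
Proof.
split; first exact: measurable_cst.
by under eq_integral do rewrite normr0; rewrite integral0 ltry.
Qed.

Lemma Rintegral_abs_le a (h : Y -> R) : absint a -> measurable_fun setT h -> (forall y, `|h y| <= 1) ->
  `|\int[nu]_y (a y * h y)| <= fine (\int[nu]_y (`|a y|)%:E)%E.
Proof.
move=> ha mh h1; have ic := absint_integrable ha mh h1.
apply: (le_trans (le_normr_Rintegral measurableT ic)).
apply: fine_le.
- by apply: integrable_fin_num => //; exact: integrable_norm.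
- by rewrite ge0_fin_numE ?integral_ge0//; case: ha.
- case: ha => ma _; apply: ge0_le_integral => //.
  + by apply/measurable_EFinP; apply: measurableT_comp => //; apply: measurable_funM.
  + by apply/measurable_EFinP; apply: measurableT_comp.
  + by move=> y _; rewrite lee_fin normrM ler_piMr.
Qed.

End osc_linear.

(** * Test functions in the lower dimension *)

Section test_function.
Context {R : realType} (n : nat).
Local Notation V := (Rn R n).
Local Notation leb := (@lebesgue_tuple R n).
Variables (v : V -> R) (de : R).
Hypotheses (mv : measurable_fun setT v) (v0 : forall x, 0 <= v x)
  (iv : (\int[leb]_x (v x)%:E < +oo)%E) (iv2 : (\int[leb]_x (v x ^+ 2)%:E < +oo)%E)
  (de0 : 0 < de).

Let th (x eta : V) : R := 1 * dot eta x.
Let mth : measurable_fun setT (fun z : V * V => th z.1 z.2).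
Proof. by rewrite /th; mfun. Qed.

Let av : absint leb v.
Proof.
by split=> //; under eq_integral do rewrite ger0_norm//.
Qed.
Let a0 : absint leb (fun=> 0) := absint0 leb.
Let cst : R := fourier_cst n.
Let cst0 : 0 < cst. Proof. exact: fourier_cst_gt0. Qed.

Let u1 (x : V) : R := cst * osc_re leb th v (fun=> 0) x.
Let u2 (x : V) : R := cst * osc_im leb th v (fun=> 0) x.
Let e (x : V) : R := expR (- (de * l1norm x)).

Let mu1 : measurable_fun setT u1.
Proof. by apply: measurable_funM; [exact: measurable_cst|exact: measurable_osc_re]. Qed.
Let mu2 : measurable_fun setT u2.
Proof. by apply: measurable_funM; [exact: measurable_cst|exact: measurable_osc_im]. Qed.
Let me : measurable_fun setT e.
Proof. by rewrite /e; have := @measurable_l1norm R n => ?; mfun. Qed.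
Let e0 x : 0 <= e x. Proof. exact: expR_ge0. Qed.
Let e1 x : e x <= 1.
Proof.
rewrite -expR0 ler_expR oppr_le0 mulr_ge0 ?(ltW de0)//.
by apply: sumr_ge0.
Qed.
Let ie : (\int[leb]_x (e x)%:E < +oo)%E.
Proof. by rewrite integral_expl1// ltry. Qed.

Let mthx x : measurable_fun setT (th x).
Proof. exact: (measurableT_comp mth (@pair1_measurable _ _ _ _ x)). Qed.

Let u_le : exists2 M : R, 0 <= M & forall x, `|u1 x| <= M /\ `|u2 x| <= M.
Proof.
exists (cst * fine (\int[leb]_y (`|v y|)%:E)%E).
  by rewrite mulr_ge0 ?(ltW cst0)// fine_ge0// integral_ge0.
move=> x; rewrite /u1 /u2 !normrM (ger0_norm (ltW cst0)) osc_re0E osc_im0E.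
split; rewrite ler_pM2l//; apply: Rintegral_abs_le => //.
- by apply: (measurableT_comp (@measurable_cos R)); exact: mthx.
- by move=> y; exact: cos_max.
- by apply: (measurableT_comp (@measurable_sin R)); exact: mthx.
- by move=> y; exact: sin_max.
Qed.

(* The inverse Fourier transform of v damped by e^(-de |x|_1); its Fourier
   transform test_out is the convolution of v with a Poisson kernel. *)
Definition test_in (x : V) : R[i] := Complex (e x * u1 x) (e x * u2 x).

Definition test_out (xi : V) : R := cst ^+ 2 * \int[leb]_eta (v eta * pkn de (tsub eta xi)).

Let absint_eu (u : V -> R) : measurable_fun setT u -> (exists2 M : R, 0 <= M & forall x, `|u x| <= M) ->
  absint leb (fun x => e x * u x).
Proof.
move=> mu [M M0 uM]; split; first exact: measurable_funM.
apply: (@le_lt_trans _ _ (\int[leb]_x ((e x)%:E * M%:E))%E).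
  apply: ge0_le_integral; [by []|by []| | |].
  - by apply/measurable_EFinP; apply: measurableT_comp => //; exact: measurable_funM.
  - by apply: emeasurable_funM; [exact/measurable_EFinP|exact: measurable_cst].
  - by move=> x _; rewrite -EFinM lee_fin normrM ger0_norm// ler_wpM2l.
rewrite ge0_integralZr; [|by []|exact/measurable_EFinP|by move=> x _; rewrite lee_fin|by rewrite lee_fin].
by rewrite muleC lte_mul_pinfty// lee_fin.
Qed.

Let au1 : absint leb (fun x => e x * u1 x).
Proof. by apply: absint_eu => //; have [M M0 H] := u_le; exists M => // x; have [] := H x. Qed.

Let au2 : absint leb (fun x => e x * u2 x).
Proof. by apply: absint_eu => //; have [M M0 H] := u_le; exists M => // x; have [] := H x. Qed.

Lemma measurable_test_in : measurable_cfun test_in.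
Proof. by split => /=; apply: measurable_funM. Qed.

Lemma energy_test_in : (energy leb test_in <= \int[leb]_x (v x ^+ 2)%:E)%E.
Proof.
have pl := plancherel_le (or_introl (erefl _)) mv a0.1 av.2 a0.2.
apply: (@le_trans _ _ ((cst ^+ 2)%:E * \int[leb]_x (osc_re leb th v (fun=> 0) x ^+ 2 + osc_im leb th v (fun=> 0) x ^+ 2)%:E)%E).
  have mre : measurable_fun setT (osc_re leb th v (fun=> 0)) by exact: measurable_osc_re.
  have mim : measurable_fun setT (osc_im leb th v (fun=> 0)) by exact: measurable_osc_im.
  rewrite -ge0_integralZl; [|by []|by mfun|by move=> x _; rewrite lee_fin addr_ge0 ?sqr_ge0|by rewrite lee_fin sqr_ge0].
  apply: ge0_le_integral; [by []|by move=> x _; rewrite lee_fin normc2_ge0| | |].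
  - by apply/measurable_EFinP; exact: measurable_normc2 measurable_test_in.
  - by mfun.
  - move=> x _; rewrite -EFinM lee_fin /normc2 /= !exprMn -mulrDr -mulrDr.
    rewrite -[leRHS]mul1r; apply: ler_wpM2r; first by rewrite mulr_ge0 ?sqr_ge0 ?addr_ge0 ?sqr_ge0.
    by rewrite expr_le1.
apply: (@le_trans _ _ ((cst ^+ 2)%:E * (((2 * pi) ^+ n)%:E * \int[leb]_x (v x ^+ 2 + 0 ^+ 2)%:E))%E).
  by apply: lee_wpmul2l; [rewrite lee_fin sqr_ge0|exact: pl].
rewrite muleA -EFinM /cst fourier_cst_sq mul1e.
by under eq_integral do rewrite expr0n addr0.
Qed.

Lemma L2_test_in : L2 leb test_in.
Proof. by split; [exact: measurable_test_in|exact: le_lt_trans energy_test_in iv2]. Qed.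

Let fub (xi : V) c :
  \int[leb]_x (e x * \int[leb]_eta (v eta * cos (dot eta x - dot x xi + c))) =
  cos c * \int[leb]_eta (v eta * pkn de (tsub eta xi)).
Proof.
have mpk := @measurable_pkn R de n.
transitivity (\int[leb]_x \int[leb]_eta (e x * (v eta * cos (dot eta x - dot x xi + c)))).
  apply: eq_Rintegral => x _; rewrite RintegralZl//.
  by apply: absint_integrable => //; [mfun|move=> y; exact: cos_max].
rewrite (@Rintegral_fubini _ _ _ _ _ _ _ _ e v) //; last 2 first.
- by mfun.
- move=> x y; rewrite !normrM (ger0_norm (e0 x)) (ger0_norm (v0 y)) ler_wpM2l//.
  by rewrite ler_piMr// cos_max.
have ip : leb.-integrable setT (EFin \o (fun eta => v eta * pkn de (tsub eta xi))).
  have iv' : leb.-integrable setT (EFin \o v).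
    by apply/integrableP; split; [exact/measurable_EFinP|under eq_integral do rewrite /= ger0_norm//].
  have iM : leb.-integrable setT (fun y => (pk de 0 ^+ n)%:E * (EFin \o v) y)%E by apply: integrableZl.
  apply: (le_integrable measurableT _ _ iM).
    apply/measurable_EFinP; apply: measurable_funM => //.
    by apply: (measurableT_comp mpk); apply: measurable_fun_tsub; mfun.
  move=> y _ /=; rewrite lee_fin !normrM mulrC; apply: ler_wpM2r => //.
  by rewrite !ger0_norm ?pkn_ge0 ?exprn_ge0 ?pk_ge0// pkn_le0.
rewrite -RintegralZl//; apply: eq_Rintegral => eta _.
have -> : cos c * (v eta * pkn de (tsub eta xi)) = v eta * fine ((cos c * pkn de (tsub eta xi))%:E) by rewrite /=; ring.
rewrite -poisson_cos//.
have ic : leb.-integrable setT (EFin \o (fun x => e x * cos (dot (tsub eta xi) x + c))).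
  apply: absint_integrable; [|by mfun|by move=> y; exact: cos_max].
  by split=> //; under eq_integral do rewrite ger0_norm//.
rewrite -/(Rintegral _ _ _) -RintegralZl//; apply: eq_Rintegral => x _.
by rewrite mulrCA dot_tsubl (dotC xi).
Qed.

Let oscE c xi x : \int[leb]_eta (v eta * cos (dot eta x - dot x xi + c)) =
    cos (dot x xi - c) * (cst^-1 * u1 x) + sin (dot x xi - c) * (cst^-1 * u2 x).
Proof.
rewrite /u1 /u2 !mulKf ?gt_eqF// osc_re0E osc_im0E.
have ic : leb.-integrable setT (EFin \o (fun y => v y * cos (th x y))) by exact: osc_cos_integrable.
have isn : leb.-integrable setT (EFin \o (fun y => v y * sin (th x y))) by exact: osc_sin_integrable.
rewrite -!RintegralZl// -RintegralD//; first last.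
- by have := integrableZl measurableT (sin (dot x xi - c)) isn.
- by have := integrableZl measurableT (cos (dot x xi - c)) ic.
apply: eq_Rintegral => y _; rewrite /th mul1r.
by rewrite (_ : _ - _ + c = dot y x - (dot x xi - c)) ?cosB; [ring|ring].
Qed.

Let fub' xi c :
  cst^-1 * \int[leb]_x (cos (dot x xi - c) * (e x * u1 x) + sin (dot x xi - c) * (e x * u2 x)) =
  cos c * \int[leb]_eta (v eta * pkn de (tsub eta xi)).
Proof.
have i1 : leb.-integrable setT (EFin \o (fun x => e x * u1 x * cos (dot x xi - c))).
  by apply: absint_integrable => //; [mfun|move=> x; exact: cos_max].
have i2 : leb.-integrable setT (EFin \o (fun x => e x * u2 x * sin (dot x xi - c))).
  by apply: absint_integrable => //; [mfun|move=> x; exact: sin_max].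
rewrite -fub -RintegralZl//; last first.
  have := integrableD measurableT i1 i2; apply: eq_integrable => // x _ /=.
  by rewrite -EFinD; congr EFin; ring.
apply: eq_Rintegral => x _; rewrite oscE; ring.
Qed.

Lemma fourier_test_in xi :
  cst * osc_re leb (fun xi x => -1 * dot x xi) (fun x => e x * u1 x) (fun x => e x * u2 x) xi = test_out xi
  /\ cst * osc_im leb (fun xi x => -1 * dot x xi) (fun x => e x * u1 x) (fun x => e x * u2 x) xi = 0.
Proof.
have H c : \int[leb]_x (cos (dot x xi - c) * (e x * u1 x) + sin (dot x xi - c) * (e x * u2 x)) =
    cst * (cos c * \int[leb]_eta (v eta * pkn de (tsub eta xi))).
  by rewrite -fub' mulrA divff ?mul1r// gt_eqF.
split.
  have := H 0; rewrite cos0 mul1r => H0.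
  rewrite /test_out expr2 -mulrA -H0; congr (_ * _); apply: eq_Rintegral => x _.
  by rewrite subr0 mulN1r cosN sinN; ring.
have := H (- (pi / 2)); rewrite cosN cos_pihalf mul0r mulr0 => H0.
rewrite -(mulr0 cst) -[in RHS]H0; congr (_ * _); apply: eq_Rintegral => x _.
rewrite opprK mulN1r cosN sinN (cosD _ (pi / 2)) (sinD _ (pi / 2)) cos_pihalf sin_pihalf; ring.
Qed.

Lemma measurable_test_out : measurable_fun setT test_out.
Proof.
apply: measurable_funM; first exact: measurable_cst.
apply: (@measurable_Rintegral2 _ _ _ _ _ _ (fun xi eta : V => v eta * pkn de (tsub eta xi))).
apply: measurable_funM; first by mfun.
by apply: (measurableT_comp (@measurable_pkn R de n)); apply: measurable_fun_tsub; mfun.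
Qed.

Lemma test_out_ge0 xi : 0 <= test_out xi.
Proof.
by rewrite mulr_ge0 ?sqr_ge0//; apply: Rintegral_ge0 => eta _; rewrite mulr_ge0 ?pkn_ge0.
Qed.

Lemma test_out_fin : (\int[leb]_xi (test_out xi)%:E < +oo)%E.
Proof.
have f0 x y : (0 <= (v y * pkn de (tsub y x))%:E)%E by rewrite lee_fin mulr_ge0 ?pkn_ge0.
have mf : measurable_fun setT (fun z : V * V => (v z.2 * pkn de (tsub z.2 z.1))%:E).
  apply/measurable_EFinP; apply: measurable_funM; first by mfun.
  by apply: (measurableT_comp (@measurable_pkn R de n)); apply: measurable_fun_tsub; mfun.
have fE xi : (\int[leb]_eta (v eta * pkn de (tsub eta xi))%:E <= (pk de 0 ^+ n)%:E * \int[leb]_x (v x)%:E)%E.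
  rewrite -ge0_integralZl; [|by []|by mfun|by move=> x _; rewrite lee_fin|by rewrite lee_fin exprn_ge0// pk_ge0].
  apply: ge0_le_integral; [by []|by []| |by mfun|].
    exact: (measurableT_comp mf (@pair1_measurable _ _ _ _ xi)).
  by move=> y _; rewrite -EFinM lee_fin mulrC; apply: ler_wpM2r => //; exact: pkn_le0.
have E : (\int[leb]_xi \int[leb]_eta (v eta * pkn de (tsub eta xi))%:E = ((2 * pi) ^+ n)%:E * \int[leb]_x (v x)%:E)%E.
  rewrite (tonelli2 (fun xi eta : V => (v eta * pkn de (tsub eta xi))%:E)) //.
  rewrite -ge0_integralZl; [|by []|by mfun|by move=> x _; rewrite lee_fin|by rewrite lee_fin exprn_ge0// mulr_ge0// pi_ge0].
  apply: eq_integral => eta _; under eq_integral do rewrite EFinM pkn_tsubC.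
  have mpk := @measurable_pkn R de n.
  rewrite ge0_integralZl; [|by []| |by move=> x _; rewrite lee_fin pkn_ge0|by rewrite lee_fin].
    rewrite (ge0_integral_tsub (f := fun x => (pkn de x)%:E)); [|by mfun|by move=> x; rewrite lee_fin pkn_ge0].
    by rewrite pkn_integral// muleC.
  apply/measurable_EFinP; apply: (measurableT_comp mpk); apply: measurable_fun_tsub; mfun.
have iE xi : (\int[leb]_eta (v eta * pkn de (tsub eta xi)))%:E = (\int[leb]_eta (v eta * pkn de (tsub eta xi))%:E)%E.
  rewrite /Rintegral fineK// ge0_fin_numE ?integral_ge0//.
  by rewrite (le_lt_trans (fE xi))// lte_mul_pinfty// lee_fin exprn_ge0// pk_ge0.
rewrite /test_out; under eq_integral do rewrite EFinM iE.
rewrite ge0_integralZl; [|by []| |by move=> x _; exact: integral_ge0|by rewrite lee_fin sqr_ge0].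
  by rewrite E muleA -EFinM lte_mul_pinfty// lee_fin mulr_ge0 ?sqr_ge0// exprn_ge0// mulr_ge0// pi_ge0.
by apply: (@measurable_integral2 _ _ _ _ R _ (fun xi eta : V => (v eta * pkn de (tsub eta xi))%:E)).
Qed.

Let i01 k (x : V) : inball k x = 0 \/ inball k x = 1.
Proof. by rewrite /inball; case: ifP; [right|left]. Qed.

Let absint_inball k a : absint leb a -> absint leb (fun x => inball k x * a x).
Proof.
move=> [ma ia]; have mi := @measurable_inball R n k.
have mia := measurable_funM mi ma.
split=> //; apply: le_lt_trans ia; apply: ge0_le_integral; [by []|by []| | |].
- by apply/measurable_EFinP; apply: measurableT_comp.
- by apply/measurable_EFinP; apply: measurableT_comp.
- by move=> x _; rewrite lee_fin; have [->|->] := i01 k x; rewrite ?mul0r ?normr0 ?mul1r.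
Qed.

Let mQ : measurable_fun setT (fun x => (e x * u1 x) ^+ 2 + (e x * u2 x) ^+ 2).
Proof. by have m1 := au1.1; have m2 := au2.1; apply: measurable_funD; apply: measurable_funX. Qed.

Let plE a b : absint leb a -> absint leb b ->
  ((cst ^+ 2)%:E * \int[leb]_xi (osc_re leb (fun xi x => -1 * dot x xi) a b xi ^+ 2 +
      osc_im leb (fun xi x => -1 * dot x xi) a b xi ^+ 2)%:E <= \int[leb]_x (a x ^+ 2 + b x ^+ 2)%:E)%E.
Proof.
move=> [ma ia] [mb ib].
have pl := plancherel_le (or_intror (erefl (-1 : R))) ma mb ia ib.
apply: (@le_trans _ _ ((cst ^+ 2)%:E * (((2 * pi) ^+ n)%:E * \int[leb]_x (a x ^+ 2 + b x ^+ 2)%:E))%E).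
  by apply: lee_wpmul2l; [rewrite lee_fin sqr_ge0|exact: pl].
by rewrite muleA -EFinM /cst fourier_cst_sq mul1e.
Qed.

Let mosc a b : absint leb a -> absint leb b ->
  measurable_fun setT (fun xi => (osc_re leb (fun xi x => -1 * dot x xi) a b xi ^+ 2 +
      osc_im leb (fun xi x => -1 * dot x xi) a b xi ^+ 2)%:E).
Proof.
move=> [ma ia] [mb ib]; have mp : measurable_fun setT (fun z : V * V => -1 * dot z.2 z.1) by mfun.
apply/measurable_EFinP; apply: measurable_funD; apply: measurable_funX.
  exact: (@measurable_osc_re _ _ _ _ _ _ (fun xi x : V => -1 * dot x xi)).
exact: (@measurable_osc_im _ _ _ _ _ _ (fun xi x : V => -1 * dot x xi)).
Qed.

Let tailE k : (energy leb (fun xi => (fourier_trunc test_in k xi - (test_out xi)%:C%C)%R) <=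
  \int[leb]_x ((1 - inball k x) * ((e x * u1 x) ^+ 2 + (e x * u2 x) ^+ 2))%:E)%E.
Proof.
pose a x := inball k x * (e x * u1 x) - e x * u1 x.
pose b x := inball k x * (e x * u2 x) - e x * u2 x.
have A : absint leb a := absintB (absint_inball k au1) au1.
have B : absint leb b := absintB (absint_inball k au2) au2.
have mp : measurable_fun setT (fun z : V * V => -1 * dot z.2 z.1) by mfun.
rewrite [leRHS](_ : _ = \int[leb]_x (a x ^+ 2 + b x ^+ 2)%:E)%E; last first.
  apply: eq_integral => x _; congr EFin; rewrite /a /b.
  by have [->|->] := i01 k x; ring.
apply: le_trans (plE A B); rewrite -ge0_integralZl; [|by []|exact: mosc|by move=> x _; rewrite lee_fin addr_ge0 ?sqr_ge0|by rewrite lee_fin sqr_ge0].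
rewrite le_eqVlt; apply/orP; left; apply/eqP; apply: eq_integral => xi _.
have [f1 f2] := fourier_test_in xi.
have -> : osc_re leb (fun xi x => -1 * dot x xi) a b xi =
    osc_re leb (fun xi x => -1 * dot x xi) (fun x => inball k x * (e x * u1 x)) (fun x => inball k x * (e x * u2 x)) xi
    - osc_re leb (fun xi x => -1 * dot x xi) (fun x => e x * u1 x) (fun x => e x * u2 x) xi.
  exact: (osc_reB mp xi (absint_inball k au1) au1 (absint_inball k au2) au2).
have -> : osc_im leb (fun xi x => -1 * dot x xi) a b xi =
    osc_im leb (fun xi x => -1 * dot x xi) (fun x => inball k x * (e x * u1 x)) (fun x => inball k x * (e x * u2 x)) xi
    - osc_im leb (fun xi x => -1 * dot x xi) (fun x => e x * u1 x) (fun x => e x * u2 x) xi.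
  exact: (osc_imB mp xi (absint_inball k au1) au1 (absint_inball k au2) au2).
rewrite -EFinM; congr EFin; rewrite /normc2 Re_sub Im_sub fourier_truncE /= -f1.
rewrite mulrDr -!exprMn !mulrBr f2 subr0 -/cst; congr (_ + _).
Qed.

Let energy_test_out : (energy leb (fun xi => (test_out xi)%:C%C) <= \int[leb]_x (v x ^+ 2)%:E)%E.
Proof.
apply: le_trans energy_test_in; apply: le_trans (plE au1 au2).
rewrite -ge0_integralZl; [|by []|exact: mosc|by move=> x _; rewrite lee_fin addr_ge0 ?sqr_ge0|by rewrite lee_fin sqr_ge0].
rewrite le_eqVlt; apply/orP; left; apply/eqP; apply: eq_integral => xi _.
have [f1 f2] := fourier_test_in xi.
by rewrite -EFinM /normc2 /= -f1 -f2 mulrDr -!exprMn.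
Qed.

Lemma L2_test_out : L2 leb (fun xi => (test_out xi)%:C%C).
Proof.
split; last exact: le_lt_trans energy_test_out iv2.
by split; [exact: measurable_test_out|exact: measurable_cst].
Qed.

Lemma is_fourier_test : is_fourier test_in (fun xi => (test_out xi)%:C%C).
Proof.
split; first exact: L2_test_out.
pose Q x := (e x * u1 x) ^+ 2 + (e x * u2 x) ^+ 2.
have Q0 x : 0 <= Q x by rewrite addr_ge0 ?sqr_ge0.
have cT : (\int[leb]_x ((1 - inball k x) * Q x)%:E)%E @[k --> \oo] --> (\int[leb]_x (0 : R)%:E)%E.
  apply: (@dominated_cvg_real _ _ _ leb (fun k x => (1 - inball k x) * Q x) (fun=> 0) Q).
  - move=> k; apply: measurable_funM => //; apply: measurable_funB; first exact: measurable_cst.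
    exact: measurable_inball.
  - exact: measurable_cst.
  - exact: mQ.
  - apply: aeW => x; apply: cvg_near_cst; near=> k.
    rewrite /inball ifT ?subrr ?mul0r//.
    by near: k; exact: nbhs_infty_ger.
  - move=> k x; have [->|->] := i01 k x; first by rewrite subr0 mul1r ger0_norm.
    by rewrite subrr mul0r normr0.
  - exact: le_lt_trans energy_test_in iv2.
rewrite integral0 in cT; apply: (squeeze_cvge _ (cvg_cst 0%E) cT).
apply: nearW => k; apply/andP; split; last exact: tailE.
by apply: integral_ge0 => x _; rewrite lee_fin normc2_ge0.
Unshelve. all: by end_near. Qed.

End test_function.

Section approximate_identity.
Context {R : realType} (n : nat).
Local Notation V := (Rn R n).
Local Notation leb := (@lebesgue_tuple R n).

Lemma pkn_tscale (de : R) (x : V) : 0 < de -> de ^+ n * pkn de (tscale de x) = pkn 1 x.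
Proof.
move=> de0; rewrite -[X in _ ^+ X](card_ord n) -prodr_const -big_split /=.
apply: eq_bigr => i _; rewrite tnth_mktuple /pk; field.
by rewrite !gt_eqF// ?ltr_pwDl// ?exprn_gt0 ?sqr_ge0// mulr_gt0.
Qed.

Variables (h v : V -> R) (M : R) (de_ : nat -> R).
Hypotheses (mh : measurable_fun setT h) (hM : forall x, `|h x| <= M)
  (ih : (\int[leb]_x (`|h x|)%:E < +oo)%E)
  (mv : measurable_fun setT v) (v0 : forall x, 0 <= v x)
  (iv : (\int[leb]_x (v x)%:E < +oo)%E)
  (de0 : forall j, 0 < de_ j)
  (hcvg : {ae leb, forall y, forall x, h (tadd (tscale (de_ j) x) y) @[j --> \oo] --> h y}).

Let M0 : 0 <= M. Proof. exact: le_trans (normr_ge0 _) (hM [tuple 0 | i < n]). Qed.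

Let h0 x : 0 <= h x + M.
Proof. by rewrite -lerBlDr sub0r; have := hM x; rewrite ler_norml => /andP[]. Qed.

Let hM2 x : h x + M <= M + M.
Proof. by rewrite lerD2r; have := hM x; rewrite ler_norml => /andP[]. Qed.

Let mpk de := @measurable_pkn R de n.

Let S (de : R) (y : V) : \bar R := (\int[leb]_x ((h (tadd (tscale de x) y) + M) * pkn 1 x)%:E)%E.

Let measurable_shift de y : measurable_fun setT (fun x : V => h (tadd (tscale de x) y)).
Proof. by apply: (measurableT_comp mh); mfunv. Qed.

Let mSE de y : measurable_fun setT (fun x : V => ((h (tadd (tscale de x) y) + M) * pkn 1 x)%:E).
Proof.
apply/measurable_EFinP; apply: measurable_funM; last exact: mpk.
by apply: measurable_funD; [exact: measurable_shift|exact: measurable_cst].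
Qed.

Let mpkE c : measurable_fun setT (fun x : V => (c%:E * (pkn 1 x)%:E)%E).
Proof. by apply: emeasurable_funM; [exact: measurable_cst|apply/measurable_EFinP; exact: mpk]. Qed.

Let S_fin de y : 0 < de -> (S de y \is a fin_num).
Proof.
move=> d0; have mpk1 := mpk 1; have ms := measurable_shift de y.
rewrite ge0_fin_numE; last by apply: integral_ge0 => x _; rewrite lee_fin mulr_ge0 ?pkn_ge0.
apply: (@le_lt_trans _ _ ((M + M)%:E * \int[leb]_x (pkn 1 x)%:E)%E); last first.
  by rewrite pkn_integral// -EFinM ltry.
rewrite -ge0_integralZl; [|by []|by mfun|by move=> x _; rewrite lee_fin pkn_ge0|by rewrite lee_fin addr_ge0].
apply: ge0_le_integral; [by []|by move=> x _; rewrite lee_fin mulr_ge0 ?pkn_ge0|exact: mSE|exact: mpkE|].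
by move=> x _; rewrite -EFinM lee_fin ler_wpM2r ?pkn_ge0.
Qed.

Let conv_E de y : 0 < de -> (\int[leb]_x ((h x + M) * pkn de (tsub y x))%:E = S de y)%E.
Proof.
move=> d0; have mpkd := mpk de.
rewrite -(ge0_integral_tadd (f := fun x => ((h x + M) * pkn de (tsub y x))%:E) y); last 2 first.
- apply/measurable_EFinP; apply: measurable_funM; first by mfun.
  by apply: (measurableT_comp mpkd); apply: measurable_fun_tsub; mfun.
- by move=> x; rewrite lee_fin mulr_ge0 ?pkn_ge0.
have -> : (\int[leb]_x ((h (tadd x y) + M) * pkn de (tsub y (tadd x y)))%:E =
    \int[leb]_x ((h (tadd x y) + M) * pkn de x)%:E)%E.
  apply: eq_integral => x _; rewrite pkn_tsubC; congr (_ * pkn _ _)%:E.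
  by apply: eq_from_tnth => i; rewrite !tnth_mktuple; ring.
have mta : measurable_fun setT (fun x : V => h (tadd x y)).
  by apply: (measurableT_comp mh); mfunv.
rewrite (ge0_integral_tscale d0 (f := fun x => ((h (tadd x y) + M) * pkn de x)%:E)); last 2 first.
- apply/measurable_EFinP; apply: measurable_funM; last exact: mpkd.
  by apply: measurable_funD => //; exact: measurable_cst.
- by move=> x; rewrite lee_fin mulr_ge0 ?pkn_ge0.
have ms := measurable_shift de y.
rewrite -ge0_integralZl; [|by []| | |by rewrite lee_fin exprn_ge0// ltW]; last 2 first.
- apply/measurable_EFinP; apply: measurable_funM; last by apply: (measurableT_comp mpkd); mfunv.
  by apply: measurable_funD => //; exact: measurable_cst.
- by move=> x _; rewrite lee_fin mulr_ge0 ?pkn_ge0.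
by apply: eq_integral => x _; rewrite -EFinM mulrCA pkn_tscale.
Qed.

Let S_cvg : {ae leb, forall y, S (de_ j) y @[j --> \oo] --> ((h y + M) * (2 * pi) ^+ n)%:E}.
Proof.
apply: filterS hcvg => y hy; have mpk1 := mpk 1.
have -> : (((h y + M) * (2 * pi) ^+ n)%:E = \int[leb]_x ((h y + M) * pkn 1 x)%:E)%E.
  under eq_integral do rewrite EFinM.
  rewrite ge0_integralZl; [|by []|by mfun|by move=> x _; rewrite lee_fin pkn_ge0|by rewrite lee_fin].
  by rewrite pkn_integral.
apply: (@dominated_cvg_real _ _ _ leb (fun j x => (h (tadd (tscale (de_ j) x) y) + M) * pkn 1 x)
   (fun x => (h y + M) * pkn 1 x) (fun x => (M + M) * pkn 1 x)).
- by move=> j; apply/measurable_EFinP; exact: mSE.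
- by mfun.
- by mfun.
- by apply: aeW => x; apply: cvgM; [apply: cvgD; [exact: hy|exact: cvg_cst]|exact: cvg_cst].
- by move=> j x; rewrite normrM !ger0_norm ?pkn_ge0// ler_wpM2r ?pkn_ge0.
- under eq_integral do rewrite EFinM.
  rewrite ge0_integralZl; [|by []|by mfun|by move=> x _; rewrite lee_fin pkn_ge0|by rewrite lee_fin addr_ge0].
  by rewrite pkn_integral// -EFinM ltry.
Qed.

Let m_tsub de (y : V) : measurable_fun setT (fun x : V => pkn de (tsub y x)).
Proof. by apply: (measurableT_comp (mpk de)); apply: measurable_fun_tsub; mfun. Qed.

Let integrable_pkn (f : V -> R) (g : V -> V) de : 0 < de -> measurable_fun setT f ->
  (\int[leb]_x (`|f x|)%:E < +oo)%E -> measurable_fun setT (fun x => pkn de (g x)) ->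
  leb.-integrable setT (EFin \o (fun x => f x * pkn de (g x))).
Proof.
move=> d0 mf i_f mg; have iv' : leb.-integrable setT (EFin \o f).
  by apply/integrableP; split; [exact/measurable_EFinP|under eq_integral do rewrite /=].
have iM : leb.-integrable setT (fun y => (pk de 0 ^+ n)%:E * (EFin \o f) y)%E by apply: integrableZl.
apply: (le_integrable measurableT _ _ iM).
  by apply/measurable_EFinP; apply: measurable_funM.
move=> y _ /=; rewrite lee_fin !normrM mulrC; apply: ler_wpM2r => //.
by rewrite !ger0_norm ?pkn_ge0 ?exprn_ge0 ?pk_ge0// pkn_le0.
Qed.

Let cst2 : R := fourier_cst n ^+ 2.
Let cst2E : cst2 * (2 * pi) ^+ n = 1. Proof. exact: fourier_cst_sq. Qed.
Let cst20 : 0 <= cst2. Proof. exact: sqr_ge0. Qed.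

Let H de y : R := cst2 * \int[leb]_x (h x * pkn de (tsub y x)).

Let HE de y : 0 < de -> H de y = cst2 * fine (S de y) - M.
Proof.
move=> d0; have mpkd : measurable_fun setT (fun x : V => pkn de (tsub y x)).
  by apply: (measurableT_comp (mpk de)); apply: measurable_fun_tsub; mfun.
have iM : leb.-integrable setT (EFin \o (fun x => M * pkn de (tsub y x))).
  apply/integrableP; split; first by apply/measurable_EFinP; apply: measurable_funM => //.
  under eq_integral do rewrite /= ger0_norm ?mulr_ge0 ?pkn_ge0// EFinM pkn_tsubC.
  rewrite ge0_integralZl; [|by []| |by move=> x _; rewrite lee_fin pkn_ge0|by rewrite lee_fin].
    rewrite (ge0_integral_tsub (f := fun x => (pkn de x)%:E)); [|by apply/measurable_EFinP; exact: mpk|by move=> x; rewrite lee_fin pkn_ge0].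
    by rewrite pkn_integral// -EFinM ltry.
  apply/measurable_EFinP; apply: (measurableT_comp (mpk de)); apply: measurable_fun_tsub; mfun.
have ihM : leb.-integrable setT (EFin \o (fun x => (h x + M) * pkn de (tsub y x))).
  apply/integrableP; split; first by apply/measurable_EFinP; apply: measurable_funM => //; mfun.
  under eq_integral do rewrite /= ger0_norm ?mulr_ge0 ?pkn_ge0//.
  by rewrite conv_E// ltey_eq S_fin.
rewrite /H; transitivity (cst2 * (\int[leb]_x ((h x + M) * pkn de (tsub y x)) - \int[leb]_x (M * pkn de (tsub y x)))).
  by congr (_ * _); rewrite -RintegralB//; apply: eq_Rintegral => x _; ring.
rewrite {1}/Rintegral conv_E// mulrBr; congr (_ - _).
have -> : \int[leb]_x (M * pkn de (tsub y x)) = M * (2 * pi) ^+ n.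
  rewrite /Rintegral; under eq_integral do rewrite EFinM pkn_tsubC.
  rewrite ge0_integralZl; [|by []| |by move=> x _; rewrite lee_fin pkn_ge0|by rewrite lee_fin].
    rewrite (ge0_integral_tsub (f := fun x => (pkn de x)%:E)); [|by apply/measurable_EFinP; exact: mpk|by move=> x; rewrite lee_fin pkn_ge0].
    by rewrite pkn_integral.
  apply/measurable_EFinP; apply: (measurableT_comp (mpk de)); apply: measurable_fun_tsub; mfun.
by rewrite mulrCA cst2E mulr1.
Qed.

Let H_le j y : `|H (de_ j) y| <= M.
Proof.
rewrite HE//.
have S0 : 0 <= fine (S (de_ j) y).
  by apply: fine_ge0; apply: integral_ge0 => x _; rewrite lee_fin mulr_ge0 ?pkn_ge0.
have c0 : 0 <= cst2 * fine (S (de_ j) y) by rewrite mulr_ge0.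
suff : cst2 * fine (S (de_ j) y) <= M + M by rewrite ler_norml => c1; apply/andP; split; lra.
apply: (@le_trans _ _ (cst2 * ((M + M) * (2 * pi) ^+ n))).
  apply: ler_wpM2l => //; rewrite -lee_fin fineK ?S_fin//.
  have mpk1 := mpk 1; have ms := measurable_shift (de_ j) y.
  rewrite EFinM -(pkn_integral (R := R) ltr01 n).
  rewrite -ge0_integralZl; [|by []|by mfun|by move=> x _; rewrite lee_fin pkn_ge0|by rewrite lee_fin addr_ge0].
  apply: ge0_le_integral; [by []|by move=> x _; rewrite lee_fin mulr_ge0 ?pkn_ge0|exact: mSE|exact: mpkE|].
  by move=> x _; rewrite -EFinM lee_fin ler_wpM2r ?pkn_ge0.
by rewrite mulrCA cst2E mulr1.
Qed.

Let H_cvg : {ae leb, forall y, H (de_ j) y @[j --> \oo] --> h y}.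
Proof.
apply: filterS S_cvg => y cS; under eq_fun do rewrite HE//.
have -> : h y = cst2 * ((h y + M) * (2 * pi) ^+ n) - M by rewrite mulrCA cst2E mulr1 addrK.
apply: cvgB; last exact: cvg_cst.
by apply: cvgM; [exact: cvg_cst|exact: fine_cvg].
Qed.

Let test_outE j : \int[leb]_x (h x * test_out v (de_ j) x) = \int[leb]_y (v y * H (de_ j) y).
Proof.
have P0 : 0 <= pk (de_ j) 0 ^+ n by rewrite exprn_ge0// pk_ge0.
have mf2 : measurable_fun setT (fun z : V * V => pkn (de_ j) (tsub z.2 z.1)).
  by apply: (measurableT_comp (mpk _)); apply: measurable_fun_tsub; mfun.
have iva : (\int[leb]_x (`|v x|)%:E < +oo)%E by under eq_integral do rewrite ger0_norm//.
transitivity (\int[leb]_x \int[leb]_y ((cst2 * h x) * (v y * pkn (de_ j) (tsub y x)))).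
  apply: eq_Rintegral => x _; rewrite /test_out -/cst2 mulrCA mulrA RintegralZl//.
  apply: (integrable_pkn (de0 j) mv iva).
  exact: (measurableT_comp mf2 (@pair1_measurable _ _ _ _ x)).
rewrite (@Rintegral_fubini _ _ _ _ _ _ _ _ (fun x => (cst2 * pk (de_ j) 0 ^+ n) * `|h x|) v).
- apply: eq_Rintegral => y _; rewrite /H -RintegralZl//; last first.
    exact: (integrable_pkn (de0 j) mh ih (m_tsub (de_ j) y)).
  rewrite -RintegralZl//.
    by apply: eq_Rintegral => x _; ring.
  have := integrableZl measurableT cst2 (integrable_pkn (de0 j) mh ih (m_tsub (de_ j) y)).
  by apply: eq_integrable.
- by apply: measurable_funM; [mfun|apply: measurable_funM => //; mfun].
- by apply: measurable_funM => //; apply: measurableT_comp.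
- by [].
- by move=> x; apply: mulr_ge0; [exact: mulr_ge0|exact: normr_ge0].
- exact: v0.
- move=> x y; rewrite (normrM (cst2 * h x)) (normrM cst2) (normrM (v y)) (ger0_norm cst20) (ger0_norm (v0 y)) [X in _ * (_ * X)]ger0_norm ?pkn_ge0//.
  have -> : cst2 * `|h x| * (v y * pkn (de_ j) (tsub y x)) = cst2 * pkn (de_ j) (tsub y x) * `|h x| * v y.
    by move: cst2 `|h x| (v y) (pkn _ _) => p q r t; ring.
  by do 2 apply: ler_wpM2r => //; apply: ler_wpM2l => //; exact: pkn_le0.
- under eq_integral do rewrite EFinM.
  rewrite ge0_integralZl; [|by []|by apply/measurable_EFinP; apply: measurableT_comp|by move=> x _; rewrite lee_fin|by rewrite lee_fin mulr_ge0].
  by rewrite lte_mul_pinfty// lee_fin mulr_ge0.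
- exact: iv.
Qed.

Lemma test_out_cvg : \int[leb]_x (h x * test_out v (de_ j) x) @[j --> \oo] --> \int[leb]_x (h x * v x).
Proof.
under eq_fun do rewrite test_outE.
have -> : \int[leb]_x (h x * v x) = \int[leb]_x (v x * h x) by apply: eq_Rintegral => x _; rewrite mulrC.
have iMv : (\int[leb]_x (M * v x)%:E < +oo)%E.
  under eq_integral do rewrite EFinM.
  rewrite ge0_integralZl; [|by []|by mfun|by move=> x _; rewrite lee_fin|by rewrite lee_fin].
  by rewrite lte_mul_pinfty// lee_fin.
have iMv' : leb.-integrable setT (EFin \o (fun x => M * v x)).
  apply/integrableP; split.
    by apply/measurable_EFinP; apply: measurable_funM; [exact: measurable_cst|].
  by under eq_integral do rewrite /= ger0_norm ?mulr_ge0//.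
have ivh : leb.-integrable setT (EFin \o (fun x => v x * h x)).
  apply: (le_integrable measurableT _ _ iMv'); first by apply/measurable_EFinP; apply: measurable_funM.
  by move=> y _ /=; rewrite lee_fin !normrM mulrC ler_wpM2r// (ger0_norm M0).
rewrite {1}/Rintegral; apply: fine_cvg; rewrite fineK ?(integrable_fin_num measurableT ivh)//.
have mH j : measurable_fun setT (H (de_ j)).
  apply: measurable_funM; first exact: measurable_cst.
  apply: (@measurable_Rintegral2 _ _ _ _ _ _ (fun y x : V => h x * pkn (de_ j) (tsub y x))).
  apply: measurable_funM; first by mfun.
  by apply: (measurableT_comp (mpk _)); apply: measurable_fun_tsub; mfun.
apply: (@dominated_cvg_real _ _ _ leb (fun j x => v x * H (de_ j) x) (fun x => v x * h x) (fun x => M * v x)).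
- by move=> j; apply: measurable_funM.
- exact: measurable_funM.
- by mfun.
- by apply: filterS H_cvg => y cH; apply: cvgM; [exact: cvg_cst|].
- by move=> j x; rewrite normrM mulrC (ger0_norm (v0 x)) ler_wpM2r.
- exact: iMv.
Qed.

End approximate_identity.

Section spheres_and_balls.
Context {R : realType}.
Local Notation mR := (measurableTypeR R).

Lemma ae_sphere n (c : R) : {ae @lebesgue_tuple R n.+1, forall y, Num.sqrt (dot y y) != c}.
Proof.
have [C [lam [C0 lam0 _ P2]]] := polar_radial (R := R) n.
pose f (s : mR) : \bar R := (if Num.sqrt s == c then 1 else 0)%:E.
have mf : measurable_fun setT f.
  rewrite /f; apply/measurable_EFinP; apply: measurable_fun_if => //.
  - by apply: measurable_fun_eqr; [exact: measurable_sqrt|exact: measurable_cst].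
have f0 s : (0 <= f s)%E by rewrite /f lee_fin; case: ifP.
have I0 : (\int[@lebesgue_tuple R n.+1]_x f (dot x x) = 0)%E.
  rewrite P2// (_ : integral _ _ _ = 0%E) ?mule0//.
  transitivity (\int[leb R]_(s in [set ((c ^+ 2)%R : mR)]) ((wt n.+1 s)%:E * f s))%E.
    rewrite [RHS]integral_mkcond; apply: eq_integral => s _; rewrite patchE.
    case: ifPn => // sc; rewrite /f; case: eqP => [Es|_]; last by rewrite mule0.
    have [s0|s0] := ltP 0 s; last by rewrite /wt ltNge s0 mul0e.
    by move: sc; rewrite notin_setE/= => -[]; rewrite -Es sqr_sqrtr// ltW.
  by rewrite integral_set1.
have mg : measurable_fun setT (fun x : Rn R n.+1 => f (dot x x)).
  by apply: (measurableT_comp mf); mfun.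
have := (ae_eq_integral_abs (@lebesgue_tuple R n.+1) measurableT mg).1.
have E : (\int[@lebesgue_tuple R n.+1]_x `|f (dot x x)| = 0)%E.
  by rewrite -[RHS]I0; apply: eq_integral => x _; rewrite gee0_abs.
move=> /(_ E); apply: filterS => y /(_ I); rewrite /f /=.
by case: eqP => // _ [] /eqP; rewrite oner_eq0.
Qed.

Lemma ball_fin n (r : R) : (\int[@lebesgue_tuple R n]_x (if Num.sqrt (dot x x) <= r then 1 else 0)%:E < +oo)%E.
Proof.
have ml := @measurable_l1norm R n.
apply: (@le_lt_trans _ _ (\int[@lebesgue_tuple R n]_x ((expR (n%:R * r))%:E * (expR (- (1 * l1norm x)))%:E))%E).
  apply: ge0_le_integral; [by []| |by mfun|by mfun|].
  - by move=> x _; rewrite lee_fin; case: ifP.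
  - move=> x _; rewrite -EFinM lee_fin -expRD; case: ifP => [xr|_]; last exact: expR_ge0.
    apply: (@le_trans _ _ (expR 0)); first by rewrite expR0.
    rewrite ler_expR subr_ge0 mul1r /l1norm.
    rewrite -[n in n%:R](card_ord n) mulr_natl -sumr_const.
    apply: ler_sum => i _; apply: le_trans xr; rewrite -sqrtr_sqr ler_sqrt ?dot_ge0//.
    by rewrite /dot (bigD1 i)//= expr2 lerDl; apply: sumr_ge0 => k _; rewrite -expr2 sqr_ge0.
rewrite ge0_integralZl; [|by []|by mfun|by move=> x _; rewrite lee_fin expR_ge0|by rewrite lee_fin expR_ge0].
by rewrite integral_expl1// -EFinM ltry.
Qed.

Lemma ball_absint n (chi a : Rn R n -> R) (r M : R) : 0 <= M ->
  measurable_fun setT chi -> measurable_fun setT a ->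
  (forall x, `|chi x| <= M * (if Num.sqrt (dot x x) <= r then 1 else 0)) ->
  (\int[@lebesgue_tuple R n]_x (a x ^+ 2)%:E < +oo)%E ->
  absint (@lebesgue_tuple R n) (fun x => chi x * a x).
Proof.
move=> M0 mchi ma chiM ia; have mca := measurable_funM mchi ma; split=> //.
pose B (x : Rn R n) : R := if Num.sqrt (dot x x) <= r then 1 else 0.
have mB : measurable_fun setT B by rewrite /B; mfun.
have B0 x : 0 <= B x by rewrite /B; case: ifP.
have B1 x : B x <= 1 by rewrite /B; case: ifP.
have ma2 : measurable_fun setT (fun x => (a x ^+ 2)%:E) by apply/measurable_EFinP; exact: measurable_funX.
have mBa : measurable_fun setT (fun x => ((B x)%:E + (a x ^+ 2)%:E)%E) by apply: emeasurable_funD => //; exact/measurable_EFinP.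
apply: (@le_lt_trans _ _ (\int[@lebesgue_tuple R n]_x (M%:E * ((B x)%:E + (a x ^+ 2)%:E)))%E).
  apply: ge0_le_integral; [by []|by []| | |].
  - by apply/measurable_EFinP; apply: measurableT_comp.
  - by apply: emeasurable_funM; [exact: measurable_cst|].
  - move=> x _; rewrite -EFinD -EFinM lee_fin normrM; apply: (@le_trans _ _ (M * B x * `|a x|)).
      by apply: ler_wpM2r.
    rewrite -mulrA; apply: ler_wpM2l => //; rewrite -[a x ^+ 2]real_normK ?num_real//.
    by have := sqr_ge0 (`|a x| - 1); have := normr_ge0 (a x); have := B0 x; have := B1 x; nra.
have b0 x : (0 <= (B x)%:E + (a x ^+ 2)%:E)%E by rewrite -EFinD lee_fin addr_ge0 ?sqr_ge0.
rewrite ge0_integralZl; [|by []|exact: mBa|by move=> x _; exact: b0|by rewrite lee_fin].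
rewrite lte_mul_pinfty ?lee_fin// ge0_integralD; [|by []|by move=> x _; rewrite lee_fin|exact/measurable_EFinP|by move=> x _; rewrite lee_fin sqr_ge0|exact: ma2].
apply: lte_add_pinfty => //; exact: ball_fin.
Qed.

Lemma cut_le_ball (psi : R -> R) k M (S : R) : (forall S, shellcut psi k S <= M) ->
  shellcut psi k S <= M * (if Num.sqrt S <= k.+1%:R then 1 else 0).
Proof.
move=> cM; have := cM S; rewrite /shellcut; case: ifP => [/andP[_ ->]|]; first by rewrite mulr1.
move=> _ M0; rewrite mulr_ge0//; first by case: ifP.
Qed.

End spheres_and_balls.

Section test_estimate.
Context {R : realType} (n : nat).
Local Notation V := (Rn R n.+1).
Local Notation lebV := (@lebesgue_tuple R n.+1).
Local Notation mR := (measurableTypeR R).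
Variables (w psi g : R -> R) (C tau : R).
Hypotheses (cpsi : {within `]0, +oo[%classic, continuous psi})
  (psi0 : forall r : R, 0 < r -> 0 <= psi r)
  (mw : measurable_fun setT w) (w0 : forall r, 0 <= w r)
  (mg : measurable_fun setT g) (g0 : forall q, 0 <= g q)
  (ig : (\int[lebV]_x (g (dot x x))%:E < +oo)%E)
  (gw : forall q, 0 <= q -> g q <= w (Num.sqrt q))
  (sin0 : forall z, \int[lebV]_x (g (dot x x) * sin (dot z x)) = 0)
  (rft0 : forall z : V, 0 <= rft g z)
  (tau0 : 0 < tau) (C0 : 0 <= C) (SE : @smoothing_estimate R n.+1 w psi C).

Let mc k : measurable_fun setT (shellcut psi k : mR -> R). Proof. exact: measurable_cut. Qed.
Let c0 k S : 0 <= shellcut psi k S. Proof. exact: cut_ge0. Qed.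
Let mcd k : measurable_fun setT (fun x : V => shellcut psi k (dot x x)).
Proof. by apply: (measurableT_comp (mc k)); mfun. Qed.

Let om (z : V * mR) : R := g (dot z.1 z.1) * expR (- (tau * `|z.2|)).
Let om0 z : 0 <= om z. Proof. by rewrite mulr_ge0 ?expR_ge0. Qed.
Let mom : measurable_fun setT om. Proof. by rewrite /om; mfun. Qed.

Let regE k (f : V -> R) : \bar R := (\int[lebV \x leb R]_z (om z *
   (osc_re lebV (@phase R n.+1) (fun x => shellcut psi k (dot x x) * f x) (fun=> 0%R) z ^+ 2 +
    osc_im lebV (@phase R n.+1) (fun x => shellcut psi k (dot x x) * f x) (fun=> 0%R) z ^+ 2))%:E)%E.

Let cut_fin k (f : V -> R) : measurable_fun setT f -> (forall x, 0 <= f x) -> (\int[lebV]_x (f x)%:E < +oo)%E ->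
  (\int[lebV]_x (`|shellcut psi k (dot x x) * f x|)%:E < +oo)%E.
Proof.
move=> mf f0 i_f; have [M M0 cM] := cut_bound cpsi psi0 k.
have mcf := measurable_funM (mcd k) mf.
apply: (@le_lt_trans _ _ (\int[lebV]_x (M%:E * (f x)%:E))%E).
  apply: ge0_le_integral; [by []|by []| |by mfun|].
  - by apply/measurable_EFinP; apply: measurableT_comp.
  - by move=> x _; rewrite -EFinM lee_fin ger0_norm ?mulr_ge0// ler_wpM2r.
rewrite ge0_integralZl; [|by []|by mfun|by move=> x _; rewrite lee_fin|by rewrite lee_fin].
by rewrite lte_mul_pinfty// lee_fin.
Qed.

Let regE_kernel k (f : V -> R) : measurable_fun setT f -> (forall x, 0 <= f x) -> (\int[lebV]_x (f x)%:E < +oo)%E ->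
  (regE k f = \int[lebV]_xi \int[lebV]_eta ((shellcut psi k (dot xi xi) * f xi) * (shellcut psi k (dot eta eta) * f eta) * evk g tau xi eta)%:E)%E.
Proof.
move=> mf f0 i_f; apply: (evolution_ge0 mg g0 ig sin0 tau0 rft0).
- exact: measurable_funM (mcd k) mf.
- exact: measurable_cst.
- exact: cut_fin.
- by under eq_integral do rewrite normr0; rewrite integral0 ltry.
- by move=> x; rewrite mulr_ge0.
- by [].
Qed.

Let measurable_kern k (f : V -> R) : measurable_fun setT f ->
  measurable_fun setT (fun z : V * V => ((shellcut psi k (dot z.1 z.1) * f z.1) * (shellcut psi k (dot z.2 z.2) * f z.2) * evk g tau z.1 z.2)%:E).
Proof.
move=> mf; apply/measurable_EFinP; apply: measurable_funM; last exact: measurable_evk.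
have mcf := measurable_funM (mcd k) mf.
by apply: measurable_funM; [exact: (measurableT_comp mcf measurable_fst)|exact: (measurableT_comp mcf measurable_snd)].
Qed.

Let regE_mono k m (f : V -> R) : (k <= m)%N -> measurable_fun setT f -> (forall x, 0 <= f x) -> (\int[lebV]_x (f x)%:E < +oo)%E ->
  (regE k f <= regE m f)%E.
Proof.
move=> km mf f0 i_f; rewrite (regE_kernel _ mf f0 i_f) (regE_kernel _ mf f0 i_f).
have ek0 := evk_ge0 tau0 rft0.
have k0 j xi eta : 0 <= (shellcut psi j (dot xi xi) * f xi) * (shellcut psi j (dot eta eta) * f eta) * evk g tau xi eta.
  by apply: mulr_ge0 => //; apply: mulr_ge0; apply: mulr_ge0.
apply: ge0_le_integral; [by []| | | |].
- by move=> xi _; apply: integral_ge0 => eta _; rewrite lee_fin.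
- by apply: (@measurable_integral2 _ _ _ _ R _ (fun xi eta : V => ((shellcut psi k (dot xi xi) * f xi) * (shellcut psi k (dot eta eta) * f eta) * evk g tau xi eta)%:E)); [exact: measurable_kern|move=> *; rewrite lee_fin].
- by apply: (@measurable_integral2 _ _ _ _ R _ (fun xi eta : V => ((shellcut psi m (dot xi xi) * f xi) * (shellcut psi m (dot eta eta) * f eta) * evk g tau xi eta)%:E)); [exact: measurable_kern|move=> *; rewrite lee_fin].
move=> xi _; apply: ge0_le_integral; [by []|by move=> eta _; rewrite lee_fin| | |].
- exact: (measurableT_comp (measurable_kern k mf) (@pair1_measurable _ _ _ _ xi)).
- exact: (measurableT_comp (measurable_kern m mf) (@pair1_measurable _ _ _ _ xi)).
move=> eta _; rewrite lee_fin; apply: ler_wpM2r => //.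
apply: ler_pM; [exact: mulr_ge0|exact: mulr_ge0| |];
  by apply: ler_wpM2r => //; exact: le_cut.
Qed.

Variable v : V -> R.
Hypotheses (mv : measurable_fun setT v) (v0 : forall x, 0 <= v x)
  (iv : (\int[lebV]_x (v x)%:E < +oo)%E) (iv2 : (\int[lebV]_x (v x ^+ 2)%:E < +oo)%E).

Let mp := @measurable_phase R n.+1.

Let mregE k (f : V -> R) : measurable_fun setT f -> measurable_fun setT (fun z : V * mR => (om z *
   (osc_re lebV (@phase R n.+1) (fun x => shellcut psi k (dot x x) * f x) (fun=> 0%R) z ^+ 2 +
    osc_im lebV (@phase R n.+1) (fun x => shellcut psi k (dot x x) * f x) (fun=> 0%R) z ^+ 2))%:E).
Proof.
move=> mf; have mcf := measurable_funM (mcd k) mf.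
apply/measurable_EFinP; apply: measurable_funM => //; apply: measurable_funD; apply: measurable_funX.
  by apply: measurable_osc_re => //; exact: measurable_cst.
by apply: measurable_osc_im => //; exact: measurable_cst.
Qed.

Let reg0 k (f : V -> R) z : (0 <= (om z *
   (osc_re lebV (@phase R n.+1) (fun x => shellcut psi k (dot x x) * f x) (fun=> 0%R) z ^+ 2 +
    osc_im lebV (@phase R n.+1) (fun x => shellcut psi k (dot x x) * f x) (fun=> 0%R) z ^+ 2))%:E)%E.
Proof. by rewrite lee_fin; apply: mulr_ge0 => //; rewrite addr_ge0 ?sqr_ge0. Qed.

Let regE_weighted k (f : V -> R) : measurable_fun setT f ->
  ((fourier_cst n.+1 ^+ 2)%:E * regE k f <= weighted_energy w (evolution_trunc psi (fun x => (f x)%:C%C) k))%E.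
Proof.
move=> mf; rewrite -ge0_integralZl; [|by []|exact: mregE|by move=> z _; exact: reg0|by rewrite lee_fin sqr_ge0].
have mfc : measurable_cfun (fun x : V => (f x)%:C%C) by split => //; exact: measurable_cst.
have mN := measurable_normc2 (measurable_evolution_trunc (mc k) mfc).
have mwe : measurable_fun setT (fun z : V * mR => w (enorm z.1)).
  by apply: (measurableT_comp mw); rewrite /enorm; mfun.
apply: ge0_le_integral; [by []|by move=> z _; rewrite mule_ge0 ?reg0// lee_fin sqr_ge0| | |].
- by apply: emeasurable_funM; [exact: measurable_cst|exact: mregE].
- by apply/measurable_EFinP; apply: measurable_funM.
move=> z _; rewrite -EFinM lee_fin normc2_evolution.
have -> : (fun x : V => shellcut psi k (dot x x) * complex.Im ((f x)%:C)%C) = fun=> 0.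
  by apply/funext => x; exact: mulr0.
have -> : (fun x : V => shellcut psi k (dot x x) * complex.Re ((f x)%:C)%C) = fun x => shellcut psi k (dot x x) * f x by [].
rewrite mulrCA; apply: ler_wpM2r; first by rewrite mulr_ge0 ?sqr_ge0// addr_ge0 ?sqr_ge0.
rewrite /om; apply: (@le_trans _ _ (g (dot z.1 z.1) * 1)).
  by apply: ler_wpM2l => //; rewrite -expR0 ler_expR oppr_le0 mulr_ge0// ltW.
by rewrite mulr1; apply: gw; exact: dot_ge0.
Qed.

Let test_out_estimate k de : 0 < de ->
  ((fourier_cst n.+1 ^+ 2)%:E * regE k (test_out v de) <= C%:E * \int[lebV]_x (v x ^+ 2)%:E)%E.
Proof.
move=> de0; have mt := measurable_test_out de mv.
have t0 := test_out_ge0 v0 de0; have it := test_out_fin mv v0 iv de0.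
have [U [mU cU] WU] := SE (L2_test_in mv v0 iv iv2 de0) (is_fourier_test mv v0 iv iv2 de0).
apply: (@le_trans _ _ (weighted_energy w U)); last first.
  apply: (le_trans WU); apply: lee_wpmul2l; first by rewrite lee_fin.
  exact: energy_test_in.
have mtc : measurable_cfun (fun x : V => (test_out v de x)%:C%C) by split => //; exact: measurable_cst.
have mF m := measurable_evolution_trunc (mc m) mtc.
apply: (@weighted_limit_le _ _ _ (lebV \x leb R)%E (fun z => w (enorm z.1)) _ _
  (fun m => evolution_trunc psi (fun x => (test_out v de x)%:C%C) m) U) => //.
- by apply: (measurableT_comp mw); rewrite /enorm; mfun.
- near=> m; apply: le_trans (regE_weighted m mt).
  apply: lee_wpmul2l; first by rewrite lee_fin sqr_ge0.
  by apply: regE_mono => //; near: m; exact: nbhs_infty_ge.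
Unshelve. all: by end_near. Qed.

Let de_ (j : nat) : R := j.+1%:R^-1.

Let osc_cvg k c z : \int[lebV]_x (shellcut psi k (dot x x) * test_out v (de_ j) x * cos (phase z x + c)) @[j --> \oo] -->
  \int[lebV]_x (shellcut psi k (dot x x) * v x * cos (phase z x + c)).
Proof.
have [M M0 cM] := cut_bound cpsi psi0 k.
pose h (x : V) := shellcut psi k (dot x x) * cos (phase z x + c).
have mph : measurable_fun setT (fun x => cos (phase z x + c)) by rewrite /phase; mfun.
have mh : measurable_fun setT h by apply: measurable_funM.
have hc x : `|h x| <= shellcut psi k (dot x x).
  by rewrite normrM (ger0_norm (c0 _ _)) ler_piMr// cos_max.
have ih : (\int[lebV]_x (`|h x|)%:E < +oo)%E.
  apply: (@le_lt_trans _ _ (\int[lebV]_x (M%:E * (if Num.sqrt (dot x x) <= k.+1%:R then 1 else 0)%:E))%E).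
    apply: ge0_le_integral; [by []|by []| |by mfun|].
    - by apply/measurable_EFinP; apply: measurableT_comp.
    - by move=> x _; rewrite -EFinM lee_fin; apply: le_trans (hc x) _; exact: cut_le_ball.
  rewrite ge0_integralZl; [|by []|by mfun|by move=> x _; rewrite lee_fin; case: ifP|by rewrite lee_fin].
  by rewrite lte_mul_pinfty ?ball_fin// lee_fin.
have de0 j : 0 < de_ j by rewrite invr_gt0.
have dcvg : de_ @ \oo --> (0 : R) by exact: cvg_harmonic.
have E f : \int[lebV]_x (shellcut psi k (dot x x) * f x * cos (phase z x + c)) = \int[lebV]_x (h x * f x).
  by apply: eq_Rintegral => x _; rewrite /h mulrAC.
under eq_fun do rewrite E; rewrite E.
apply: (@test_out_cvg _ _ h v M) => //.
  by move=> x; exact: le_trans (hc x) (cM _).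
apply: filterS2 (ae_sphere n k.+1%:R^-1) (ae_sphere n k.+1%:R) => y y1 y2 x.
have dd a : dot a (tadd (tscale (de_ j) x) y) @[j --> \oo] --> dot a y.
  under eq_fun do rewrite dotC dot_tadd dot_tscalel.
  rewrite (_ : dot a y = 0 * dot x a + dot y a); last by rewrite mul0r add0r dotC.
  by apply: cvgD; [apply: cvgM => //; exact: cvg_cst|exact: cvg_cst].
have d2 : dot (tadd (tscale (de_ j) x) y) (tadd (tscale (de_ j) x) y) @[j --> \oo] --> dot y y.
  under eq_fun do rewrite dot_tadd dot_tscalel.
  suff : (de_ j * dot x (tadd (tscale (de_ j) x) y) + dot y (tadd (tscale (de_ j) x) y)) @[j --> \oo] -->
      0 * dot x y + dot y y by rewrite mul0r add0r.
  by apply: cvgD; [apply: cvgM|].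
apply: cvgM; first exact: cut_cvg.
apply: (continuous_cvg_seq (h := cos)); first exact: continuous_cos.
apply: cvgD; last exact: cvg_cst.
by apply: cvgB => //; apply: cvgM => //; exact: cvg_cst.
Qed.

Lemma smoothing_kernel_estimate k :
  ((fourier_cst n.+1 ^+ 2)%:E * \int[lebV]_xi \int[lebV]_eta ((shellcut psi k (dot xi xi) * v xi) * (shellcut psi k (dot eta eta) * v eta) * evk g tau xi eta)%:E
   <= C%:E * \int[lebV]_x (v x ^+ 2)%:E)%E.
Proof.
rewrite -regE_kernel//.
have F0 : (0 <= (fourier_cst n.+1 ^+ 2)%:E :> \bar R)%E by rewrite lee_fin sqr_ge0.
rewrite -ge0_integralZl; [|by []|exact: mregE|by move=> z _; exact: reg0|by []].
apply: (@fatou_le_cst _ _ _ (lebV \x leb R)%E (fun j z => ((fourier_cst n.+1 ^+ 2)%:E * (om z *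
   (osc_re lebV (@phase R n.+1) (fun x => shellcut psi k (dot x x) * test_out v (de_ j) x) (fun=> 0%R) z ^+ 2 +
    osc_im lebV (@phase R n.+1) (fun x => shellcut psi k (dot x x) * test_out v (de_ j) x) (fun=> 0%R) z ^+ 2))%:E)%E)).
- move=> j; apply: emeasurable_funM; first exact: measurable_cst.
  by apply: mregE; exact: measurable_test_out.
- by move=> j z; rewrite mule_ge0 ?reg0.
- by apply: emeasurable_funM; [exact: measurable_cst|exact: mregE].
- by move=> z; rewrite mule_ge0 ?reg0.
- move=> z; apply: cvgeZl => //; apply: cvg_EFin; first exact: nearW.
  apply: cvgM; first exact: cvg_cst.
  have X2 (a : nat -> R) (b : R) : a @ \oo --> b -> a j ^+ 2 @[j --> \oo] --> b ^+ 2.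
    by move=> ab; rewrite expr2; under eq_fun do rewrite expr2; exact: cvgM.
  apply: cvgD; apply: X2.
    under eq_fun do rewrite osc_re0E; rewrite osc_re0E.
    have := @osc_cvg k 0 z; under eq_Rintegral do rewrite addr0.
    by under eq_fun do under eq_Rintegral do rewrite addr0.
  under eq_fun do rewrite osc_im0E; rewrite osc_im0E.
  have := @osc_cvg k (- (pi / 2)) z.
  have sc (t : R) : cos (t - pi / 2) = sin t by rewrite cosB cos_pihalf sin_pihalf mulr0 mulr1 add0r.
  under eq_Rintegral do rewrite sc.
  by under eq_fun do under eq_Rintegral do rewrite sc.
- move=> j; rewrite ge0_integralZl; [|by []|by apply: mregE; exact: measurable_test_out|by move=> z _; exact: reg0|by []].
  by apply: test_out_estimate; rewrite invr_gt0.
Qed.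

End test_estimate.

(** * The estimate in the higher dimension *)

Section regularized_estimate.
Context {R : realType} (n : nat).
Local Notation V := (Rn R n.+2).
Local Notation lebV := (@lebesgue_tuple R n.+2).
Local Notation V' := (Rn R n.+3).
Local Notation lebV' := (@lebesgue_tuple R n.+3).
Local Notation mR := (measurableTypeR R).
Variables (w psi g : R -> R) (C tau : R).
Hypotheses (cpsi : {within `]0, +oo[%classic, continuous psi})
  (psi0 : forall r : R, 0 < r -> 0 <= psi r)
  (mw : measurable_fun setT w) (w0 : forall r, 0 <= w r)
  (mg : measurable_fun setT g) (g0 : forall q, 0 <= g q)
  (ig : (\int[lebV]_x (g (dot x x))%:E < +oo)%E)
  (ig' : (\int[lebV']_x (g (dot x x))%:E < +oo)%E)
  (gw : forall q, 0 <= q -> g q <= w (Num.sqrt q))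
  (sin0 : forall z, \int[lebV]_x (g (dot x x) * sin (dot z x)) = 0)
  (rft0 : forall z : V, 0 <= rft g z)
  (sin0' : forall z, \int[lebV']_x (g (dot x x) * sin (dot z x)) = 0)
  (rft0' : forall z : V', 0 <= rft g z)
  (tau0 : 0 < tau) (C0 : 0 <= C) (SE : @smoothing_estimate R n.+2 w psi C).

Let mc k : measurable_fun setT (shellcut psi k : mR -> R). Proof. exact: measurable_cut. Qed.
Let c0 k S : 0 <= shellcut psi k S. Proof. exact: cut_ge0. Qed.
Let mcd k : measurable_fun setT (fun x : V => shellcut psi k (dot x x)).
Proof. by apply: (measurableT_comp (mc k)); mfun. Qed.
Let mcd' k : measurable_fun setT (fun x : V' => shellcut psi k (dot x x)).
Proof. by apply: (measurableT_comp (mc k)); mfun. Qed.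

Let ek0 := evk_ge0 tau0 rft0.

Let A0 : R := C / fourier_cst n.+2 ^+ 2.
Let A0_ge0 : 0 <= A0. Proof. by rewrite divr_ge0 ?sqr_ge0. Qed.

Let kern k (phi : V -> R) xi eta : R :=
  (shellcut psi k (dot xi xi) * phi xi) * (shellcut psi k (dot eta eta) * phi eta) * evk g tau xi eta.

Let kern0 k (phi : V -> R) xi eta : (forall x, 0 <= phi x) -> 0 <= kern k phi xi eta.
Proof. by move=> p0; apply: mulr_ge0 => //; apply: mulr_ge0; apply: mulr_ge0. Qed.

Let mkern k (phi : V -> R) : measurable_fun setT phi ->
  measurable_fun setT (fun z : V * V => (kern k phi z.1 z.2)%:E).
Proof.
move=> mf; apply/measurable_EFinP; apply: measurable_funM; last exact: measurable_evk.
have mcf := measurable_funM (mcd k) mf.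
by apply: measurable_funM; [exact: (measurableT_comp mcf measurable_fst)|exact: (measurableT_comp mcf measurable_snd)].
Qed.

Let kern_le_integrable k (v : V -> R) : measurable_fun setT v -> (forall x, 0 <= v x) ->
  (\int[lebV]_x (v x)%:E < +oo)%E -> (\int[lebV]_x (v x ^+ 2)%:E < +oo)%E ->
  (\int[lebV]_xi \int[lebV]_eta (kern k v xi eta)%:E <= A0%:E * \int[lebV]_x (v x ^+ 2)%:E)%E.
Proof.
move=> mv v0 iv iv2.
have := smoothing_kernel_estimate cpsi psi0 mw w0 mg g0 ig gw sin0 rft0 tau0 C0 SE mv v0 iv iv2 k.
have cst0 := fourier_cst_gt0 (R := R) n.+2.
rewrite -/(kern k v _ _) => H.
have E : ((fourier_cst n.+2 ^+ 2)^-1%:E * (fourier_cst n.+2 ^+ 2)%:E = 1 :> \bar R)%E.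
  by rewrite -EFinM mulVf// gt_eqF// exprn_gt0.
have A0E : (A0%:E = (fourier_cst n.+2 ^+ 2)^-1%:E * C%:E)%E by rewrite -EFinM mulrC.
rewrite -[leLHS]mul1e -E A0E -!muleA; apply: lee_wpmul2l => //.
by rewrite lee_fin invr_ge0 sqr_ge0.
Qed.

Let kern_le k (v : V -> R) : measurable_fun setT v -> (forall x, 0 <= v x) ->
  (\int[lebV]_xi \int[lebV]_eta (kern k v xi eta)%:E <= A0%:E * \int[lebV]_x (v x ^+ 2)%:E)%E.
Proof.
move=> mv v0.
pose t m (x : V) : R := if (Num.sqrt (dot x x) <= m%:R) && (v x <= m%:R) then v x else 0.
have mt m : measurable_fun setT (t m).
  by rewrite /t; mfun.
have t0 m x : 0 <= t m x by rewrite /t; case: ifP.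
have tv m x : t m x <= v x by rewrite /t; case: ifP.
have tb m x : t m x <= m%:R * (if Num.sqrt (dot x x) <= m%:R then 1 else 0).
  by rewrite /t; case: (Num.sqrt (dot x x) <= m%:R); rewrite /= ?mulr1 ?mulr0//; case: ifP.
have bf (m : nat) (c : R) : 0 <= c -> (\int[lebV]_x (c * (if Num.sqrt (dot x x) <= m%:R then 1 else 0))%:E < +oo)%E.
  move=> c_0; under eq_integral do rewrite EFinM.
  rewrite ge0_integralZl; [|by []|by mfun|by move=> x _; rewrite lee_fin; case: ifP|by rewrite lee_fin].
  by rewrite lte_mul_pinfty ?ball_fin// lee_fin.
have mball (m : nat) c : measurable_fun setT (fun x : V => (c * (if Num.sqrt (dot x x) <= m%:R then 1 else 0) : R)%:E) by mfun.
have it m : (\int[lebV]_x (t m x)%:E < +oo)%E.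
  apply: le_lt_trans (bf m m%:R _) => //; apply: ge0_le_integral; [by []|by move=> x _; rewrite lee_fin|exact/measurable_EFinP|exact: mball|].
  by move=> x _; rewrite lee_fin.
have it2 m : (\int[lebV]_x (t m x ^+ 2)%:E < +oo)%E.
  apply: le_lt_trans (bf m (m%:R ^+ 2) _) => //; apply: ge0_le_integral; [by []| | |exact: mball|].
  - by move=> x _; rewrite lee_fin sqr_ge0.
  - by apply/measurable_EFinP; exact: measurable_funX.
  - move=> x _; rewrite lee_fin; apply: (@le_trans _ _ ((m%:R * (if Num.sqrt (dot x x) <= m%:R then 1 else 0)) ^+ 2)).
      by rewrite lerXn2r// nnegrE ?(le_trans (t0 m x)).
    by rewrite exprMn; case: ifP => _; rewrite ?expr1n ?expr0n.
have E (f : V -> R) : measurable_fun setT f -> (forall x, 0 <= f x) ->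
    (\int[lebV]_xi \int[lebV]_eta (kern k f xi eta)%:E = \int[prod_measure lebV lebV]_z (kern k f z.1 z.2)%:E)%E.
  move=> mf f0; rewrite (fubini_tonelli1 (fun z : V * V => (kern k f z.1 z.2)%:E)) //; first exact: mkern.
  by move=> z; rewrite lee_fin kern0.
rewrite E//; apply: (@fatou_le_cst _ _ _ _ (fun m z => (kern k (t m) z.1 z.2)%:E)).
- by move=> m; exact: mkern.
- by move=> m z; rewrite lee_fin kern0.
- exact: mkern.
- by move=> z; rewrite lee_fin kern0.
- move=> [xi eta] /=.
  have tE (x : V) : \forall m \near \oo, t m x = v x.
    near=> m; rewrite /t ifT//; apply/andP; split; near: m; exact: nbhs_infty_ger.
  apply: cvg_near_cst; near=> m; rewrite /kern; congr ((_ * _) * (_ * _) * _)%:E; near: m; exact: tE.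
- move=> m; rewrite -E//; apply: (le_trans (kern_le_integrable k (mt m) (t0 m) (it m) (it2 m))).
  apply: lee_wpmul2l; first by rewrite lee_fin.
  apply: ge0_le_integral; [by []|by move=> x _; rewrite lee_fin sqr_ge0| | |].
  + by apply/measurable_EFinP; exact: measurable_funX.
  + by apply/measurable_EFinP; exact: measurable_funX.
  + by move=> x _; rewrite lee_fin lerXn2r ?nnegrE.
Unshelve. all: by end_near. Qed.

Let Om (q : R) : R := rft g (axis n.+2 (Num.sqrt q)).
Let Hk k (p : R * R) : R := shellcut psi k p.1 * shellcut psi k p.2 * pk tau (p.1 - p.2).

Let rftE (z : V') : rft g z = Om (dot z z).
Proof. by apply: (rft_radial mg g0 ig'); rewrite dot_axis sqr_sqrtr// dot_ge0. Qed.

Let mOm : measurable_fun setT (Om : mR -> R).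
Proof.
apply: (measurableT_comp (measurable_rft mg)); rewrite /axis.
apply: (measurableT_comp (@measurable_tcons R n.+2)).
by apply: measurable_fun_pair; [exact: measurable_sqrt|exact: measurable_cst].
Qed.

Let Om0 q : 0 <= Om q. Proof. exact: rft0'. Qed.

Let mHk k : measurable_fun setT (Hk k : mR * mR -> R).
Proof.
apply: measurable_funM; first by apply: measurable_funM;
  [exact: (measurableT_comp (mc k) measurable_fst)|exact: (measurableT_comp (mc k) measurable_snd)].
by apply: (measurableT_comp (measurable_pk tau)); mfun.
Qed.

Let Hk0 k p : 0 <= Hk k p. Proof. by rewrite /Hk; apply: mulr_ge0; [exact: mulr_ge0|exact: pk_ge0]. Qed.

Let HkC k s t : Hk k (s, t) = Hk k (t, s).
Proof. by rewrite /Hk /= (mulrC (shellcut psi k s)) /pk -(sqrrN (s - t)) opprB. Qed.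

Let star k (phi : R -> R) : measurable_fun setT phi -> (forall x, 0 <= phi x) ->
 (\int[lebV]_xi \int[lebV]_eta \int[leb R]_y
           (phi (dot xi xi) * phi (dot eta eta) * Hk k (dot xi xi, dot eta eta) *
            Om (y ^+ 2 + dot xi xi + dot eta eta - 2 * dot xi eta))%:E <=
  (2 * pi * A0)%:E * \int[lebV]_xi (phi (dot xi xi) ^+ 2)%:E)%E.
Proof.
move=> mphi phi0.
have mphid : measurable_fun setT (fun x : V => phi (dot x x)) by mfun.
have phk0 (xi eta : V) : 0 <= phi (dot xi xi) * phi (dot eta eta) * Hk k (dot xi xi, dot eta eta).
  by apply: mulr_ge0; [exact: mulr_ge0|exact: Hk0].
have p0 : 0 <= 2 * pi :> R by rewrite mulr_ge0// pi_ge0.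
have mOmE xi eta : measurable_fun setT (fun y : mR => (Om (y ^+ 2 + dot xi xi + dot eta eta - 2 * dot (xi : V) eta))%:E).
  by apply/measurable_EFinP; apply: (measurableT_comp mOm); mfun.
have inner xi eta : (\int[leb R]_y (phi (dot xi xi) * phi (dot eta eta) * Hk k (dot xi xi, dot eta eta) *
            Om (y ^+ 2 + dot xi xi + dot eta eta - 2 * dot (xi : V) eta))%:E <=
    (2 * pi)%:E * (kern k (fun x => phi (dot x x)) xi eta)%:E)%E.
  under eq_integral do rewrite EFinM.
  rewrite ge0_integralZl; [|by []|exact: mOmE|by move=> y _; rewrite lee_fin|by rewrite lee_fin; exact: phk0].
  have -> : (\int[leb R]_y (Om (y ^+ 2 + dot xi xi + dot eta eta - 2 * dot xi eta))%:E =
      \int[leb R]_y (rft g (tcons (y : mR, tsub xi eta)))%:E)%E.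
    apply: eq_integral => y _; rewrite rftE dot_tcons dot_tsub; congr (Om _)%:E; rewrite /=; ring.
  apply: (@le_trans _ _ ((phi (dot xi xi) * phi (dot eta eta) * Hk k (dot xi xi, dot eta eta))%:E *
     (2 * pi * rft g (tsub xi eta))%:E)%E).
    apply: lee_wpmul2l; first by rewrite lee_fin; exact: phk0.
    exact: (rft_descent mg g0 ig ig').
  by rewrite -!EFinM lee_fin /kern /evk /Hk /= le_eqVlt; apply/orP; left; apply/eqP; ring.
have mk := mkern k mphid.
have k0 xi eta : (0 <= (kern k (fun x => phi (dot x x)) xi eta)%:E)%E by rewrite lee_fin kern0.
apply: (@le_trans _ _ (\int[lebV]_xi \int[lebV]_eta ((2 * pi)%:E * (kern k (fun x => phi (dot x x)) xi eta)%:E))%E).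
  have f0 xi eta y : (0 <= (phi (dot xi xi) * phi (dot eta eta) * Hk k (dot xi xi, dot eta eta) *
            Om (y ^+ 2 + dot xi xi + dot eta eta - 2 * dot (xi : V) eta))%:E)%E.
    by rewrite lee_fin; apply: mulr_ge0; [exact: phk0|exact: Om0].
  have mf : measurable_fun setT (fun z : (V * V) => (\int[leb R]_y (phi (dot z.1 z.1) * phi (dot z.2 z.2) * Hk k (dot z.1 z.1, dot z.2 z.2) *
            Om (y ^+ 2 + dot z.1 z.1 + dot z.2 z.2 - 2 * dot z.1 z.2))%:E)%E).
    apply: (@measurable_integral2 _ _ _ _ R _ (fun (z : V * V) (y : mR) => (phi (dot z.1 z.1) * phi (dot z.2 z.2) * Hk k (dot z.1 z.1, dot z.2 z.2) *
            Om (y ^+ 2 + dot z.1 z.1 + dot z.2 z.2 - 2 * dot z.1 z.2))%:E)); last by move=> *; exact: f0.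
    apply/measurable_EFinP; apply: measurable_funM; last by apply: (measurableT_comp mOm); mfun.
    apply: measurable_funM; first by mfun.
    by apply: (measurableT_comp (mHk k)); mfun.
  have mf1 : measurable_fun setT (fun z : V * V => ((2 * pi)%:E * (kern k (fun x => phi (dot x x)) z.1 z.2)%:E)%E).
    by apply: emeasurable_funM; [exact: measurable_cst|].
  have g1 xi eta : (0 <= (2 * pi)%:E * (kern k (fun x => phi (dot x x)) xi eta)%:E)%E by rewrite mule_ge0.
  apply: ge0_le_integral; [by []| | | |].
  - by move=> xi _; apply: integral_ge0 => eta _; apply: integral_ge0.
  - by apply: (@measurable_integral2 _ _ _ _ R _ (fun xi eta : V => _) mf) => *; exact: integral_ge0.
  - by apply: (@measurable_integral2 _ _ _ _ R _ (fun xi eta : V => _) mf1).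
  move=> xi _; apply: ge0_le_integral; [by []|by move=> eta _; exact: integral_ge0| | |by move=> eta _; exact: inner].
  - exact: (measurableT_comp mf (@pair1_measurable _ _ _ _ xi)).
  - exact: (measurableT_comp mf1 (@pair1_measurable _ _ _ _ xi)).
have mi : measurable_fun setT (fun xi : V => \int[lebV]_eta (kern k (fun x => phi (dot x x)) xi eta)%:E)%E.
  by apply: (@measurable_integral2 _ _ _ _ R _ (fun xi eta : V => _) mk).
have -> : (\int[lebV]_xi \int[lebV]_eta ((2 * pi)%:E * (kern k (fun x => phi (dot x x)) xi eta)%:E) =
   (2 * pi)%:E * \int[lebV]_xi \int[lebV]_eta (kern k (fun x => phi (dot x x)) xi eta)%:E)%E.
  rewrite -ge0_integralZl; [|by []|exact: mi|by move=> xi _; exact: integral_ge0|by rewrite lee_fin].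
  apply: eq_integral => xi _; rewrite ge0_integralZl; [by []|by []| |by move=> eta _|by rewrite lee_fin].
  exact: (measurableT_comp mk (@pair1_measurable _ _ _ _ xi)).
rewrite [X in (_ <= X * _)%E]EFinM -muleA; apply: lee_wpmul2l; first by rewrite lee_fin.
by apply: kern_le => // x.
Qed.

Let cut_absint k (a : V' -> R) : measurable_fun setT a -> (\int[lebV']_x (a x ^+ 2)%:E < +oo)%E ->
  absint lebV' (fun x => shellcut psi k (dot x x) * a x).
Proof.
move=> ma ia; have [M M0 cM] := cut_bound cpsi psi0 k.
apply: (@ball_absint _ _ (fun x : V' => shellcut psi k (dot x x)) a k.+1%:R M) => //.
by move=> x; rewrite ger0_norm//; exact: cut_le_ball.
Qed.

Lemma L2_cut_absint k (v : V' -> R[i]) : L2 lebV' v ->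
  absint lebV' (fun x => shellcut psi k (dot x x) * complex.Re (v x)) /\
  absint lebV' (fun x => shellcut psi k (dot x x) * complex.Im (v x)).
Proof.
move=> [[m1 m2] iv]; have mN := measurable_normc2 (conj m1 m2).
split; apply: cut_absint => //; apply: le_lt_trans iv; apply: ge0_le_integral;
  try (first [exact: measurableT | by move=> x _; rewrite lee_fin sqr_ge0 |
   by apply/measurable_EFinP; exact: measurable_funX | exact/measurable_EFinP]).
- by move=> x _; rewrite lee_fin lerDl sqr_ge0.
- by move=> x _; rewrite lee_fin lerDr sqr_ge0.
Qed.

Lemma regularized_estimate k (v : V' -> R[i]) : L2 lebV' v ->
  (\int[lebV' \x leb R]_z (g (dot z.1 z.1) * expR (- (tau * `|z.2|)) *
     normc2 (evolution_trunc psi v k z))%:E <= C%:E * energy lebV' v)%E.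
Proof.
move=> L2v; have [[m1 m2] iv] := L2v; have [[ma ia] [mb ib]] := L2_cut_absint k L2v.
have mN := measurable_normc2 (conj m1 m2).
pose G (x : V') := Num.sqrt (normc2 (v x)).
have mG : measurable_fun setT G by rewrite /G; mfun.
have G0 x : 0 <= G x by exact: sqrtr_ge0.
have G2 x : G x ^+ 2 = normc2 (v x) by rewrite sqr_sqrtr// normc2_ge0.
have iG : (\int[lebV']_x (G x ^+ 2)%:E < +oo)%E by under eq_integral do rewrite G2.
have p0 : 0 <= 2 * pi :> R by rewrite mulr_ge0// pi_ge0.
have A1 : 0 <= 2 * pi * A0 by rewrite mulr_ge0.
have mHk' : measurable_fun setT (Hk k : R * R -> R) := mHk k.
have KC := kernel_compare mOm mHk' Om0 (Hk0 k) (HkC k) A1 (star k) mG G0 iG.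
have EV := evolution_le mg g0 ig' sin0' tau0 rft0' ma mb ia ib.
set c2 := fourier_cst n.+3 ^+ 2 : R.
have c20 : 0 <= c2 by exact: sqr_ge0.
have mp := @measurable_phase R n.+3.
pose a (x : V') := shellcut psi k (dot x x) * complex.Re (v x).
pose b (x : V') := shellcut psi k (dot x x) * complex.Im (v x).
have -> : (\int[lebV' \x leb R]_z (g (dot z.1 z.1) * expR (- (tau * `|z.2|)) *
     normc2 (evolution_trunc psi v k z))%:E =
   c2%:E * \int[lebV' \x leb R]_z (g (dot z.1 z.1) * expR (- (tau * `|z.2|)) *
     (osc_re lebV' (@phase R n.+3) a b z ^+ 2 + osc_im lebV' (@phase R n.+3) a b z ^+ 2))%:E)%E.
  rewrite -ge0_integralZl; [|by []| | |by rewrite lee_fin]; last 2 first.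
  - apply/measurable_EFinP; apply: measurable_funM; first by mfun.
    by apply: measurable_funD; apply: measurable_funX; [exact: measurable_osc_re|exact: measurable_osc_im].
  - by move=> z _; rewrite lee_fin mulr_ge0 ?mulr_ge0 ?expR_ge0// addr_ge0 ?sqr_ge0.
  by apply: eq_integral => z _; rewrite -EFinM normc2_evolution mulrCA.
apply: (@le_trans _ _ (c2%:E * ((2 * pi * A0)%:E * energy lebV' v))%E); last first.
  rewrite muleA -EFinM; apply: lee_wpmul2r; first by apply: integral_ge0 => x _; rewrite lee_fin normc2_ge0.
  rewrite lee_fin /A0 /c2 le_eqVlt; apply/orP; left; apply/eqP.
  have := fourier_cst_sq (R := R) n.+3; have := fourier_cst_sq (R := R) n.+2.
  have := fourier_cst_gt0 (R := R) n.+2.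
  rewrite (exprS _ n.+2); move: (fourier_cst n.+3 ^+ 2) (fourier_cst n.+2) ((2 * pi) ^+ n.+2) => x y t y0 Ey Ex.
  have y2 : y ^+ 2 != 0 by rewrite gt_eqF// exprn_gt0.
  have t0 : t = (y ^+ 2)^-1 by apply: (mulfI y2); rewrite Ey divff.
  transitivity (C * (x * (2 * pi * t))); last by rewrite Ex mulr1.
  by rewrite t0; ring.
apply: lee_wpmul2l; first by rewrite lee_fin.
apply: (le_trans EV); rewrite /energy; under [X in (_ <= _ * X)%E]eq_integral do rewrite -G2.
apply: le_trans KC; rewrite le_eqVlt; apply/orP; left; apply/eqP.
apply: eq_integral => xi _; apply: eq_integral => eta _; congr EFin.
have sq x : Num.sqrt ((shellcut psi k (dot x x) * complex.Re (v x)) ^+ 2 + (shellcut psi k (dot x x) * complex.Im (v x)) ^+ 2) =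
    shellcut psi k (dot x x) * G x.
  rewrite !exprMn -mulrDr sqrtrM ?sqr_ge0// sqrtr_sqr ger0_norm//.
by rewrite !sq /evk rftE dot_tsub /Hk /=; ring.
Qed.

End regularized_estimate.

(** * The weight *)

Section weight.
Context {R : realType}.
Local Notation mR := (measurableTypeR R).
Variable w : R -> R.
Hypotheses (mw : measurable_fun (`]0, +oo[%classic : set R) w)
  (w0 : forall r : R, 0 < r -> 0 <= w r).

Definition wpos (r : R) : R := if 0 < r then w r else 0.

Lemma wpos_ge0 r : 0 <= wpos r.
Proof. by rewrite /wpos; case: ifP => // /w0. Qed.

Lemma measurable_wpos : measurable_fun setT (wpos : mR -> R).
Proof.
rewrite (_ : wpos = w \_ `]0, +oo[%classic).
  by apply/(measurable_restrictT _ (measurable_itv `]0%R, +oo[)).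
by apply/funext => r; rewrite patchE mem_setE in_itv/= andbT.
Qed.

Lemma measurable_w_enorm d (T : measurableType d) n (f : T -> Rn R n) : measurable_fun setT f ->
  measurable_fun setT (fun x => w (enorm (f x))).
Proof.
move=> mf; have mp := measurable_wpos.
rewrite (_ : (fun x => _) = fun x => if 0 < enorm (f x) then wpos (enorm (f x)) else w 0).
  have me : measurable_fun setT (fun x => enorm (f x)) by rewrite /enorm; mfun.
  apply: measurable_fun_ifT; last exact: measurable_cst.
    by apply: measurable_fun_ltr => //; exact: measurable_cst.
  exact: (measurableT_comp mp me).
apply/funext => x; rewrite /wpos; case: ltP => // e0.
by congr w; apply/eqP; rewrite eq_le e0 sqrtr_ge0.
Qed.

Lemma wpos_enorm n (x : Rn R n) : Num.sqrt (dot x x) != 0 -> w (enorm x) = wpos (enorm x).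
Proof. by move=> x0; rewrite /wpos lt_neqAle eq_sym x0 sqrtr_ge0. Qed.

Lemma weighted_energy_wpos n (U : Rn R n.+1 * mR -> R[i]) : measurable_cfun U ->
  weighted_energy w U = weighted_energy wpos U.
Proof.
move=> mU; have mN := measurable_normc2 mU.
have m1 : measurable_fun setT (fun z : Rn R n.+1 * mR => w (enorm z.1)).
  exact: measurable_w_enorm.
have m2 : measurable_fun setT (fun z : Rn R n.+1 * mR => wpos (enorm z.1)).
  by apply: (measurableT_comp measurable_wpos); rewrite /enorm; mfun.
apply: ae_eq_integral => //.
- by apply/measurable_EFinP; exact: measurable_funM.
- by apply/measurable_EFinP; exact: measurable_funM.
have [N [mN' N0 sub]] := ae_sphere n (0 : R).
exists (N `*` setT); split.
- by apply: measurableX.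
- transitivity (@lebesgue_tuple R n.+1 N * leb R setT)%E; first exact: product_measure1E.
  by rewrite N0 mul0e.
move=> z /= nz; split => //; apply: sub => /= z0; apply: nz => _.
by rewrite wpos_enorm.
Qed.

Lemma smoothing_estimate_wpos n (psi : R -> R) C :
  (forall k, measurable_fun setT (shellcut psi k : mR -> R)) ->
  @smoothing_estimate R n.+1 w psi C <-> @smoothing_estimate R n.+1 wpos psi C.
Proof.
move=> mc; have E U v k : L2 (@lebesgue_tuple R n.+1) v -> measurable_cfun U ->
    weighted_energy w (fun z => evolution_trunc psi v k z - U z) =
    weighted_energy wpos (fun z => evolution_trunc psi v k z - U z).
  move=> [mv _] mU; apply: weighted_energy_wpos; apply: measurable_cfunB => //.
  exact: measurable_evolution_trunc.
split=> SE u0 v L2u Fv; have [U [mU cU] WU] := SE u0 v L2u Fv; exists U.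
- split=> //; rewrite (_ : (fun k => _) = fun k => weighted_energy w (fun z => evolution_trunc psi v k z - U z))//.
  by apply/funext => k; rewrite E//; case: Fv.
- by rewrite -weighted_energy_wpos.
- split=> //; rewrite (_ : (fun k => _) = fun k => weighted_energy wpos (fun z => evolution_trunc psi v k z - U z))//.
  by apply/funext => k; rewrite E//; case: Fv.
- by rewrite weighted_energy_wpos.
Qed.

Variable eps : R.
Hypothesis eps0 : 0 < eps.

Definition gweight (q : R) : R := wpos (Num.sqrt q) * expR (- (eps * q)).

Lemma gweight_ge0 q : 0 <= gweight q.
Proof. by rewrite mulr_ge0 ?expR_ge0 ?wpos_ge0. Qed.

Lemma measurable_gweight : measurable_fun setT (gweight : mR -> R).
Proof.
apply: measurable_funM; last by mfun.
exact: (measurableT_comp measurable_wpos (@measurable_sqrt R)).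
Qed.

Lemma gweight_le q : 0 <= q -> gweight q <= wpos (Num.sqrt q).
Proof.
move=> q0; rewrite -[leRHS]mulr1; apply: ler_wpM2l; first exact: wpos_ge0.
by rewrite -expR0 ler_expR oppr_le0 mulr_ge0// ltW.
Qed.

Lemma gaussian_moment m : exists2 K : R, 0 <= K & forall r, 1 <= r -> r ^+ m * expR (- (eps * r ^+ 2)) <= K.
Proof.
exists ((m.+1%:R / eps) ^+ m.+1); first by rewrite exprn_ge0// divr_ge0// ltW.
move=> r r1; have r0 : 0 < r by apply: lt_le_trans r1.
set N := m.+1; have N0 : (0 : R) < N%:R by rewrite ltr0n.
have a0 : 0 < eps * r ^+ 2 / N%:R by rewrite divr_gt0// mulr_gt0// exprn_gt0.
have e1 : (eps * r ^+ 2 / N%:R) ^+ N <= expR (eps * r ^+ 2).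
  have -> : expR (eps * r ^+ 2) = expR (eps * r ^+ 2 / N%:R) ^+ N.
    by rewrite -expRM_natl [X in _ = expR X]mulrC divfK// gt_eqF.
  rewrite lerXn2r ?nnegrE ?expR_ge0 ?(ltW a0)//.
  by apply: le_trans (expR_ge1Dx _); rewrite lerDr.
rewrite expRN; apply: (@le_trans _ _ (r ^+ m * ((eps * r ^+ 2 / N%:R) ^+ N)^-1)).
  apply: ler_wpM2l; first by rewrite exprn_ge0// ltW.
  by rewrite lef_pV2 ?posrE ?expR_gt0 ?exprn_gt0.
rewrite -exprVn invf_div.
have -> : N%:R / (eps * r ^+ 2) = (N%:R / eps) * (r ^+ 2)^-1 by rewrite invfM mulrA.
rewrite exprMn mulrCA -[leRHS]mulr1; apply: ler_wpM2l; first by rewrite exprn_ge0// divr_ge0// ltW.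
rewrite exprVn -exprM ler_pdivrMr ?exprn_gt0// mul1r.
by apply: ler_weXn2l => //; apply: leq_trans (leqnSn m) _; rewrite /N leq_pmull.
Qed.

Variable d : nat.
Hypothesis fin_w : (\int[leb R]_(r in `]0%R, 1%R[) (w r * r ^+ d)%:E +
   \int[leb R]_(r in `]1%R, +oo[) (w r)%:E < +oo)%E.

Let half m (r : R) : R := if 0 < r then r ^+ m * wpos r * expR (- (eps * r ^+ 2)) else 0.

Let mhalf m : measurable_fun setT (half m : mR -> R).
Proof.
have mp := measurable_wpos; rewrite /half; mfun.
Qed.

Let half_fin m : (d <= m)%N -> (\int[leb R]_r (half m r)%:E < +oo)%E.
Proof.
move=> dm; have [K K0 HK] := gaussian_moment m.
pose h1 (r : mR) : R := if (0 < r) && (r < 1) then wpos r * r ^+ d else 0.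
pose h2 (r : mR) : R := if 1 < r then wpos r else 0.
pose h3 (r : mR) : R := if r == 1 then wpos 1 * K else 0.
have mp := measurable_wpos.
have m1 : measurable_fun setT h1 by rewrite /h1; mfun.
have m2 : measurable_fun setT h2 by rewrite /h2; mfun.
have m3 : measurable_fun setT h3.
  rewrite /h3; apply: measurable_fun_ifT; [|exact: measurable_cst|exact: measurable_cst].
  by apply: measurable_fun_eqr; [exact: measurable_id|exact: measurable_cst].
have h10 r : 0 <= h1 r.
  by rewrite /h1; case: ifP => // /andP[r0 _]; rewrite mulr_ge0 ?wpos_ge0// exprn_ge0// ltW.
have h20 r : 0 <= h2 r by rewrite /h2; case: ifP => // _; exact: wpos_ge0.
have h30 r : 0 <= h3 r by rewrite /h3; case: ifP => // _; rewrite mulr_ge0// wpos_ge0.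
have w10 := wpos_ge0.
have hle r : half m r <= h1 r + (K * h2 r + h3 r).
  rewrite /half; case: ifPn => r0; last by rewrite !addr_ge0 ?mulr_ge0.
  have [r1|r1|->] := ltgtP r 1.
  - rewrite /h1 r0 r1 /= -[leLHS]addr0; apply: lerD; last by rewrite addr_ge0 ?mulr_ge0.
    rewrite -[leRHS]mulr1; apply: ler_pM; rewrite ?expR_ge0 ?mulr_ge0 ?exprn_ge0 ?(ltW r0)//.
      rewrite mulrC; apply: ler_wpM2l => //.
      by apply: ler_wiXn2l => //; exact: ltW.
    by rewrite -expR0 ler_expR oppr_le0 mulr_ge0 ?sqr_ge0// ltW.
  - rewrite -[leLHS]add0r; apply: lerD => //; rewrite -[leLHS]addr0; apply: lerD => //.
    rewrite /h2 r1 mulrAC; apply: ler_wpM2r => //; apply: HK; exact: ltW.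
  - rewrite -[leLHS]add0r; apply: lerD => //; rewrite -[leLHS]add0r; apply: lerD; first by rewrite mulr_ge0.
    rewrite /h3 eqxx mulrAC mulrC; apply: ler_wpM2l => //; exact: HK.
have i1 : (\int[leb R]_r (h1 r)%:E = \int[leb R]_(r in `]0%R, 1%R[) (w r * r ^+ d)%:E)%E.
  rewrite [RHS]integral_mkcond; apply: eq_integral => r _; rewrite patchE mem_setE in_itv/= /h1 /wpos.
  by case: (0 < r) => //=; case: (r < 1).
have i2 : (\int[leb R]_r (h2 r)%:E = \int[leb R]_(r in `]1%R, +oo[) (w r)%:E)%E.
  rewrite [RHS]integral_mkcond; apply: eq_integral => r _; rewrite patchE mem_setE in_itv/= andbT /h2 /wpos.
  by case: ltP => // r1; rewrite (lt_trans _ r1).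
have i3 : (\int[leb R]_r (h3 r)%:E = 0)%E.
  transitivity (\int[leb R]_(r in [set (1%R : mR)]) (h3 r)%:E)%E.
    rewrite [RHS]integral_mkcond; apply: eq_integral => r _; rewrite patchE.
    by case: ifPn => //; rewrite notin_setE /= /h3; case: eqP.
  by rewrite integral_set1.
have j1 : (0 <= \int[leb R]_r (h1 r)%:E)%E by apply: integral_ge0 => r _; rewrite lee_fin.
have j2 : (0 <= \int[leb R]_r (h2 r)%:E)%E by apply: integral_ge0 => r _; rewrite lee_fin.
have E1 : measurable_fun setT (fun r : mR => (h1 r)%:E) by exact/measurable_EFinP.
have E2' : measurable_fun setT (fun r : mR => (h2 r)%:E) by exact/measurable_EFinP.
have E2 : measurable_fun setT (fun r : mR => (K * h2 r)%:E).
  by apply/measurable_EFinP; apply: measurable_funM => //; exact: measurable_cst.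
have E3 : measurable_fun setT (fun r : mR => (h3 r)%:E) by exact/measurable_EFinP.
have E23 := emeasurable_funD E2 E3.
apply: (@le_lt_trans _ _ (\int[leb R]_r ((h1 r)%:E + ((K * h2 r)%:E + (h3 r)%:E)))%E).
  apply: ge0_le_integral; [by []| |by apply/measurable_EFinP; exact: mhalf| |].
  - move=> r _; rewrite lee_fin /half; case: ifPn => // r0.
    by rewrite !mulr_ge0 ?expR_ge0// exprn_ge0// ltW.
  - exact: emeasurable_funD.
  - by move=> r _; rewrite -!EFinD lee_fin.
rewrite ge0_integralD; [|by []|by move=> r _; rewrite lee_fin|exact: E1| |exact: E23]; last first.
  by move=> r _; rewrite -EFinD lee_fin addr_ge0 ?mulr_ge0.
rewrite ge0_integralD; [|by []|by move=> r _; rewrite lee_fin mulr_ge0|exact: E2|by move=> r _; rewrite lee_fin|exact: E3].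
under [X in (_ + (X + _))%E]eq_integral do rewrite EFinM.
rewrite ge0_integralZl; [|by []|exact: E2'|by move=> r _; rewrite lee_fin|by rewrite lee_fin].
rewrite i3 adde0 i1 i2; rewrite i1 in j1; rewrite i2 in j2.
apply: lte_add_pinfty; first by apply: le_lt_trans fin_w; exact: leeDl.
rewrite lte_mul_pinfty ?lee_fin//.
by apply: le_lt_trans fin_w; exact: leeDr.
Qed.

Lemma gweight_fin m : (d <= m)%N ->
  (\int[@lebesgue_tuple R m.+1]_x (gweight (dot x x))%:E < +oo)%E.
Proof.
move=> dm; have [c [lam [_ lam0 _ P]]] := polar_radial (R := R) m.
have [c1 [lam1 [_ lam10 _ P1]]] := polar_radial (R := R) 0.
have mgw := measurable_gweight; have gw0 := gweight_ge0.
have mgE : measurable_fun setT (fun q : mR => (gweight q)%:E) by exact/measurable_EFinP.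
rewrite (P (fun q => (gweight q)%:E))//.
pose F (q : mR) : R := Num.sqrt q ^+ m * gweight q.
have mF : measurable_fun setT (fun q => (F q)%:E) by rewrite /F; mfun.
have F0 q : (0 <= (F q)%:E)%E by rewrite lee_fin mulr_ge0// exprn_ge0.
have := P1 (fun q => (F q)%:E) mF F0.
have -> : (\int[leb R]_s ((wt 1 s)%:E * (F s)%:E) = \int[leb R]_s ((wt m.+1 s)%:E * (gweight s)%:E))%E.
  apply: eq_integral => s _; rewrite -!EFinM /F mulrA /wt; case: ifP => _; last by rewrite !mul0r.
  by rewrite expr1 exprS; congr EFin; ring.
have mFr : measurable_fun setT (F : mR -> R) by rewrite /F; mfun.
rewrite ge0_integral_tcons; [|by apply/measurable_EFinP; apply: (measurableT_comp mFr); mfun|by []].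
have T0 (a : mR) : (\int[@lebesgue_tuple R 0]_t (F (dot (tcons (a, t)) (tcons (a, t))))%:E = (F (a ^+ 2))%:E)%E.
  rewrite ge0_integral_tuple0; first by rewrite dot_tcons dot0l addr0 -expr2.
  by apply/measurable_EFinP; apply: (measurableT_comp mFr); mfunv.
under eq_integral do rewrite T0.
have hi := half_fin dm; have mh := mhalf m.
have h0 a : 0 <= half m a.
  rewrite /half; case: ifPn => // r0.
  by rewrite !mulr_ge0 ?expR_ge0 ?wpos_ge0// exprn_ge0// ltW.
have mhN : measurable_fun setT (fun a : mR => half m (- a)) by apply: (measurableT_comp mh); mfun.
have halfE (a : R) : F (a ^+ 2) <= half m a + half m (- a).
  have FE : F (a ^+ 2) = `|a| ^+ m * wpos `|a| * expR (- (eps * a ^+ 2)).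
    by rewrite /F /gweight sqrtr_sqr mulrA.
  move: FE; have [a0|a0|<-] := ltgtP 0 a => FE.
  - by rewrite FE {1}/half a0 gtr0_norm// lerDl.
  - rewrite FE {2}/half oppr_gt0 a0 ltr0_norm// sqrrN lerDr//.
  - by rewrite FE normr0 /wpos ltxx mulr0 mul0r addr_ge0.
have H : (\int[leb R]_a (F (a ^+ 2))%:E < +oo)%E.
  apply: (@le_lt_trans _ _ (\int[leb R]_a ((half m a)%:E + (half m (- a))%:E))%E).
    apply: ge0_le_integral; [by []|by []| | |by move=> a _; rewrite -EFinD lee_fin].
    - by apply/measurable_EFinP; apply: (measurableT_comp mFr); mfun.
    - by apply: emeasurable_funD; exact/measurable_EFinP.
  rewrite ge0_integralD; [|by []|by move=> a _; rewrite lee_fin|exact/measurable_EFinP|by move=> a _; rewrite lee_fin|exact/measurable_EFinP].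
  rewrite (ge0_integral_opp (f := fun a => (half m a)%:E)); [|exact/measurable_EFinP|by move=> a; rewrite lee_fin].
  exact: lte_add_pinfty.
move=> E; move: H; rewrite E; set I := (integral _ _ _) => H.
have -> : (lam%:E * I = (lam / lam1)%:E * (lam1%:E * I))%E.
  by rewrite muleA -EFinM divfK// gt_eqF.
apply: lte_mul_pinfty => //; first by rewrite lee_fin divr_ge0// ltW.
Qed.

Lemma integral_w_enorm n (f : Rn R n.+1 -> R) : measurable_fun setT f ->
  \int[@lebesgue_tuple R n.+1]_x (w (enorm x) * expR (- (eps * enorm x ^+ 2)) * f x) =
  \int[@lebesgue_tuple R n.+1]_x (gweight (dot x x) * f x).
Proof.
move=> mf; apply: (congr1 fine); apply: ae_eq_integral; [exact: measurableT| | |].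
- apply/measurable_EFinP; apply: measurable_funM => //; apply: measurable_funM.
    exact: (@measurable_w_enorm _ _ _ id).
  by rewrite /enorm; mfun.
- apply/measurable_EFinP; apply: measurable_funM => //.
  by apply: (measurableT_comp measurable_gweight); mfun.
apply: filterS (ae_sphere n (0 : R)) => x x0 _; rewrite wpos_enorm//.
by rewrite /gweight /enorm sqr_sqrtr ?dot_ge0.
Qed.

Lemma radial_fourier_rft n : radial_fourier_ge0 n.+1 w ->
  (forall z : Rn R n.+1, 0 <= rft gweight z) /\
  (forall z : Rn R n.+1, \int[@lebesgue_tuple R n.+1]_x (gweight (dot x x) * sin (dot z x)) = 0).
Proof.
move=> H; have key (z : Rn R n.+1) : 0 <= Complex (rft gweight z)
    (\int[@lebesgue_tuple R n.+1]_x (gweight (dot x x) * sin (dot z x))).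
  have := H eps (tscale (-1) z) eps0; rewrite /cintegral.
  have dE x : - dot x (tscale (-1) z) = dot z x by rewrite dotC dot_tscalel; ring.
  have -> : Rintegral (@lebesgue_tuple R n.+1) setT (fun x => complex.Re ((w (enorm x))%:C * (expR (- (eps * enorm x ^+ 2)))%:C *
         expi (- dot x (tscale (-1) z)))%C) = rft gweight z.
    rewrite /rft -integral_w_enorm; last by mfun.
    by apply: eq_Rintegral => x _; rewrite dE /expi /=; ring.
  have -> : Rintegral (@lebesgue_tuple R n.+1) setT (fun x => complex.Im ((w (enorm x))%:C * (expR (- (eps * enorm x ^+ 2)))%:C *
         expi (- dot x (tscale (-1) z)))%C) = \int[@lebesgue_tuple R n.+1]_x (gweight (dot x x) * sin (dot z x)).
    rewrite -integral_w_enorm; last by mfun.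
    by apply: eq_Rintegral => x _; rewrite dE /expi /=; ring.
  by [].
by split=> z; have := key z; rewrite lecE /= => /andP[/eqP].
Qed.

End weight.

(** * Completeness *)

Lemma geometric_increments_cvg (R : realType) (x : nat -> R) (A : R) :
  (forall j, `|x j.+1 - x j| <= A * 2^-1 ^+ j) -> cvgn x.
Proof.
move=> H; have A0 : 0 <= A.
  by have := le_trans (normr_ge0 _) (H 0%N); rewrite expr0 mulr1.
have cs : cvgn (series (telescope x)).
  apply: normed_cvg; apply: (@series_le_cvg _ _ (geometric A 2^-1)).
  - by move=> n; exact: normr_ge0.
  - by move=> n; rewrite /geometric /= mulr_ge0// exprn_ge0// invr_ge0.
  - by move=> n; exact: H.
  - by apply: is_cvg_geometric_series; rewrite ger0_norm ?invr_ge0// invf_lt1// ltr1n.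
rewrite (_ : x = fun n => x 0%N + series (telescope x) n).
  by apply: is_cvgD => //; exact: is_cvg_cst.
by apply/funext => n; exact: eq_sum_telescope.
Qed.

Section riesz_fischer.
Context {R : realType} d (T : measurableType d) (mu : {measure set T -> \bar R}).
Variables (om : T -> R) (F : nat -> T -> R[i]) (e : nat -> \bar R).
Hypotheses (mom : measurable_fun setT om) (om0 : forall x, 0 <= om x)
  (mF : forall m, measurable_cfun (F m))
  (Fe : forall m k, (m <= k)%N -> (\int[mu]_x (om x * normc2 (F k x - F m x))%:E <= e m)%E)
  (e0 : e @ \oo --> 0%E).

(* Increments of size 8^-j make the sum of 4^j times the increments converge
   almost everywhere. *)
Let subsequence : exists phi : nat -> nat,
  [/\ forall j, (phi j <= phi j.+1)%N, forall j, (j <= phi j)%N &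
      forall j, (e (phi j) <= (8^-1 ^+ j)%:E)%E].
Proof.
have H j : exists N, forall m, (N <= m)%N -> (e m <= (8^-1 ^+ j)%:E)%E.
  have j0 : (0 < (8^-1 ^+ j)%:E :> \bar R)%E by rewrite lte_fin exprn_gt0.
  have nb : nbhs (0%E : \bar R) [set y | (y < (8^-1 ^+ j)%:E)%E].
    by apply: open_nbhs_nbhs; split => //; exact: open_ereal_lt_ereal.
  have [N _ HN] := (@e0 _ nb).
  by exists N => m Nm; apply: ltW; exact: HN.
have [N HN] := choice H.
exists (fun j => ((\sum_(i < j.+1) N i) + j)%N); split=> j.
- by rewrite [X in (_ <= X + _)%N]big_ord_recr /= addnS leqW// leq_add2r leq_addr.
- exact: leq_addl.
- by apply: HN; rewrite big_ord_recr /= addnAC leq_addl.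
Qed.

Lemma riesz_fischer : exists2 U : T -> R[i], measurable_cfun U &
  (\int[mu]_x (om x * normc2 (F m x - U x))%:E)%E @[m --> \oo] --> 0%E.
Proof.
have [phi [phiS phi_ge phi_e]] := subsequence.
pose D j z := normc2 (F (phi j.+1) z - F (phi j) z).
have mD j : measurable_fun setT (D j) by apply: measurable_normc2; exact: measurable_cfunB.
pose f j z : \bar R := (4 ^+ j * (om z * D j z))%:E.
have f0 j z : (0 <= f j z)%E by rewrite lee_fin mulr_ge0 ?exprn_ge0// mulr_ge0 ?normc2_ge0.
have mf j : measurable_fun setT (f j).
  apply/measurable_EFinP; apply: measurable_funM; first exact: measurable_cst.
  exact: measurable_funM.
have fj j : (\int[mu]_z f j z <= (2 / (2 ^ j.+1)%:R)%:E)%E.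
  rewrite /f; under eq_integral do rewrite EFinM.
  rewrite ge0_integralZl; [|by []| | |by rewrite lee_fin exprn_ge0]; last 2 first.
  - by apply/measurable_EFinP; exact: measurable_funM.
  - by move=> z _; rewrite lee_fin mulr_ge0 ?normc2_ge0.
  apply: (@le_trans _ _ ((4 ^+ j)%:E * (8^-1 ^+ j)%:E)%E).
    apply: lee_wpmul2l; first by rewrite lee_fin exprn_ge0.
    exact: le_trans (Fe (phiS j)) (phi_e j).
  rewrite -EFinM lee_fin -exprMn natrX exprS invfM mulrA divff// mul1r.
  by rewrite -exprVn; apply: lerXn2r; rewrite ?nnegrE; lra.
have iS : (\int[mu]_z (\sum_(j <oo) f j z) <= 2%:E)%E.
  rewrite integral_nneseries//.
  apply: (le_trans _ (@epsilon_trick0 R 2 xpredT _)) => //.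
  by apply: lee_nneseries => [j _ _|j _]; [exact: integral_ge0|exact: fj].
have S0 z : (0 <= \sum_(j <oo) f j z)%E by apply: nneseries_ge0.
have mS : measurable_fun setT (fun z => \sum_(j <oo) f j z)%E.
  exact: (@ge0_emeasurable_sum _ _ _ setT f xpredT).
have Sfin : {ae mu, forall z, (\sum_(j <oo) f j z)%E \is a fin_num}.
  have iS' : mu.-integrable setT (fun z => \sum_(j <oo) f j z)%E.
    apply/integrableP; split => //.
    by under eq_integral do rewrite gee0_abs//; rewrite (le_lt_trans iS)// ltry.
  by apply: filterS (integrable_ae measurableT iS') => z; apply.
have incr z : (\sum_(j <oo) f j z)%E \is a fin_num -> 0 < om z ->
    exists A, forall j, D j z <= (A * 2^-1 ^+ j) ^+ 2 /\ 0 <= A * 2^-1 ^+ j.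
  move=> Sz oz; set s := fine (\sum_(j <oo) f j z)%E.
  have s0 : 0 <= s by exact: fine_ge0.
  exists (Num.sqrt (s / om z)) => j; split; last by rewrite mulr_ge0 ?sqrtr_ge0// exprn_ge0// invr_ge0.
  have fs : (f j z <= s%:E)%E.
    rewrite fineK//; apply: le_trans (@nneseries_lim_ge _ (f ^~ z) xpredT 0 j.+1 _) => //.
    by rewrite big_nat_recr//= leeDr// sume_ge0.
  rewrite exprMn sqr_sqrtr ?divr_ge0// ?(ltW oz)//.
  rewrite mulrAC ler_pdivlMr// -exprM mulnC exprM.
  rewrite /f lee_fin in fs; rewrite mulrC.
  have e4 : 0 < (4 : R) ^+ j by rewrite exprn_gt0.
  rewrite -(ler_pM2l e4); apply: (le_trans fs).
  by rewrite mulrCA -exprMn (_ : 4 * 2^-1 ^+ 2 = 1) ?expr1n ?mulr1//; field.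
have comp_cvg (p : R[i] -> R) z : (forall x y, p (x - y) = p x - p y) -> (forall x, p x ^+ 2 <= normc2 x) ->
    (\sum_(j <oo) f j z)%E \is a fin_num -> 0 < om z -> cvgn (fun j => p (F (phi j) z)).
  move=> pB p2 Sz oz; have [A HA] := incr z Sz oz.
  apply: (@geometric_increments_cvg _ _ A) => j; have [DA A0] := HA j.
  rewrite -[leRHS]ger0_norm// -ler_sqr ?nnegrE// !real_normK ?num_real//.
  by rewrite -pB; apply: le_trans (p2 _) DA.
pose u (p : R[i] -> R) z := fine (limn_esup (fun j => (p (F (phi j) z))%:E)).
have mu' (p : R[i] -> R) : (forall m, measurable_fun setT (fun z => p (F m z))) -> measurable_fun setT (u p).
  move=> mp; apply: (measurableT_comp (fine_measurable measurableT)).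
  by apply: measurable_fun_limn_esup => j; apply/measurable_EFinP.
have ulim (p : R[i] -> R) z : cvgn (fun j => p (F (phi j) z)) -> p (F (phi j) z) @[j --> \oo] --> u p z.
  move=> cp; rewrite /u; have /cvg_limn_einf_sup[_ ->//] : (fun j => (p (F (phi j) z))%:E) @ \oo --> (limn (fun j => p (F (phi j) z)))%:E.
  by apply: cvg_EFin => //; exact: nearW.
pose U z := Complex (u (@complex.Re R) z) (u (@complex.Im R) z).
have mU : measurable_cfun U by split; apply: mu' => m; have [] := mF m.
exists U => //.
have bound m : (\int[mu]_x (om x * normc2 (F m x - U x))%:E <= e m)%E.
  have sym (x y : R[i]) : normc2 (x - y) = normc2 (y - x).
    by rewrite /normc2 !Re_sub !Im_sub; ring.
  have mG k : measurable_fun setT (fun z => (om z * normc2 (F m z - F k z))%:E).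
    by apply/measurable_EFinP; apply: measurable_funM => //; apply: measurable_normc2; exact: measurable_cfunB.
  apply: (@fatou_le _ _ _ mu (fun j z => (om z * normc2 (F m z - F (phi (j + m)%N) z))%:E) _ (fun=> e m)).
  - by move=> j; exact: mG.
  - by move=> j z; rewrite lee_fin mulr_ge0 ?normc2_ge0.
  - by apply/measurable_EFinP; apply: measurable_funM => //; apply: measurable_normc2; exact: measurable_cfunB.
  - by move=> z; rewrite lee_fin mulr_ge0 ?normc2_ge0.
  - apply: filterS Sfin => z Sz; apply: cvg_EFin; first exact: nearW.
    have [oz|oz] := ltP 0 (om z); last first.
      have -> : om z = 0 by apply/eqP; rewrite eq_le oz om0.
      by rewrite mul0r; under eq_fun do rewrite mul0r; exact: cvg_cst.
    apply: cvgM; first exact: cvg_cst.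
    have X2 (a : nat -> R) (b : R) : a @ \oo --> b -> a j ^+ 2 @[j --> \oo] --> b ^+ 2.
      by move=> ab; rewrite expr2; under eq_fun do rewrite expr2; exact: cvgM.
    have shift (p : R[i] -> R) : cvgn (fun j => p (F (phi j) z)) -> p (F (phi (j + m)%N) z) @[j --> \oo] --> u p z.
      by move=> cp; have := ulim p z cp; rewrite -(cvg_shiftn m).
    apply: cvgD; apply: X2.
      rewrite Re_sub; under eq_fun do rewrite Re_sub.
      apply: cvgB; first exact: cvg_cst.
      by apply: (shift (@complex.Re R)); apply: comp_cvg => //; [exact: Re_sub|move=> x; rewrite lerDl sqr_ge0].
    rewrite Im_sub; under eq_fun do rewrite Im_sub.
    apply: cvgB; first exact: cvg_cst.
    by apply: (shift (@complex.Im R)); apply: comp_cvg => //; [exact: Im_sub|move=> x; rewrite lerDr sqr_ge0].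
  - move=> j; apply: le_trans (@Fe m (phi (j + m)%N) _).
      by rewrite le_eqVlt; apply/orP; left; apply/eqP; apply: eq_integral => z _; rewrite sym.
    by apply: leq_trans (phi_ge _); exact: leq_addl.
  - exact: cvg_cst.
apply: (squeeze_cvge _ (cvg_cst 0%E) e0); apply: nearW => m; rewrite bound andbT.
by apply: integral_ge0 => z _; rewrite lee_fin mulr_ge0 ?normc2_ge0.
Qed.

End riesz_fischer.

Lemma energy_fourier_le (R : realType) n (u v : Rn R n -> R[i]) : L2 (@lebesgue_tuple R n) u -> is_fourier u v ->
  (energy (@lebesgue_tuple R n) v <= energy (@lebesgue_tuple R n) u)%E.
Proof.
move=> [mu iu] [[mv iv] cv].
have energy1 w : energy (@lebesgue_tuple R n) w = (\int[@lebesgue_tuple R n]_x (1 * normc2 (w x))%:E)%E.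
  by apply: eq_integral => x _; rewrite mul1r.
rewrite (energy1 v); apply: (@weighted_limit_ge _ _ _ (@lebesgue_tuple R n) (fun=> 1) _ _ (fourier_trunc u)) => //.
- by move=> k; exact: measurable_fourier_trunc.
- by under eq_fun do rewrite -(energy1 (fun x => fourier_trunc u _ x - v x)).
move=> k; rewrite -energy1.
have [m1 m2] := mu; have mN := measurable_normc2 mu.
have i01 (x : Rn R n) : `|inball k x| <= 1 * (if Num.sqrt (dot x x) <= k%:R then 1 else 0 : R) :> R.
  by rewrite /inball /enorm mul1r; case: ifP; rewrite ?normr1 ?normr0.
have lt1 : (\int[@lebesgue_tuple R n]_x (complex.Re (u x) ^+ 2)%:E < +oo)%E.
  apply: le_lt_trans iu; apply: ge0_le_integral; [by []|by move=> x _; rewrite lee_fin sqr_ge0| |exact/measurable_EFinP|].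
    by apply/measurable_EFinP; exact: measurable_funX.
  by move=> x _; rewrite lee_fin lerDl sqr_ge0.
have lt2 : (\int[@lebesgue_tuple R n]_x (complex.Im (u x) ^+ 2)%:E < +oo)%E.
  apply: le_lt_trans iu; apply: ge0_le_integral; [by []|by move=> x _; rewrite lee_fin sqr_ge0| |exact/measurable_EFinP|].
    by apply/measurable_EFinP; exact: measurable_funX.
  by move=> x _; rewrite lee_fin lerDr sqr_ge0.
have [ma ia] := ball_absint ler01 (@measurable_inball R n k) m1 i01 lt1.
have [mb ib] := ball_absint ler01 (@measurable_inball R n k) m2 i01 lt2.
have pl := plancherel_le (or_intror (erefl (-1 : R))) ma mb ia ib.
set a := fun x => _ in ma ia pl; set b := fun x => _ in mb ib pl.
have mp : measurable_fun setT (fun z : Rn R n * Rn R n => -1 * dot z.2 z.1) by mfun.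
apply: (@le_trans _ _ ((fourier_cst n ^+ 2)%:E * (((2 * pi) ^+ n)%:E * \int[@lebesgue_tuple R n]_x (a x ^+ 2 + b x ^+ 2)%:E))%E).
  apply: le_trans (lee_wpmul2l _ pl); last by rewrite lee_fin sqr_ge0.
  rewrite -ge0_integralZl; [|by []| |by move=> x _; rewrite lee_fin addr_ge0 ?sqr_ge0|by rewrite lee_fin sqr_ge0]; last first.
    apply/measurable_EFinP; apply: measurable_funD; apply: measurable_funX.
      exact: (@measurable_osc_re _ _ _ _ _ _ (fun xi x : Rn R n => -1 * dot x xi)).
    exact: (@measurable_osc_im _ _ _ _ _ _ (fun xi x : Rn R n => -1 * dot x xi)).
  rewrite le_eqVlt; apply/orP; left; apply/eqP; apply: eq_integral => xi _.
  by rewrite -EFinM fourier_truncE /normc2 /= !exprMn mulrDr.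
rewrite muleA -EFinM fourier_cst_sq mul1e.
apply: ge0_le_integral; [by []|by move=> x _; rewrite lee_fin addr_ge0 ?sqr_ge0| |exact/measurable_EFinP|].
  by apply/measurable_EFinP; apply: measurable_funD; exact: measurable_funX.
move=> x _; rewrite lee_fin /a /b /normc2 /inball; case: ifP => _; rewrite ?mul1r ?mul0r//.
by rewrite expr0n addr0 addr_ge0 ?sqr_ge0.
Qed.

Section lift.
Context {R : realType} (n : nat).
Local Notation V' := (Rn R n.+3).
Local Notation lebV' := (@lebesgue_tuple R n.+3).
Local Notation mR := (measurableTypeR R).
Variables (w psi : R -> R) (C : R).
Hypotheses (mw : measurable_fun (`]0, +oo[%classic : set R) w)
  (w0 : forall r : R, 0 < r -> 0 <= w r)
  (fin_w : (\int[leb R]_(r in `]0%R, 1%R[) (w r * r ^+ n.+1)%:E +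
   \int[leb R]_(r in `]1%R, +oo[) (w r)%:E < +oo)%E)
  (pos : radial_fourier_ge0 n.+2 w) (pos' : radial_fourier_ge0 n.+3 w)
  (cpsi : {within `]0, +oo[%classic, continuous psi})
  (psi0 : forall r : R, 0 < r -> 0 <= psi r)
  (C0 : 0 <= C) (SE : @smoothing_estimate R n.+2 w psi C).

Let mc k : measurable_fun setT (shellcut psi k : mR -> R). Proof. exact: measurable_cut. Qed.

Let om (z : V' * mR) : R := wpos w (enorm z.1).
Let om0 z : 0 <= om z. Proof. exact: wpos_ge0. Qed.
Let mom : measurable_fun setT om.
Proof. by apply: (measurableT_comp (measurable_wpos mw)); rewrite /enorm; mfun. Qed.

Let evolution_estimate k (v : V' -> R[i]) : L2 lebV' v ->
  (weighted_energy (wpos w) (evolution_trunc psi v k) <= C%:E * energy lebV' v)%E.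
Proof.
move=> L2v; have [mv _] := L2v.
have mN := measurable_normc2 (measurable_evolution_trunc (mc k) mv).
have SE' := (smoothing_estimate_wpos mw n.+1 C mc).1 SE.
pose ka (j : nat) : R := j.+1%:R^-1.
have ka0 j : 0 < ka j by rewrite invr_gt0.
have expto1 (a : R) : expR (- (ka j * a)) @[j --> \oo] --> (1 : R).
  rewrite -expR0; apply: (continuous_cvg_seq (h := expR)); first exact: continuous_expR.
  rewrite -oppr0 -(mul0r a); apply: cvgN; apply: cvgM; last exact: cvg_cst.
  exact: cvg_harmonic.
apply: (@fatou_le_cst _ _ _ (lebV' \x leb R)%E (fun j z => (gweight w (ka j) (dot z.1 z.1) *
  expR (- (ka j * `|z.2|)) * normc2 (evolution_trunc psi v k z))%:E)).
- move=> j; apply/measurable_EFinP; apply: measurable_funM => //.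
  apply: measurable_funM; last by mfun.
  by apply: (measurableT_comp (measurable_gweight mw (ka j))); mfun.
- move=> j z; rewrite lee_fin; apply: mulr_ge0; last exact: normc2_ge0.
  by apply: mulr_ge0; [exact: gweight_ge0|exact: expR_ge0].
- by apply/measurable_EFinP; exact: measurable_funM.
- by move=> z; rewrite lee_fin; apply: mulr_ge0; [exact: om0|exact: normc2_ge0].
- move=> z; apply: cvg_EFin; first exact: nearW.
  apply: cvgM; last exact: cvg_cst.
  have -> : wpos w (enorm z.1) = wpos w (enorm z.1) * 1 * 1 by rewrite !mulr1.
  apply: cvgM; last exact: expto1.
  by apply: cvgM; [exact: cvg_cst|exact: expto1].
- move=> j; have [r1 s1] := radial_fourier_rft mw (ka0 j) pos.
  have [r2 s2] := radial_fourier_rft mw (ka0 j) pos'.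
  apply: (regularized_estimate cpsi psi0 (measurable_wpos mw) (wpos_ge0 w0)
    (measurable_gweight mw (ka j)) (gweight_ge0 w0 (ka j)) _ _ (gweight_le w0 (ka0 j)) s1 r1 s2 r2 (ka0 j) C0 SE' k L2v).
    exact: (gweight_fin mw w0 (ka0 j) fin_w).
  exact: (gweight_fin mw w0 (ka0 j) fin_w).
Qed.

Let inshell m (x : V') : bool := (m.+1%:R^-1 <= enorm x) && (enorm x <= m.+1%:R).

Let outer (v : V' -> R[i]) m (x : V') : R[i] := if inshell m x then 0 else v x.

Let measurable_inshell m : measurable_fun setT (inshell m).
Proof. by rewrite /inshell /enorm; mfun. Qed.

Let L2_outer v m : L2 lebV' v -> L2 lebV' (outer v m).
Proof.
move=> [mv iv]; have [m1 m2] := mv; have mi := measurable_inshell m.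
have mo : measurable_cfun (outer v m).
  split.
    rewrite (_ : (fun x => _) = fun x => if inshell m x then 0 else complex.Re (v x)); last first.
      by apply/funext => x; rewrite /outer; case: ifP.
    by apply: measurable_fun_ifT => //; exact: measurable_cst.
  rewrite (_ : (fun x => _) = fun x => if inshell m x then 0 else complex.Im (v x)); last first.
    by apply/funext => x; rewrite /outer; case: ifP.
  by apply: measurable_fun_ifT => //; exact: measurable_cst.
split=> //; apply: le_lt_trans iv; apply: ge0_le_integral; [by []| | | |].
- by move=> x _; rewrite lee_fin normc2_ge0.
- by apply/measurable_EFinP; exact: measurable_normc2.
- by apply/measurable_EFinP; exact: measurable_normc2.
- move=> x _; rewrite lee_fin /outer; case: ifP => // _.
  by rewrite {1}/normc2 /= expr0n addr0 normc2_ge0.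
Qed.

Let evolution_outer v m k z : L2 lebV' v -> (m <= k)%N ->
  evolution_trunc psi v k z - evolution_trunc psi v m z = evolution_trunc psi (outer v m) k z.
Proof.
move=> L2v mk; have mp := @measurable_phase R n.+3.
have [a1 b1] := L2_cut_absint cpsi psi0 k L2v; have [a2 b2] := L2_cut_absint cpsi psi0 m L2v.
have cutE (p : R[i] -> R) : p 0 = 0 ->
    (fun x : V' => shellcut psi k (dot x x) * p (outer v m x)) =
    fun x => shellcut psi k (dot x x) * p (v x) - shellcut psi m (dot x x) * p (v x).
  move=> p0; apply/funext => x; rewrite /outer /inshell; case: ifPn => [xm|xm]; last first.
    by rewrite [shellcut psi m _]/shellcut (negbTE xm) mul0r subr0.
  rewrite p0 mulr0 /shellcut xm ifT ?subrr//.
  move: xm => /andP[x1 x2]; apply/andP; split.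
    by apply: le_trans x1; rewrite lef_pV2 ?posrE// ler_nat.
  by apply: (le_trans x2); rewrite ler_nat.
rewrite !evolution_truncE; rewrite (cutE (@complex.Re R))// (cutE (@complex.Im R))//.
rewrite (osc_reB mp)// (osc_imB mp)//.
by apply/eqP; rewrite eq_complex /=; apply/andP; split; apply/eqP; ring.
Qed.

Let outer_cvg v : L2 lebV' v -> (C%:E * energy lebV' (outer v m))%E @[m --> \oo] --> 0%E.
Proof.
move=> L2v; have [mv iv] := L2v; rewrite -(mule0 C%:E); apply: cvgeZl => //.
have -> : (0%E = \int[lebV']_x (0 : R)%:E :> \bar R)%E by rewrite integral0.
apply: (@dominated_cvg_real _ _ _ lebV' (fun m x => normc2 (outer v m x)) (fun=> 0) (fun x => normc2 (v x))).
- by move=> m; apply: measurable_normc2; have [] := L2_outer m L2v.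
- exact: measurable_cst.
- exact: measurable_normc2.
- apply: filterS (ae_sphere n.+2 (0 : R)) => x x0; apply: cvg_near_cst.
  have ex : 0 < enorm x by rewrite lt_neqAle eq_sym x0 sqrtr_ge0.
  near=> m; rewrite /outer ifT; first by rewrite /normc2 /= expr0n addr0.
  apply/andP; split.
    rewrite invf_ple ?posrE//; apply: (@le_trans _ _ m%:R); last by rewrite ler_nat.
    by near: m; exact: nbhs_infty_ger.
  apply: (@le_trans _ _ m%:R); last by rewrite ler_nat.
  by near: m; exact: nbhs_infty_ger.
- move=> m x; rewrite ger0_norm ?normc2_ge0// /outer; case: ifP => // _.
  by rewrite {1}/normc2 /= expr0n addr0 normc2_ge0.
- exact: iv.
Unshelve. all: by end_near. Qed.

Lemma smoothing_estimate_lift : @smoothing_estimate R n.+3 w psi C.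
Proof.
apply/(smoothing_estimate_wpos mw n.+2 C mc) => u v L2u Fv.
have [L2v _] := Fv; have [mv _] := L2v.
have mF k := measurable_evolution_trunc (mc k) mv.
have Fe m k : (m <= k)%N -> (\int[lebV' \x leb R]_z
    (om z * normc2 (evolution_trunc psi v k z - evolution_trunc psi v m z))%:E <= C%:E * energy lebV' (outer v m))%E.
  move=> mk; apply: (@le_trans _ _ (weighted_energy (wpos w) (evolution_trunc psi (outer v m) k))).
    by rewrite le_eqVlt; apply/orP; left; apply/eqP; apply: eq_integral => z _; rewrite evolution_outer.
  by apply: evolution_estimate; exact: L2_outer.
have [U mU cU] := @riesz_fischer _ _ _ (lebV' \x leb R)%E om (evolution_trunc psi v)
  (fun m => C%:E * energy lebV' (outer v m))%E mom om0 mF Fe (outer_cvg L2v).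
exists U; first by [].
apply: (@le_trans _ _ (C%:E * energy lebV' v)%E); last first.
  by apply: lee_wpmul2l; [rewrite lee_fin|exact: energy_fourier_le].
apply: (@weighted_limit_ge _ _ _ (lebV' \x leb R)%E om mom om0 (evolution_trunc psi v) U) => // k.
exact: evolution_estimate.
Qed.

End lift.

Theorem theorem1p3 (R : realType) (d : nat) (w : R -> R) :
  (2 <= d)%N ->
  measurable_fun (`]0, +oo[%classic : set R) w ->
  (forall r : R, 0 < r -> 0 <= w r) ->
  (\int[@lebesgue_measure R]_(r in `]0%R, 1%R[) (w r * r ^+ d.-1)%:E +
   \int[@lebesgue_measure R]_(r in `]1%R, +oo[) (w r)%:E < +oo)%E ->
  radial_fourier_ge0 d w ->
  radial_fourier_ge0 d.+1 w ->
  forall psi : R -> R,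
  {within `]0, +oo[%classic, continuous psi} ->
  (forall r : R, 0 < r -> 0 <= psi r) ->
  (smoothing_constant d.+1 w psi <= smoothing_constant d w psi)%E.
Proof.
case: d => [|[|n]] // _ mw w0 fin_w pos pos' psi cpsi psi0.
apply: le_ereal_inf => _ [C [C0 SE] <-]; exists C => //; split => //.
exact: smoothing_estimate_lift SE.
Qed.
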